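(* Let $k$ be an algebraically closed field and $\Lambda$ an indecomposable finite dimensional selfinjective $k$-algebra with Jacobson radical $\mathfrak{r}$. Let $H$ be a graded subalgebra of the Hochschild cohomology ring $\mathrm{HH}^*(\Lambda)$ such that $H$ is a commutative Noetherian ring with $H^0=\mathrm{HH}^0(\Lambda)=Z(\Lambda)$. Assume that $M$ is an indecomposable periodic finitely generated left $\Lambda$-module. If $\mathrm{Ext}^*_\Lambda(M,M)$ is a finitely generated $H$-module, then the variety $V_H(M)$ of $M$ is a line.
   Context: $\mathrm{HH}^*(\Lambda)=\bigoplus_{i\ge 0}\mathrm{Ext}^i_{\Lambda^e}(\Lambda,\Lambda)$ with $\Lambda^e=\Lambda\otimes_k\Lambda^{\mathrm{op}}$. For finitely generated left $\Lambda$-modules $M,N$, $\mathrm{Ext}^*_\Lambda(M,N)=\bigoplus_{i\ge 0}\mathrm{Ext}^i_\Lambda(M,N)$ is a graded $\mathrm{HH}^*(\Lambda)$-module (hence an $H$-module) via the graded ring homomorphism $\mathrm{HH}^*(\Lambda)\to\mathrm{Ext}^*_\Lambda(M,M)$ induced by $-\otimes_\Lambda M$ followed by Yoneda product. The variety of $M$ is $V_H(M)=\{\mathfrak{m}\in\mathrm{MaxSpec}\,H\mid \mathrm{Ann}_H\mathrm{Ext}^*_\Lambda(M,\Lambda/\mathfrak{r})\subseteq\mathfrak{m}\}$, equivalently the set of maximal ideals containing $\mathrm{Ann}_H\mathrm{Ext}^*_\Lambda(M,M)$. A module $M$ is periodic if $\Omega^n_\Lambda(M)\simeq M$ for some $n\ge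 1$, where $\Omega_\Lambda$ is the syzygy (kernel of a projective cover). A line is a closed homogeneous (i.e. defined by a homogeneous ideal) irreducible subvariety of $\mathrm{MaxSpec}\,H$ of dimension one. *)

(* Defs.v *)
From HB Require Import structures.
From mathcomp Require Import all_boot all_order all_algebra all_field.
From mathcomp Require Import ring_quotient generic_quotient boolp classical_sets functions.
Set Implicit Arguments. Unset Strict Implicit. Unset Printing Implicit Defensive.
Import GRing.Theory.
Local Open Scope ring_scope.
Local Open Scope quotient_scope.

(* Let A be an algebra over a field k. The bar resolution of A over its enveloping algebra has
   Bar_n = A (x) A^(x)n (x) A, and for an A-bimodule X
     Hom_(A (x) A^op)(Bar_n, X) = { k-multilinear maps A^n -> X }.
   For a left A-module M, Bar (x)_A M is a projective resolution of M and
     Hom_A(Bar_n (x)_A M, N) = { k-multilinear maps A^n -> Hom_k(M, N) }.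
   Ext over A (x) A^op and over A is computed with these two resolutions.
   Cochains of all degrees are packed in one function on sequences: its
   restriction to sequences of size n is the component of degree n. *)

Definition contract (A : pzRingType) (s : seq A) (i : nat) : seq A :=
  take i s ++ s`_i * s`_i.+1 :: drop i.+2 s.

Section BarDifferential.
Variables (A : pzRingType) (X : lmodType A) (act : X -> A -> X).

(* (d f)(a_1, ..., a_(n+1)) = a_1 f(a_2, ..., a_(n+1))
     + \sum_(1 <= i <= n) (-1)^i f(a_1, ..., a_i a_(i+1), ..., a_(n+1))
     + (-1)^(n+1) f(a_1, ..., a_n) . a_(n+1),
   where act is the right action on X. *)
Definition bar_diff (f : seq A -> X) (s : seq A) : X :=
  if s is a :: t then
    a *: f t + \sum_(i < size t) (-1) ^+ i.+1 *: f (contract s i)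
    + (-1) ^+ size s *: act (f (belast a t)) (last a t)
  else 0.
Arguments bar_diff : simpl never.

(* All terms of bar_diff f (a :: t) but the first, up to sign. *)
Fixpoint bar_tail (f : seq A -> X) (a : A) (t : seq A) : X :=
  if t is b :: t' then f (a * b :: t') - bar_tail (fun u => f (a :: u)) b t'
  else act (f [::]) a.

Lemma bar_diffE f a t : bar_diff f (a :: t) = a *: f t - bar_tail f a t.
Proof.
rewrite /bar_diff -addrA; congr (_ + _).
elim: t f a => [|b t IH] f a /=; first by rewrite big_ord0 add0r expr1 scaleN1r.

rewrite big_ord_recl /= expr1 scaleN1r opprB -addrA [RHS]addrC.
have -> : f (contract [:: a, b & t] 0) = f (a * b :: t).
  by rewrite /contract /= drop0.
congr (- _ + _).
rewrite -[RHS]opprK -IH opprD -sumrN; congr (_ + _).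
  by apply: eq_bigr => i _; rewrite [in LHS]exprS mulN1r scaleNr.
by rewrite [in LHS]exprS mulN1r scaleNr.
Qed.

Hypothesis actD : forall a, {morph act^~ a : x y / x + y}.

Lemma act0 a : act 0 a = 0.
Proof. by apply: (@addrI _ (act 0 a)); rewrite -actD !addr0. Qed.

Lemma actN a x : act (- x) a = - act x a.
Proof. by apply: (@addrI _ (act x a)); rewrite -actD !subrr act0. Qed.

Lemma bar_tailD f g a t :
  bar_tail (f + g) a t = bar_tail f a t + bar_tail g a t.
Proof.
elim: t f g a => [|b t IH] f g a /=; first exact: actD.
have -> : (fun u => (f + g) (a :: u)) =
          (fun u => f (a :: u)) + (fun u => g (a :: u)) by [].
by rewrite IH opprD addrACA.
Qed.

Lemma bar_diffD f g : bar_diff (f + g) = bar_diff f + bar_diff g.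
Proof.
apply/funext => -[|a t]; first exact/esym/addr0.
rewrite -[RHS]/(bar_diff f (a :: t) + bar_diff g (a :: t)).
by rewrite !bar_diffE bar_tailD scalerDr opprD addrACA.
Qed.

Lemma bar_diff0 : bar_diff 0 = 0.
Proof. by apply: (@addrI _ (bar_diff 0)); rewrite -bar_diffD !addr0. Qed.

Lemma bar_diffN f : bar_diff (- f) = - bar_diff f.
Proof.
by apply: (@addrI _ (bar_diff f)); rewrite -bar_diffD !subrr bar_diff0.
Qed.

Lemma bar_diffB f g : bar_diff (f - g) = bar_diff f - bar_diff g.
Proof. by rewrite bar_diffD bar_diffN. Qed.

Lemma bar_tail_tail f a b t :
    (forall x c d, act (act x c) d = act x (c * d)) ->
  bar_tail (bar_tail f a) b t = bar_tail f (a * b) t.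
Proof.
move=> actA; elim: t f a b => [|c u IH] f a b /=; first by rewrite actA.
have -> : (fun v => bar_tail f a (b :: v)) =
  (fun v => f (a * b :: v)) + - bar_tail (fun v => f (a :: v)) b by [].
have tailN h d v : bar_tail (- h) d v = - bar_tail h d v.
  apply: (@addrI _ (bar_tail h d v)); rewrite -bar_tailD !subrr.
  elim: v d => [|e v IHv] d /=; first exact: act0.
  by rewrite (_ : (fun _ => _) = 0) ?IHv ?subr0.
by rewrite bar_tailD tailN IH !mulrA opprD opprK addrA addrAC subrK.
Qed.

Lemma bar_diffK f :
    (forall x c d, act (act x c) d = act x (c * d)) ->
    (forall c x d, act (c *: x) d = c *: act x d) ->
  bar_diff (bar_diff f) = 0.
Proof.
move=> actA actZ; apply/funext => -[|a [|b t]] //.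
  by rewrite bar_diffE /= /bar_diff act0 scaler0 subr0.
rewrite !bar_diffE /= bar_diffE.
have -> : (fun u => bar_diff f (a :: u)) = a *: f + - bar_tail f a.
  by apply/funext => u; rewrite bar_diffE.
have tailZ h d v : bar_tail (a *: h) d v = a *: bar_tail h d v.
  elim: v h d => [|e v IHv] h d /=; first exact: actZ.
  by rewrite scalerBr -IHv.
have tailN h d v : bar_tail (- h) d v = - bar_tail h d v.
  apply: (@addrI _ (bar_tail h d v)); rewrite -bar_tailD !subrr.
  elim: v d => [|e v IHv] d /=; first exact: act0.
  by rewrite (_ : (fun _ => _) = 0) ?IHv ?subr0.
rewrite bar_tailD tailZ tailN bar_tail_tail// scalerBr scalerA.
rewrite opprD !opprK opprB addrC [X in X + _]addrC [X in X + _]addrA subrK addrA.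
by rewrite subrK subrr.
Qed.

Definition deg_part n (f : seq A -> X) s := if size s == n then f s else 0.

Definition flip_odd (f : seq A -> X) s := (-1) ^+ size s *: f s.

Lemma flip_oddK : involutive flip_odd.
Proof.
by move=> f; apply/funext => s; rewrite /flip_odd scalerA -expr2 sqrr_sign scale1r.
Qed.

Lemma bar_diff_local f g a t : {in [pred s | size s == size t], f =1 g} ->
  bar_diff f (a :: t) = bar_diff g (a :: t).
Proof.
move=> fg; rewrite /bar_diff (fg t) ?inE// (fg (belast a t)) ?inE ?size_belast//.
congr (_ + _ + _); apply: eq_bigr => i _; rewrite fg// inE.
rewrite /contract size_cat /= size_drop size_take /= ltnS (ltnW (ltn_ord i)).
by rewrite addnS -addSn subnKC.
Qed.

Lemma bar_diff_part n f : bar_diff (deg_part n f) = deg_part n.+1 (bar_diff f).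
Proof.
apply/funext => -[|a t]; first by rewrite /deg_part.
rewrite {2}/deg_part [size _]/= eqSS; case: eqP => [<-|nt].
  by apply: bar_diff_local => s; rewrite inE /deg_part => ->.
rewrite (@bar_diff_local _ 0) ?bar_diff0// => s; rewrite inE /deg_part => /eqP ->.
by case: eqP.
Qed.

Lemma bar_diff_flip f : bar_diff (flip_odd f) = - flip_odd (bar_diff f).
Proof.
apply/funext => -[|a t]; first by rewrite /flip_odd opprfctE /= scaler0 oppr0.
rewrite opprfctE {2}/flip_odd [size _]/= exprS mulN1r scaleNr opprK -signr_odd.
have [] : (-1) ^+ odd (size t) = 1 :> A /\ (forall s, size s = size t ->
    flip_odd f s = f s) \/ (-1) ^+ odd (size t) = -1 :> A /\ (forall s, size s = size t ->
    flip_odd f s = - f s).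
- case: (boolP (odd (size t))) => [o|/negPf o]; [right|left]; split=> // s Es;
  by rewrite /flip_odd Es -signr_odd o ?expr1 ?scaleN1r// expr0 scale1r.
- case=> -> fE; rewrite scale1r; apply: bar_diff_local => s; rewrite inE => /eqP.
  exact: fE.
case=> -> fE; rewrite scaleN1r.
rewrite (@bar_diff_local _ (- f)) ?bar_diffN// => s; rewrite inE => /eqP.
exact: fE.
Qed.

End BarDifferential.

Section Cup.
Variables (T X Y : Type) (W : zmodType) (p : X -> Y -> W).

(* (f u g)(a_1, ..., a_n) = \sum_i p (f(a_1, ..., a_i), g(a_(i+1), ..., a_n)).
   No sign is needed: a cocycle g of degree q lifts to the chain map
   [a_1 | ... | a_(i+q)] |-> [a_1 | ... | a_i] g(a_(i+1), ..., a_(i+q)), so that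
   for p a composition (or the product of A) the cup product is the Yoneda
   product. *)
Definition cup (f : seq T -> X) (g : seq T -> Y) (s : seq T) : W :=
  \sum_(i < (size s).+1) p (f (take i s)) (g (drop i s)).

Lemma cup_nil f g : cup f g [::] = p (f [::]) (g [::]).
Proof. by rewrite /cup big_ord1. Qed.

Lemma cup_cons f g a s :
  cup f g (a :: s) = p (f [::]) (g (a :: s)) + cup (fun u => f (a :: u)) g s.
Proof. by rewrite /cup big_ord_recl. Qed.
End Cup.

Section CupTheory.
Variables (A : pzRingType) (X Y W : lmodType A).
Variables (actX : X -> A -> X) (actY : Y -> A -> Y) (actW : W -> A -> W).
Variable (p : X -> Y -> W).
Hypothesis actXD : forall a, {morph actX^~ a : x y / x + y}.
Hypothesis actYD : forall a, {morph actY^~ a : x y / x + y}.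
Hypothesis actWD : forall a, {morph actW^~ a : x y / x + y}.
Hypothesis pDl : forall y, {morph p^~ y : x x' / x + x'}.
Hypothesis pZl : forall a x y, p (a *: x) y = a *: p x y.
Hypothesis pA : forall x a y, p (actX x a) y = p x (a *: y).
Hypothesis pZr : forall x y a, actW (p x y) a = p x (actY y a).

Local Notation cup := (cup p).

Lemma p0l y : p 0 y = 0.
Proof. by rewrite -(scale0r 0) pZl scale0r. Qed.

Lemma pNl x y : p (- x) y = - p x y.
Proof. by rewrite -scaleN1r pZl scaleN1r. Qed.

Lemma cupDl f f' (g : seq A -> Y) : cup (f + f') g = cup f g + cup f' g.
Proof.
apply/funext => s; rewrite -[RHS]/(cup f g s + cup f' g s).
by rewrite /cup -big_split; apply: eq_bigr => i _ /=; rewrite -pDl.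
Qed.

Lemma cupNl f (g : seq A -> Y) : cup (- f) g = - cup f g.
Proof.
apply/funext => s; rewrite -[RHS]/(- cup f g s) /cup -sumrN; apply: eq_bigr => i _.
by rewrite -pNl.
Qed.

Lemma cup0l (g : seq A -> Y) : cup 0 g = 0.
Proof. by apply/funext => s; rewrite /cup big1// => i _; rewrite p0l. Qed.

Lemma cupZl a f (g : seq A -> Y) : cup (a *: f) g = a *: cup f g.
Proof.
apply/funext => s; rewrite -[RHS]/(a *: cup f g s) /cup scaler_sumr.
by apply: eq_bigr => i _; rewrite -pZl.
Qed.

Definition rlinear (f : seq A -> X) :=
  forall s, {morph p (f s) : y y' / y + y'}.

Lemma p0r f s : rlinear f -> p (f s) 0 = 0.
Proof. by move=> fl; apply: (@addrI _ (p (f s) 0)); rewrite -fl !addr0. Qed.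

Lemma pNr f s y : rlinear f -> p (f s) (- y) = - p (f s) y.
Proof.
by move=> fl; apply: (@addrI _ (p (f s) y)); rewrite -fl !subrr p0r.
Qed.

Lemma bar_tail_pr f s (g : seq A -> Y) a t : rlinear f ->
  bar_tail actW (fun u => p (f s) (g u)) a t = p (f s) (bar_tail actY g a t).
Proof.
move=> fl; elim: t g a => [|b t IH] g a /=; first exact: pZr.
by rewrite (IH (fun u => g (a :: u))) fl pNr.
Qed.

Lemma bar_tail_cup f g a t : rlinear f ->
  bar_tail actW (cup f g) a t =
    cup (bar_tail actX f a) g t - p (actX (f [::]) a) (g t)
    + p (f [::]) (bar_tail actY g a t)
    + cup (flip_odd (fun u => f (a :: u))) (bar_diff actY g) t.
Proof.
elim: t f a => [|b t IH] f a fl.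
  rewrite /= !cup_nil /= pZr subrr add0r /bar_diff /= /flip_odd /= expr0.
  by rewrite scale1r p0r// addr0.
rewrite [LHS]/=.
have -> : (fun u => cup f g (a :: u)) =
    (fun u => p (f [::]) (g (a :: u))) + cup (fun u => f (a :: u)) g.
  by apply/funext => u; rewrite cup_cons.
rewrite bar_tailD// bar_tail_pr// IH; last by move=> s; exact: fl.
rewrite !cup_cons [bar_tail actX f a [::]]/= [bar_tail actY g a (b :: t)]/=.
rewrite (fl [::]) pNr// bar_diffE.
have -> : flip_odd (fun u => f (a :: u)) [::] = f [:: a].
  by rewrite /flip_odd expr0 scale1r.
rewrite (fl [:: a]) pNr// -pA.
have -> : (fun u => flip_odd (fun v => f (a :: v)) (b :: u)) =
    - flip_odd (fun v => f [:: a, b & v]).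
  by apply/funext => u; rewrite /flip_odd /= exprS mulN1r scaleNr.
have -> : (fun u => bar_tail actX f a (b :: u)) =
    (fun u => f (a * b :: u)) - bar_tail actX (fun v => f (a :: v)) b by [].
rewrite cupDl !cupNl.
set R := p (actX (f [::]) a) _; set P1 := p (f [::]) (g _).
set C1 := cup _ g t; set P2 := p _ (bar_tail _ _ _ _); set C2 := cup _ g.
set Q := p (actX _ b) _; set P3 := p _ (bar_tail _ _ _ _).
set C3 := cup _ (bar_diff _ _).
rewrite -[(cup _ g - C2) t]/(C1 - C2 t) -[(- C3) t]/(- C3 t).
rewrite [R + _]addrC addrK !opprD !opprK !addrA; do 3!congr (_ + _).
by rewrite [P1 + C1]addrC addrAC [C1 + P1 - _]addrAC.
Qed.

Lemma bar_diff_cup f g : rlinear f ->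
  bar_diff actW (cup f g) =
    cup (bar_diff actX f) g + cup (flip_odd f) (bar_diff actY g).
Proof.
move=> fl; apply/funext => -[|a t].
  rewrite -[RHS]/(cup (bar_diff actX f) g [::] +
    cup (flip_odd f) (bar_diff actY g) [::]) !cup_nil /bar_diff p0l add0r.
  by rewrite /flip_odd expr0 scale1r p0r.
rewrite -[RHS]/(cup (bar_diff actX f) g (a :: t) +
    cup (flip_odd f) (bar_diff actY g) (a :: t)) bar_diffE.
rewrite !cup_cons bar_tail_cup// {1}/bar_diff p0l add0r.
have -> : (fun u => bar_diff actX f (a :: u)) = a *: f - bar_tail actX f a.
  by apply/funext => u; rewrite bar_diffE.
have -> : flip_odd f [::] = f [::] by rewrite /flip_odd expr0 scale1r.
have -> : (fun u => flip_odd f (a :: u)) = - flip_odd (fun u => f (a :: u)).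
  by apply/funext => u; rewrite /flip_odd /= exprS mulN1r scaleNr.
rewrite cupDl !cupNl cupZl bar_diffE fl pNr// pA.
set C1 := cup (bar_tail _ _ _) g; set C3 := cup _ (bar_diff _ _).
rewrite -[(a *: _ - C1) t]/(a *: cup f g t - C1 t) -[(- C3) t]/(- C3 t).
by rewrite !opprD opprK !addrA addrAC.
Qed.
End CupTheory.

(* The R-module U / (U :&: B) for submodules U and B of V. The (phantom) proofs
   in sq_num and sq_den only serve to attach the instances. *)
Section Subquotient.
Variables (R : pzRingType) (V : lmodType R) (U B : {pred V}).
Hypotheses (hU : submod_closed U) (hB : submod_closed B).

Definition sq_num of submod_closed U : {pred V} := U.
HB.instance Definition _ := GRing.isSubmodClosed.Build R V (sq_num hU) hU.

Record sq_sub := SqSub { sq_val : V; _ : sq_val \in sq_num hU }.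
HB.instance Definition _ := [isSub of sq_sub for sq_val].
HB.instance Definition _ := [Choice of sq_sub by <:].
HB.instance Definition _ := [SubChoice_isSubLmodule of sq_sub by <:].

Definition sq_den of submod_closed B : {pred sq_sub} :=
  [pred x | val x \in B].
Fact sq_den_closed : submod_closed (sq_den hB).
Proof.
have [h0 hl] := hB; split; first by rewrite inE raddf0.
by move=> a x y; rewrite !inE (linearP val); exact: hl.
Qed.
HB.instance Definition _ :=
  GRing.isSubmodClosed.Build R sq_sub (sq_den hB) sq_den_closed.

Definition subquot : Type := Quotient.quot (sq_den hB).
HB.instance Definition _ := GRing.Zmodule.on subquot.

Definition cls (v : V) : subquot := \pi_(Quotient.quot (sq_den hB)) (insubd (0 : sq_sub) v).
Definition rep (x : subquot) : V := val (repr (x : Quotient.quot (sq_den hB))).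

Lemma rep_in x : rep x \in U. Proof. exact: (valP (repr _)). Qed.

Lemma repK : cancel rep cls.
Proof. by move=> x; rewrite /cls /rep valKd reprK. Qed.

Lemma insubdU u : u \in U -> val (insubd (0 : sq_sub) u) = u.
Proof. by move=> uU; rewrite insubdK. Qed.

Lemma cls_eq u v : u \in U -> v \in U -> (cls u == cls v) = (u - v \in B).
Proof.
move=> uU vU; rewrite /cls -Quotient.idealrBE inE raddfB /=.
by rewrite !insubdU.
Qed.

Lemma clsB u v : u \in U -> v \in U -> u - v \in B -> cls u = cls v.
Proof. by move=> uU vU uv; apply/eqP; rewrite cls_eq. Qed.

Lemma rep_cls u : u \in U -> rep (cls u) - u \in B.
Proof. by move=> uU; rewrite -cls_eq ?rep_in// repK. Qed.

Lemma clsD u v : u \in U -> v \in U -> cls (u + v) = cls u + cls v.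
Proof.
move=> uU vU; rewrite -[RHS](raddfD (\pi_(Quotient.quot (sq_den hB)))) /cls.
congr (\pi _); apply: val_inj; rewrite raddfD /= !insubdU//.
exact: (@rpredD _ (sq_num hU)).
Qed.

Definition sq_scale (a : R) (x : subquot) : subquot := cls (a *: rep x).

Lemma cls_scale a u : u \in U -> sq_scale a (cls u) = cls (a *: u).
Proof.
move=> uU; have ZU v : v \in U -> a *: v \in U by exact: (@rpredZ _ _ (sq_num hU)).
apply: clsB; rewrite ?ZU ?rep_in// -scalerBr.
have [h0 hl] := hB; rewrite -[_ *: _]addr0; apply: hl => //.
exact: rep_cls.
Qed.

Fact sq_scaleA a b x : sq_scale a (sq_scale b x) = sq_scale (a * b) x.
Proof.
rewrite -[x]repK !cls_scale ?scalerA ?rep_in//.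
exact: (@rpredZ _ _ (sq_num hU) _ _ (rep_in x)).
Qed.

Fact sq_scale1 : left_id 1 sq_scale.
Proof. by move=> x; rewrite /sq_scale scale1r repK. Qed.

Fact sq_scaleDr : right_distributive sq_scale +%R.
Proof.
have ZU a x := @rpredZ _ _ (sq_num hU) a _ (rep_in x).
move=> a x y; rewrite -[x]repK -[y]repK -clsD ?rep_in//.
rewrite !cls_scale ?rep_in// ?scalerDr ?clsD//.
exact: (@rpredD _ (sq_num hU)) (rep_in x) (rep_in y).
Qed.

Fact sq_scaleDl x : {morph sq_scale^~ x : a b / a + b}.
Proof.
have ZU a y := @rpredZ _ _ (sq_num hU) a _ (rep_in y).
by move=> a b; rewrite /sq_scale scalerDl clsD.
Qed.

HB.instance Definition _ := GRing.Zmodule_isLmodule.Build R subquot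
  sq_scaleA sq_scale1 sq_scaleDr sq_scaleDl.

Lemma clsZ a u : u \in U -> cls (a *: u) = a *: cls u.
Proof. by move=> uU; rewrite -cls_scale. Qed.
End Subquotient.
Arguments cls {R V U B} hU hB.
Arguments rep {R V U B hU hB}.

Section Cochains.
Variables (k : fieldType) (A : algType k).

(* k acts on an A-module through c |-> c%:A. *)
Definition multilinear (X : lmodType A) (f : seq A -> X) :=
  forall (c : k) a b s1 s2, f (s1 ++ (c *: a + b) :: s2) =
    c%:A *: f (s1 ++ a :: s2) + f (s1 ++ b :: s2).

(* Finitely many nonzero components: elements of a direct sum over degrees. *)
Definition bounded_degree (X : nmodType) (f : seq A -> X) :=
  exists n : nat, forall s, (n <= size s)%N -> f s = 0.

Variables X Y W : lmodType A.
Implicit Types (f : seq A -> X).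

Lemma algC (c : k) (a : A) : c%:A * a = a * c%:A.
Proof. by rewrite mulr_algl mulr_algr. Qed.

Lemma signC n (a : A) : (-1) ^+ n * a = a * (-1) ^+ n.
Proof. exact/commr_sym/commr_sign. Qed.

Lemma multilinear0 : multilinear (0 : seq A -> X).
Proof. by move=> c a b s1 s2; rewrite scaler0 addr0. Qed.

Lemma multilinearD f g : multilinear f -> multilinear g -> multilinear (f + g).
Proof.
move=> fm gm c a b s1 s2; rewrite -[LHS]/(f _ + g _) fm gm.
rewrite -[(f + g) (s1 ++ a :: s2)]/(f _ + g _).
by rewrite -[(f + g) (s1 ++ b :: s2)]/(f _ + g _) scalerDr addrACA.
Qed.

Lemma multilinearZ (c : k) f : multilinear f -> multilinear (c%:A *: f).
Proof.
move=> fm d a b s1 s2; rewrite -[LHS]/(c%:A *: f _) fm scalerDr; congr (_ + _).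
by rewrite -[RHS]/(_ *: (c%:A *: f _)) !scalerA algC.
Qed.

Lemma multilinear_part n f : multilinear f -> multilinear (deg_part n f).
Proof.
move=> fm c a b s1 s2; rewrite /deg_part !size_cat /=.
by case: ifP => _; rewrite ?fm// scaler0 addr0.
Qed.

Lemma multilinear_flip f : multilinear f -> multilinear (flip_odd f).
Proof.
move=> fm c a b s1 s2; rewrite /flip_odd !size_cat /= fm scalerDr !scalerA.
by rewrite signC.
Qed.

Lemma multilinear_cons f a : multilinear f -> multilinear (fun u => f (a :: u)).
Proof. by move=> fm c x y s1 s2; rewrite -[a :: _]/((a :: s1) ++ _) fm. Qed.

Lemma multilinear_cup (p : X -> Y -> W) f g :
    (forall y, {morph p^~ y : x x' / x + x'}) ->
    (forall a x y, p (a *: x) y = a *: p x y) ->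
    (forall s, {morph p (f s) : y y' / y + y'}) ->
    (forall s c y, p (f s) (c%:A *: y) = c%:A *: p (f s) y) ->
  multilinear f -> multilinear g -> multilinear (cup p f g).
Proof.
move=> pDl pZl; rewrite /multilinear => pDr pZr fm gm c a b s1 s2.
elim: s1 f pDr pZr fm => [|d s1 IH] f pDr pZr fm.
  have -> : [::] ++ (c *: a + b) :: s2 = (c *: a + b) :: s2 by [].
  rewrite !cup_cons (gm c a b [::]) /= pDr pZr.
  have -> : (fun u => f (c *: a + b :: u)) =
      c%:A *: (fun u => f (a :: u)) + (fun u => f (b :: u)).
    by apply/funext => u; rewrite (fm c a b [::]).
  by rewrite cupDl// cupZl// scalerDr addrACA.
rewrite !cat_cons !cup_cons -!cat_cons gm pDr pZr IH; first last.
- exact: multilinear_cons.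
- by move=> s; exact: pZr.
- by move=> s; exact: pDr.
by rewrite scalerDr addrACA.
Qed.

Lemma bounded0 : bounded_degree (0 : seq A -> X).
Proof. by exists 0. Qed.

Lemma boundedD f g : bounded_degree f -> bounded_degree g -> bounded_degree (f + g).
Proof.
move=> [m fm] [n gn]; exists (maxn m n) => s; rewrite geq_max => /andP[sm sn].
by rewrite -[LHS]/(f s + g s) fm// gn// addr0.
Qed.

Lemma boundedZ c f : bounded_degree f -> bounded_degree (c *: f).
Proof.
by move=> [m fm]; exists m => s /fm fs; rewrite -[LHS]/(c *: f s) fs scaler0.
Qed.

Lemma bounded_part n f : bounded_degree f -> bounded_degree (deg_part n f).
Proof.
by move=> [m fm]; exists m => s /fm; rewrite /deg_part => ->; case: ifP.
Qed.

Lemma bounded_flip f : bounded_degree f -> bounded_degree (flip_odd f).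
Proof.
by move=> [m fm]; exists m => s /fm; rewrite /flip_odd => ->; rewrite scaler0.
Qed.

Lemma bounded_cup (p : X -> Y -> W) f g :
    (forall y, p 0 y = 0) -> (forall s, p (f s) 0 = 0) ->
  bounded_degree f -> bounded_degree g -> bounded_degree (cup p f g).
Proof.
move=> p0l p0r [m fm] [n gn]; exists (m + n)%N => s mns.
rewrite /cup big1// => i _; have [im|im] := leqP m i.
  by rewrite fm ?p0l// size_take_min leq_min im /= (leq_trans _ mns)// leq_addr.
rewrite gn ?p0r// size_drop leq_subRL; last by rewrite -ltnS.
by rewrite (leq_trans _ mns)// leq_add2r ltnW.
Qed.
End Cochains.

Section HochschildCohomology.
Variables (k : fieldType) (A : algType k).
Implicit Types f g : seq A -> A.

Definition hh_diff f : seq A -> A :=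
  bar_diff (X := A^o) (fun x a => x * a) f.

Definition hh_cochain f := multilinear (f : seq A -> A^o) /\ bounded_degree f.

Definition hh_cocycles : {pred seq A -> A} :=
  fun f => `[< hh_cochain f /\ hh_diff f = 0 >].

Definition hh_coboundaries : {pred seq A -> A} :=
  fun f => `[< exists2 g, hh_cochain g & f = hh_diff g >].

Let actD (a : A) : {morph (fun x : A^o => x * a) : x y / x + y}.
Proof. by move=> x y; exact: mulrDl. Qed.

Lemma hh_scaleE (c : k) f : c *: f = c%:A *: (f : seq A -> A^o).
Proof. by apply/funext => s; exact/esym/mulr_algl. Qed.

Lemma hh_diffZ (c : k) f : hh_diff (c *: f) = c *: hh_diff f.
Proof.
apply/funext => -[|a t]; first exact/esym/scaler0.
rewrite -[RHS]/(c *: hh_diff f (a :: t)) /hh_diff !bar_diffE scalerBr.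
congr (_ - _); first exact/esym/scalerAr.
elim: t f a => [|b t IH] f a /=; first exact/esym/scalerAl.
by rewrite scalerBr -IH.
Qed.

Lemma hh_cochain0 : hh_cochain 0.
Proof. by split; [exact: multilinear0|exact: (@bounded0 _ _ A^o)]. Qed.

Lemma hh_cochainD f g : hh_cochain f -> hh_cochain g -> hh_cochain (f + g).
Proof.
move=> [fm fb] [gm gb]; split; first exact: multilinearD.
exact: (@boundedD _ _ A^o).
Qed.

Lemma hh_cochainZ (c : k) f : hh_cochain f -> hh_cochain (c *: f).
Proof.
move=> [fm fb]; rewrite hh_scaleE; split; first exact: multilinearZ.
exact: (@boundedZ _ _ A^o).
Qed.

Fact hh_cocycles_closed : submod_closed hh_cocycles.
Proof.
split; first by apply/asboolP; split; [exact: hh_cochain0|exact: (bar_diff0 actD)].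
move=> c f g /asboolP[fc df] /asboolP[gc dg]; apply/asboolP; split.
  by apply: hh_cochainD gc; exact: hh_cochainZ.
by rewrite /hh_diff (bar_diffD actD) -/(hh_diff _) hh_diffZ df scaler0 add0r.
Qed.

Fact hh_coboundaries_closed : submod_closed hh_coboundaries.
Proof.
split.
  by apply/asboolP; exists 0; [exact: hh_cochain0|rewrite /hh_diff (bar_diff0 actD)].
move=> c _ _ /asboolP[f fc ->] /asboolP[g gc ->].
apply/asboolP; exists (c *: f + g).
  by apply: hh_cochainD gc; exact: hh_cochainZ.
by rewrite /hh_diff (bar_diffD actD) -/(hh_diff (_ *: _)) hh_diffZ.
Qed.

(* The total Hochschild cohomology ring, the direct sum over n of
   Ext^n_(A (x) A^op)(A, A). *)
Definition HH : Type := subquot hh_cocycles_closed hh_coboundaries_closed.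
HB.instance Definition _ := GRing.Lmodule.on HH.

Lemma HH_in (x : HH) : rep x \in hh_cocycles. Proof. exact: rep_in. Qed.

Definition hh_cls : (seq A -> A) -> HH :=
  cls hh_cocycles_closed hh_coboundaries_closed.

Definition hh_const (z : A) (s : seq A) : A := if s is [::] then z else 0.
Definition hh_one : seq A -> A := hh_const 1.
Definition hh_cup f g : seq A -> A := cup (fun x y => x * y) f g.

Let mulD (y : A^o) : {morph (fun x : A^o => (x * y : A^o)) : x x' / x + x'}.
Proof. by move=> x x'; exact: mulrDl. Qed.
Let mulZ (a : A) (x y : A^o) : (a *: x) * y = a *: (x * y) :> A^o.
Proof. exact/esym/mulrA. Qed.
Let mulAA (x : A^o) (a : A) (y : A^o) : (x * a : A^o) * y = x * (a *: y) :> A^o.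
Proof. exact/esym/mulrA. Qed.
Let mulZr (x y : A^o) (a : A) : (x * y) * a = x * (y * a) :> A^o.
Proof. exact/esym/mulrA. Qed.
Let mulrl f : @rlinear A A^o A^o A^o (fun x y => x * y) f.
Proof. by move=> s x y; exact: mulrDr. Qed.

Lemma hh_diff_cup f g :
  hh_diff (hh_cup f g) =
    hh_cup (hh_diff f) g + hh_cup (flip_odd (f : seq A -> A^o)) (hh_diff g).
Proof.
exact: (@bar_diff_cup A A^o A^o A^o (fun x a => x * a) (fun x a => x * a)
  (fun x a => x * a) (fun x y => x * y)).
Qed.

Lemma hh_cochain_cup f g :
  hh_cochain f -> hh_cochain g -> hh_cochain (hh_cup f g).
Proof.
move=> [fm fb] [gm gb]; split.
  apply: (@multilinear_cup k A A^o A^o A^o (fun x y => x * y)) => //.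
  - by move=> s; exact: mulrl.
  - move=> s c y; rewrite -[LHS]/((f s : A) * (c%:A * (y : A))) mulrA -algC -mulrA.
    by [].
apply: (@bounded_cup k A A^o A^o A^o (fun x y => x * y)) => //.
- by move=> y; exact: mul0r.
- by move=> s; exact: mulr0.
Qed.

Lemma hh_cochain_flip f : hh_cochain f -> hh_cochain (flip_odd (f : seq A -> A^o)).
Proof.
by move=> [fm fb]; split; [exact: multilinear_flip|exact: (@bounded_flip k A A^o)].
Qed.

Lemma hh_cupDl f f' g : hh_cup (f + f') g = hh_cup f g + hh_cup f' g.
Proof. exact: (@cupDl A A^o A^o A^o (fun x y => x * y)). Qed.

Lemma hh_cupDr f g g' : hh_cup f (g + g') = hh_cup f g + hh_cup f g'.
Proof.
apply/funext => s; rewrite -[RHS]/(hh_cup f g s + hh_cup f g' s).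
by rewrite /hh_cup /cup -big_split; apply: eq_bigr => i _ /=; rewrite -mulrDr.
Qed.

Lemma hh_cupZl (c : k) f g : hh_cup (c *: f) g = c *: hh_cup f g.
Proof.
apply/funext => s; rewrite -[RHS]/(c *: hh_cup f g s) /hh_cup /cup scaler_sumr.
by apply: eq_bigr => i _; rewrite scalerAl.
Qed.

Lemma hh_cupZr (c : k) f g : hh_cup f (c *: g) = c *: hh_cup f g.
Proof.
apply/funext => s; rewrite -[RHS]/(c *: hh_cup f g s) /hh_cup /cup scaler_sumr.
by apply: eq_bigr => i _; rewrite scalerAr.
Qed.

Lemma hh_cup0l g : hh_cup 0 g = 0.
Proof. by apply: (@addrI _ (hh_cup 0 g)); rewrite -hh_cupDl !addr0. Qed.

Lemma hh_cup0r f : hh_cup f 0 = 0.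
Proof. by apply: (@addrI _ (hh_cup f 0)); rewrite -hh_cupDr !addr0. Qed.

Lemma hh_cupA f g h : hh_cup f (hh_cup g h) = hh_cup (hh_cup f g) h.
Proof.
apply/funext => s; rewrite /hh_cup; elim: s f => [|a s IH] f.
  by rewrite !cup_nil mulrA.
rewrite !cup_cons !cup_nil IH mulrDr mulrA -addrA; congr (_ + _).
have -> : (fun u => cup (fun x y => x * y) f g (a :: u)) =
    (fun u => f [::] * g (a :: u)) + hh_cup (fun u => f (a :: u)) g.
  by apply/funext => u; rewrite cup_cons.
rewrite -[RHS]/(hh_cup (_ + _) h s) hh_cupDl; congr (_ + _).
by rewrite /hh_cup /cup mulr_sumr; apply: eq_bigr => i _; rewrite mulrA.
Qed.

Lemma hh_cup1l f : hh_cup hh_one f = f.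
Proof.
apply/funext => -[|a s]; first by rewrite /hh_cup cup_nil mul1r.
by rewrite /hh_cup cup_cons mul1r -/(hh_cup 0 f) hh_cup0l addr0.
Qed.

Lemma hh_cup1r f : hh_cup f hh_one = f.
Proof.
apply/funext => s; rewrite /hh_cup; elim: s f => [|a s IH] f.
  by rewrite cup_nil mulr1.
by rewrite cup_cons mulr0 add0r IH.
Qed.

Lemma hh_const_in z :
  (forall a, z * a = a * z) -> hh_const z \in hh_cocycles.
Proof.
move=> zC; apply/asboolP; split.
  split; last by exists 1%N => -[].
  by move=> c a b [|d s1] s2; rewrite scaler0 addr0.
apply/funext => -[|a [|b t]] //.
  by rewrite /hh_diff bar_diffE /= -[LHS]/(a * z - z * a) zC subrr.
rewrite /hh_diff bar_diffE /= scaler0 sub0r.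
have tail0 : bar_tail (X := A^o) (fun x a => x * a) (fun=> 0) b t = 0.
  by elim: t b => [|c t IH] b /=; rewrite ?mul0r// IH subr0.
by rewrite tail0 subr0 oppr0.
Qed.

Lemma hh_one_in : hh_one \in hh_cocycles.
Proof. by apply: hh_const_in => a; rewrite mul1r mulr1. Qed.

Lemma hh_cup_in f g : f \in hh_cocycles -> g \in hh_cocycles ->
  hh_cup f g \in hh_cocycles.
Proof.
move=> /asboolP[fc df] /asboolP[gc dg]; apply/asboolP; split.
  exact: hh_cochain_cup.
by rewrite hh_diff_cup df dg hh_cup0l hh_cup0r addr0.
Qed.

Lemma hh_cup_coboundaryl f g : f \in hh_coboundaries -> g \in hh_cocycles ->
  hh_cup f g \in hh_coboundaries.
Proof.
move=> /asboolP[h hc ->] /asboolP[gc dg]; apply/asboolP; exists (hh_cup h g).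
  exact: hh_cochain_cup.
by rewrite hh_diff_cup dg hh_cup0r addr0.
Qed.

Lemma hh_cup_coboundaryr f g : f \in hh_cocycles -> g \in hh_coboundaries ->
  hh_cup f g \in hh_coboundaries.
Proof.
move=> /asboolP[fc df] /asboolP[h hc ->]; apply/asboolP.
exists (hh_cup (flip_odd (f : seq A -> A^o)) h).
  by apply: hh_cochain_cup => //; exact: hh_cochain_flip.
have dF : hh_diff (flip_odd (f : seq A -> A^o)) = 0.
  transitivity (- flip_odd (hh_diff f : seq A -> A^o)).
    exact: (bar_diff_flip actD).
  by rewrite df; apply/funext => s; rewrite -[LHS]/(- (_ *: (0 : A^o))) scaler0 oppr0.
rewrite hh_diff_cup dF hh_cup0l add0r.
by congr (hh_cup _ _); exact/esym/(flip_oddK (X := A^o)).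
Qed.

Definition hh_mul (x y : HH) : HH := hh_cls (hh_cup (rep x) (rep y)).

Lemma hh_cls_eq f g : f \in hh_cocycles -> g \in hh_cocycles ->
  f - g \in hh_coboundaries -> hh_cls f = hh_cls g.
Proof. exact: clsB. Qed.

Lemma hh_mulE f g : f \in hh_cocycles -> g \in hh_cocycles ->
  hh_mul (hh_cls f) (hh_cls g) = hh_cls (hh_cup f g).
Proof.
move=> fZ gZ; apply: hh_cls_eq; rewrite ?hh_cup_in ?HH_in//.
set f' := rep _; set g' := rep _.
have -> : hh_cup f' g' - hh_cup f g = hh_cup f' (g' - g) + hh_cup (f' - f) g.
  rewrite hh_cupDr hh_cupDl -!scaleN1r hh_cupZr hh_cupZl !scaleN1r addrA.
  by rewrite subrK.
have [h0 hl] := hh_coboundaries_closed.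
rewrite -[hh_cup f' _]scale1r; apply: hl.
  by apply: hh_cup_coboundaryr; rewrite ?HH_in//; exact: rep_cls.
by apply: hh_cup_coboundaryl => //; exact: rep_cls.
Qed.

Fact hh_mulA : associative hh_mul.
Proof.
move=> x y z; rewrite -[x]repK -[y]repK -[z]repK -!/(hh_cls _).
by rewrite !hh_mulE ?hh_cupA ?hh_cup_in ?HH_in.
Qed.

Fact hh_mul1r : left_id (hh_cls hh_one) hh_mul.
Proof.
by move=> x; rewrite -[x]repK -!/(hh_cls _) hh_mulE ?HH_in ?hh_one_in// hh_cup1l.
Qed.

Fact hh_mulr1 : right_id (hh_cls hh_one) hh_mul.
Proof.
by move=> x; rewrite -[x]repK -!/(hh_cls _) hh_mulE ?HH_in ?hh_one_in// hh_cup1r.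
Qed.

Fact hh_clsD f g : f \in hh_cocycles -> g \in hh_cocycles ->
  hh_cls (f + g) = hh_cls f + hh_cls g.
Proof. exact: clsD. Qed.

Fact hh_clsZ (c : k) f : f \in hh_cocycles -> hh_cls (c *: f) = c *: hh_cls f.
Proof. exact: clsZ. Qed.

Let addZ f g : f \in hh_cocycles -> g \in hh_cocycles -> f + g \in hh_cocycles.
Proof. by have [_ hl] := hh_cocycles_closed => fZ; rewrite -[f]scale1r; exact: hl. Qed.

Let sclZ (c : k) f : f \in hh_cocycles -> c *: f \in hh_cocycles.
Proof. by have [h0 hl] := hh_cocycles_closed => fZ; rewrite -[_ *: _]addr0; exact: hl. Qed.

Fact hh_mulDl : left_distributive hh_mul +%R.
Proof.
move=> x y z; rewrite -[x]repK -[y]repK -[z]repK -!/(hh_cls _).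
by rewrite -hh_clsD ?hh_mulE ?hh_cupDl ?hh_clsD ?hh_cup_in ?addZ ?HH_in.
Qed.

Fact hh_mulDr : right_distributive hh_mul +%R.
Proof.
move=> x y z; rewrite -[x]repK -[y]repK -[z]repK -!/(hh_cls _).
by rewrite -hh_clsD ?hh_mulE ?hh_cupDr ?hh_clsD ?hh_cup_in ?addZ ?HH_in.
Qed.

Fact hh_one_neq0 : hh_cls hh_one != 0.
Proof.
have [Z0 _] := hh_cocycles_closed.
have -> : (0 : HH) = hh_cls 0 by rewrite -[in RHS](scale0r 0) hh_clsZ ?scale0r.
rewrite cls_eq ?hh_one_in// subr0; apply/asboolP => -[h _].
by move=> /(congr1 (@^~ [::])) /eqP; rewrite oner_eq0.
Qed.

HB.instance Definition _ := GRing.Zmodule_isNzRing.Build HH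
  hh_mulA hh_mul1r hh_mulr1 hh_mulDl hh_mulDr hh_one_neq0.

Fact hh_scaleAl (c : k) (x y : HH) : c *: (x * y) = (c *: x) * y.
Proof.
rewrite -[x]repK -[y]repK -!/(hh_cls _) -hh_clsZ ?HH_in//.
by rewrite -![_ * _]/(hh_mul _ _) !hh_mulE ?sclZ ?HH_in// hh_cupZl hh_clsZ ?hh_cup_in ?HH_in.
Qed.

HB.instance Definition _ := GRing.Lmodule_isLalgebra.Build k HH hh_scaleAl.

Fact hh_scaleAr (c : k) (x y : HH) : c *: (x * y) = x * (c *: y).
Proof.
rewrite -[x]repK -[y]repK -!/(hh_cls _) -hh_clsZ ?HH_in//.
by rewrite -![_ * _]/(hh_mul _ _) !hh_mulE ?sclZ ?HH_in// hh_cupZr hh_clsZ ?hh_cup_in ?HH_in.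
Qed.

HB.instance Definition _ := GRing.Lalgebra_isAlgebra.Build k HH hh_scaleAr.

(* The component of degree n. *)
Definition hh_part (n : nat) (x : HH) : HH :=
  hh_cls (deg_part n (rep x : seq A -> A^o)).

Lemma hh_cocycle_comp n f : f \in hh_cocycles ->
  deg_part n (f : seq A -> A^o) \in hh_cocycles.
Proof.
move=> /asboolP[[fm fb] df]; apply/asboolP; split.
  by split; [exact: multilinear_part|exact: (@bounded_part k A A^o)].
transitivity (deg_part n.+1 (hh_diff f : seq A -> A^o)).
  exact: (bar_diff_part actD).
by rewrite df; apply/funext => s; rewrite /deg_part; case: ifP.
Qed.

Lemma hh_partE n f : f \in hh_cocycles ->
  hh_part n (hh_cls f) = hh_cls (deg_part n (f : seq A -> A^o)).
Proof.
move=> fZ; apply: hh_cls_eq; rewrite ?hh_cocycle_comp ?HH_in//.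
have /asboolP[g [gm gb] dg] : rep (hh_cls f) - f \in hh_coboundaries.
  exact: rep_cls.
have -> : deg_part n (rep (hh_cls f) : seq A -> A^o) - deg_part n (f : seq A -> A^o) =
    deg_part n (hh_diff g : seq A -> A^o).
  apply/funext => s; rewrite -dg -[LHS]/(deg_part n _ s - deg_part n _ s) /deg_part.
  by case: ifP; rewrite // subr0.
case: n => [|n].
  have -> : deg_part 0 (hh_diff g : seq A -> A^o) = 0.
    by apply/funext => -[].
  by case: hh_coboundaries_closed.
apply/asboolP; exists (deg_part n (g : seq A -> A^o)).
  by split; [exact: multilinear_part|exact: (@bounded_part k A A^o)].
exact/esym/(bar_diff_part actD).
Qed.

(* HH^0 is the center of A. *)
Lemma hh_part0P x : hh_part 0 x = x <->
  exists2 z, (forall a, z * a = a * z) & x = hh_cls (hh_const z).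
Proof.
have constE f : deg_part 0 (f : seq A -> A^o) = hh_const (f [::]).
  by apply/funext => -[].
split=> [<-|[z zC ->]]; last by rewrite hh_partE ?hh_const_in// constE.
rewrite /hh_part constE; exists (rep x [::]) => // a.
have /asboolP[_ dx] := HH_in x.
move: (congr1 (@^~ [:: a]) dx); rewrite /hh_diff bar_diffE /= => /eqP.
by rewrite subr_eq0 => /eqP.
Qed.

End HochschildCohomology.

Section RestrictScalars.
Variables (k : fieldType) (A : algType k) (N : lmodType A).

Definition restr : Type := N.
HB.instance Definition _ := GRing.Zmodule.on restr.

Definition restr_scale (c : k) (x : restr) : restr := c%:A *: (x : N).

Fact restr_scaleA c d x :
  restr_scale c (restr_scale d x) = restr_scale (c * d) x.
Proof. by rewrite /restr_scale scalerA mulr_algl scalerA. Qed.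
Fact restr_scale1 : left_id 1 restr_scale.
Proof. by move=> x; rewrite /restr_scale !scale1r. Qed.
Fact restr_scaleDr : right_distributive restr_scale +%R.
Proof. by move=> c x y; exact: scalerDr. Qed.
Fact restr_scaleDl x : {morph restr_scale^~ x : c d / c + d}.
Proof. by move=> c d; rewrite /restr_scale !scalerDl. Qed.
HB.instance Definition _ := GRing.Zmodule_isLmodule.Build k restr
  restr_scaleA restr_scale1 restr_scaleDr restr_scaleDl.
End RestrictScalars.

Section Ext.
Variables (k : fieldType) (A : algType k).

Definition klinear (M N : lmodType A) (u : M -> N) :=
  forall (c : k) x y, u (c%:A *: x + y) = c%:A *: u x + u y.

Lemma klinear_add (M N : lmodType A) (u : M -> N) : klinear u -> {morph u : x y / x + y}.
Proof. by move=> ul x y; rewrite -[x in LHS]scale1r -(scale1r (1 : A)) ul !scale1r. Qed.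

Section Pair.
Variables M N : lmodType A.
Implicit Types f g : seq A -> M -> N.

(* The right action of A on maps M -> N. *)
Definition precomp (u : M -> N) (a : A) : M -> N := fun m => u (a *: m).

Definition ext_diff f : seq A -> M -> N := bar_diff precomp f.

(* f corresponds to the A-linear map a0 (x) s (x) m |-> a0 *: f s m. *)
Definition ext_cochain f :=
  [/\ multilinear f, bounded_degree f & forall s, klinear (f s)].

Definition ext_cocycles : {pred seq A -> M -> restr N} :=
  fun f => `[< ext_cochain f /\ ext_diff f = 0 >].

Definition ext_coboundaries : {pred seq A -> M -> restr N} :=
  fun f => `[< exists2 g, ext_cochain g & f = ext_diff g >].

Lemma precompD (a : A) : {morph precomp^~ a : x y / x + y}.
Proof. by []. Qed.

Lemma klinearZ (a : A) (u : M -> N) : (forall c : k, a * c%:A = c%:A * a) ->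
  klinear u -> klinear (a *: u).
Proof.
move=> ac ul c x y; rewrite -[LHS]/(a *: u _) ul scalerDr.
by rewrite -[RHS]/(_ *: (a *: u _) + a *: u _) !scalerA ac.
Qed.

Lemma klinearD (u v : M -> N) : klinear u -> klinear v -> klinear (u + v).
Proof.
move=> ul vl c x y; rewrite -[LHS]/(u _ + v _) ul vl.
by rewrite -[RHS]/(_ *: (u _ + v _) + (u _ + v _)) scalerDr addrACA.
Qed.

Lemma klinear0 : klinear (0 : M -> N).
Proof. by move=> c x y; rewrite -[RHS]/(_ *: 0 + 0) scaler0 addr0. Qed.

Lemma ext_diffZ (c : k) f : ext_diff (c%:A *: f) = c%:A *: ext_diff f.
Proof.
apply/funext => -[|a t]; first exact/esym/scaler0.
rewrite -[RHS]/(c%:A *: ext_diff f (a :: t)) /ext_diff !bar_diffE scalerBr.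
congr (_ - _); first by rewrite -[LHS]/(a *: (c%:A *: f t)) !scalerA algC.
by elim: t f a => [|b t IH] f a //=; rewrite scalerBr -IH.
Qed.

Lemma ext_cochain0 : ext_cochain 0.
Proof.
by split; [exact: multilinear0|exact: (@bounded0 k A (M -> N))|move=> s; exact: klinear0].
Qed.

Lemma ext_cochainD f g : ext_cochain f -> ext_cochain g -> ext_cochain (f + g).
Proof.
move=> [fm fb fl] [gm gb gl]; split; first exact: multilinearD.
  exact: (@boundedD _ _ (M -> N)).
by move=> s; exact: klinearD.
Qed.

Lemma ext_cochainZ (c : k) f : ext_cochain f -> ext_cochain (c%:A *: f).
Proof.
move=> [fm fb fl]; split; first exact: multilinearZ.
  exact: (@boundedZ _ _ (M -> N)).
by move=> s; apply: klinearZ => // d; rewrite algC.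
Qed.

Fact ext_cocycles_closed : submod_closed ext_cocycles.
Proof.
split; first by apply/asboolP; split; [exact: ext_cochain0|exact: (bar_diff0 precompD)].
move=> c f g /asboolP[fc df] /asboolP[gc dg]; apply/asboolP; split.
  by apply: ext_cochainD gc; exact: ext_cochainZ.
transitivity (ext_diff (c%:A *: (f : seq A -> M -> N)) + ext_diff g).
  exact: (bar_diffD precompD).
by rewrite ext_diffZ df dg scaler0 addr0.
Qed.

Fact ext_coboundaries_closed : submod_closed ext_coboundaries.
Proof.
split; first by apply/asboolP; exists 0; [exact: ext_cochain0|exact/esym/(bar_diff0 precompD)].
move=> c _ _ /asboolP[f fc ->] /asboolP[g gc ->].
apply/asboolP; exists (c%:A *: f + g).
  by apply: ext_cochainD gc; exact: ext_cochainZ.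
transitivity (ext_diff (c%:A *: f) + ext_diff g); last exact/esym/(bar_diffD precompD).
by rewrite ext_diffZ.
Qed.

(* The direct sum over n of Ext^n_A(M, N). *)
Definition Ext : Type := subquot ext_cocycles_closed ext_coboundaries_closed.
HB.instance Definition _ := GRing.Lmodule.on Ext.

Definition ext_cls (f : seq A -> M -> N) : Ext :=
  cls ext_cocycles_closed ext_coboundaries_closed f.

Definition ext_rep (x : Ext) : seq A -> M -> N := rep x.

Lemma ext_repK : cancel ext_rep ext_cls. Proof. exact: repK. Qed.

Lemma ext_repP x : ext_rep x \in ext_cocycles.
Proof.
exact: (rep_in (x : subquot ext_cocycles_closed ext_coboundaries_closed)).
Qed.

Lemma ext_cls_eq f g : f \in ext_cocycles -> g \in ext_cocycles ->
  f - g \in ext_coboundaries -> ext_cls f = ext_cls g.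
Proof. exact: (@clsB k _ _ _ ext_cocycles_closed ext_coboundaries_closed). Qed.

Lemma ext_rep_cls f : f \in ext_cocycles ->
  ext_rep (ext_cls f) - f \in ext_coboundaries.
Proof. exact: (@rep_cls k _ _ _ ext_cocycles_closed ext_coboundaries_closed). Qed.
End Pair.

Section Products.
Variables M N P : lmodType A.

Definition comp_cup (f : seq A -> N -> P) (g : seq A -> M -> N) :
  seq A -> M -> P := cup (fun u v => u \o v) f g.

Definition yoneda (x : Ext N P) (y : Ext M N) : Ext M P :=
  ext_cls (comp_cup (ext_rep x) (ext_rep y)).

Lemma ext_diff_comp f g : (forall s, klinear (f s)) ->
  ext_diff (comp_cup f g) =
    comp_cup (ext_diff f) g + comp_cup (flip_odd f) (ext_diff g).
Proof.
move=> fl; apply: (@bar_diff_cup A (N -> P) (M -> N) (M -> P) (@precomp N P)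
  (@precomp M N) (@precomp M P) (fun u v => u \o v)) => //.
by move=> s u v; apply/funext => m; exact: (klinear_add (fl s) (u m) (v m)).
Qed.

Lemma ext_cochain_comp (f : seq A -> N -> P) (g : seq A -> M -> N) :
  ext_cochain f -> ext_cochain g -> ext_cochain (comp_cup f g).
Proof.
move=> [fm fb fl] [gm gb gl].
have f0 s : f s 0 = 0.
  by apply: (@addrI _ (f s 0)); rewrite -klinear_add// !addr0.
split.
- apply: (@multilinear_cup k A (N -> P) (M -> N) (M -> P)
    (fun u v => u \o v)) => //.
    by move=> s u v; apply/funext => m; exact: (klinear_add (fl s) (u m) (v m)).
  move=> s c u; apply/funext => m.
  rewrite -[LHS]/(f s (c%:A *: u m)) -[RHS]/(c%:A *: f s (u m)).
  by rewrite -[c%:A *: u m]addr0 fl f0 addr0.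
- apply: (@bounded_cup k A (N -> P) (M -> N) (M -> P) (fun u v => u \o v)) => //.
  by move=> s; apply/funext => m; exact: f0.
- move=> s c x y; rewrite /comp_cup /cup !fct_sumE scaler_sumr -big_split.
  by apply: eq_bigr => i _ /=; rewrite gl fl.
Qed.

Lemma ext_cochain_flip (f : seq A -> N -> P) :
  ext_cochain f -> ext_cochain (flip_odd f).
Proof.
move=> [fm fb fl]; split; first exact: multilinear_flip.
  exact: (@bounded_flip k A (N -> P)).
by move=> s; apply: klinearZ => // c; exact: signC.
Qed.

Lemma comp_cup0l (g : seq A -> M -> N) : comp_cup 0 g = 0.
Proof. by apply/funext => s; rewrite /comp_cup /cup big1. Qed.

Lemma comp_cup0r (f : seq A -> N -> P) :
  (forall s, klinear (f s)) -> comp_cup f 0 = 0.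
Proof.
move=> fl; apply/funext => s; rewrite /comp_cup /cup big1// => i _.
apply/funext => m; apply: (@addrI _ (f (take i s) 0)).
by rewrite -[X in _ + X = _]/(f (take i s) 0) -klinear_add// !addr0.
Qed.

Lemma comp_cup_in (f : seq A -> N -> P) (g : seq A -> M -> N) :
  f \in @ext_cocycles N P -> g \in @ext_cocycles M N ->
  comp_cup f g \in @ext_cocycles M P.
Proof.
move=> /asboolP[fc df] /asboolP[gc dg]; apply/asboolP; split.
  exact: ext_cochain_comp.
case: (ext_cochain_flip fc) => _ _ sfl; case: fc => _ _ fl.
by rewrite ext_diff_comp// df dg comp_cup0l comp_cup0r// addr0.
Qed.

Lemma yonedaE (f : seq A -> N -> P) (g : seq A -> M -> N) :
  f \in @ext_cocycles N P -> g \in @ext_cocycles M N ->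
  yoneda (ext_cls f) (ext_cls g) = ext_cls (comp_cup f g).
Proof.
move=> fZ gZ; apply: ext_cls_eq; rewrite ?comp_cup_in ?ext_repP//.
have := ext_repP (ext_cls f); have := ext_rep_cls fZ; have := ext_rep_cls gZ.
set g' := ext_rep _; set f' := ext_rep _ => /asboolP[g1 g1c gE].
move=> /asboolP[f1 f1c fE] /asboolP[f'c df'].
have /asboolP[gc dg] := gZ.
apply/asboolP; exists (comp_cup (flip_odd f') g1 + comp_cup f1 g).
  by apply: ext_cochainD; apply: ext_cochain_comp => //; exact: ext_cochain_flip.
have -> : ext_diff (comp_cup (flip_odd f') g1 + comp_cup f1 g) =
    ext_diff (comp_cup (flip_odd f') g1) + ext_diff (comp_cup f1 g).
  exact: (bar_diffD (@precompD M P)).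
have dF : ext_diff (flip_odd f') = 0.
  transitivity (- flip_odd (ext_diff f')); first exact: (bar_diff_flip (@precompD N P)).
  by rewrite df'; apply/funext => s; rewrite -[LHS]/(- (_ *: 0)) scaler0 oppr0.
case: (ext_cochain_flip f'c) => _ _ sfl; case: (f1c) => _ _ f1l.
case: (ext_cochain_flip f1c) => _ _ sf1l; case: (f'c) => _ _ f'l.
rewrite !ext_diff_comp// dF dg comp_cup0l add0r flip_oddK comp_cup0r// addr0.
rewrite -fE -gE; apply/funext => s; apply/funext => m.
rewrite -[LHS]/(comp_cup f' g' s m - comp_cup f g s m).
rewrite -[RHS]/(comp_cup f' (g' - g) s m + comp_cup (f' - f) g s m).
rewrite /comp_cup /cup !fct_sumE -sumrB -big_split; apply: eq_bigr => i _ /=.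
have -> : f' (take i s) ((g' - g) (drop i s) m) =
    f' (take i s) (g' (drop i s) m) - f' (take i s) (g (drop i s) m).
  apply: (addIr (f' (take i s) (g (drop i s) m))); rewrite subrK -klinear_add//.
  by rewrite -[(g' - g) _ _]/(g' (drop i s) m - g (drop i s) m) subrK.
by rewrite -[(f' - f) _ _]/(f' (take i s) _ - f (take i s) _) addrA subrK.
Qed.
End Products.

(* f (x)_A M : Bar (x)_A M -> A (x)_A M = M. *)
Definition tensor_cochain (M : lmodType A) (f : seq A -> A) : seq A -> M -> M :=
  fun s m => f s *: m.
Arguments tensor_cochain : clear implicits.

Definition tensor (M : lmodType A) (h : HH A) : Ext M M :=
  ext_cls (tensor_cochain M (rep h)).
Arguments tensor : clear implicits.

Lemma ext_diff_tensor (M : lmodType A) f :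
  ext_diff (tensor_cochain M f) = tensor_cochain M (hh_diff f).
Proof.
apply/funext => -[|a t]; first by apply/funext => m; rewrite /tensor_cochain scale0r.
rewrite /ext_diff bar_diffE /tensor_cochain /hh_diff bar_diffE; apply/funext => m.
rewrite scalerBl -scalerA; congr (_ - _).
elim: t f a => [|b t IH] f a /=; first by rewrite /precomp scalerA.
by rewrite scalerBl -IH.
Qed.

Lemma ext_cochain_tensor (M : lmodType A) f :
  hh_cochain f -> ext_cochain (tensor_cochain M f).
Proof.
move=> [fm [n fb]]; split.
- move=> c a b s1 s2; apply/funext => m.
  by rewrite /tensor_cochain fm scalerDl -scalerA.
- by exists n => s /fb fs; apply/funext => m; rewrite /tensor_cochain fs scale0r.
- by move=> s c x y; rewrite /tensor_cochain scalerDr !scalerA algC.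
Qed.

Lemma tensor_cochain_in (M : lmodType A) f :
  f \in @hh_cocycles k A -> tensor_cochain M f \in @ext_cocycles M M.
Proof.
move=> /asboolP[fc df]; apply/asboolP; split; first exact: ext_cochain_tensor.
rewrite ext_diff_tensor df; apply/funext => s; apply/funext => m.
exact: scale0r.
Qed.

Lemma tensorE (M : lmodType A) f : f \in @hh_cocycles k A ->
  tensor M (hh_cls f) = ext_cls (tensor_cochain M f).
Proof.
move=> fZ; apply: ext_cls_eq; rewrite ?tensor_cochain_in ?HH_in//.
have /asboolP[g gc gE] : rep (hh_cls f) - f \in @hh_coboundaries k A by exact: rep_cls.
apply/asboolP; exists (tensor_cochain M g); first exact: ext_cochain_tensor.
rewrite ext_diff_tensor -gE; apply/funext => s; apply/funext => m.
exact/esym/scalerBl.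
Qed.

Lemma tensorM (M : lmodType A) (x y : HH A) :
  tensor M (x * y) = yoneda (tensor M x) (tensor M y).
Proof.
rewrite -[x]repK -[y]repK -!/(hh_cls _) -[_ * _]/(hh_mul _ _) hh_mulE ?HH_in//.
rewrite !tensorE ?hh_cup_in ?HH_in// yonedaE ?tensor_cochain_in ?HH_in//.
congr ext_cls; apply/funext => s; apply/funext => m.
rewrite /tensor_cochain /comp_cup /hh_cup /cup fct_sumE scaler_suml.
by apply: eq_bigr => i _; rewrite /= scalerA.
Qed.

(* The action of HH A on Ext M N. By construction it is a right action; for a
   commutative subring of HH A the side is immaterial. *)
Definition ext_act (M N : lmodType A) (x : Ext M N) (h : HH A) : Ext M N :=
  yoneda x (tensor M h).
End Ext.

Section Modules.
Variables (R : nzRingType).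
Implicit Types M N P K : lmodType R.

Definition isomorphic M N := exists f : {linear M -> N}, bijective f.

Definition fg_module M := exists n (g : 'I_n -> M),
  forall x, exists c : 'I_n -> R, x = \sum_i c i *: g i.

Definition indecomposable M := (exists x : M, x != 0) /\
  forall U V : lmodType R, isomorphic M (U * V)%type ->
    (forall u : U, u = 0) \/ (forall v : V, v = 0).

Definition projective P :=
  forall (X Y : lmodType R) (f : {linear X -> Y}) (g : {linear P -> Y}),
    (forall y, exists x, f x = y) ->
  exists h : {linear P -> X}, f \o h =1 g.

Definition injective_module N :=
  forall (X Y : lmodType R) (i : {linear X -> Y}) (g : {linear X -> N}),
    injective i -> exists h : {linear Y -> N}, h \o i =1 g.

Definition projective_cover P M (p : {linear P -> M}) :=
  [/\ projective P, forall y, exists x, p x = y &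
    forall U : {pred P}, submod_closed U ->
      (forall x, exists u v, [/\ u \in U, p v = 0 & x = u + v]) ->
    U =i predT].

(* K is (isomorphic to) the kernel of a projective cover of M. *)
Definition is_syzygy M K := exists P (p : {linear P -> M}) (i : {linear K -> P}),
  [/\ projective_cover p, injective i &
    forall x, p x = 0 <-> exists y, i y = x].

Fixpoint is_nth_syzygy n M K : Prop :=
  if n is n'.+1 then exists2 L, is_syzygy M L & is_nth_syzygy n' L K
  else isomorphic M K.

Definition periodic M := exists2 n, (0 < n)%N & is_nth_syzygy n M M.

Definition selfinjective := injective_module R^o.

Definition maximal_left_ideal (I : {pred R^o}) :=
  [/\ submod_closed I, ~ (I =i predT) &
    forall J : {pred R^o}, submod_closed J -> {subset I <= J} ->
      J =i I \/ J =i predT].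
End Modules.

Section Radical.
Variable R : nzRingType.

Definition jacobson : {pred R^o} :=
  fun x => `[< forall I : {pred R^o}, maximal_left_ideal I -> x \in I >].

Fact jacobson_closed : submod_closed jacobson.
Proof.
split; first by apply/asboolP => I [[]].
move=> a x y /asboolP hx /asboolP hy; apply/asboolP => I mI.
by have [[_ hl] _ _] := mI; apply: hl; [exact: hx|exact: hy].
Qed.

Fact predT_closed : submod_closed (predT : {pred R^o}).
Proof. by []. Qed.

Definition mod_radical : lmodType R := subquot predT_closed jacobson_closed.
End Radical.

(* H is the carrier of a commutative subring of R; ideals of H, and the points
   of its maximal spectrum, are subsets of R contained in H. *)
Section MaxSpec.
Variables (R : nzRingType) (H : set R).
Local Open Scope classical_set_scope.
Implicit Types (I J m : set R) (V C D : set (set R)).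

Definition ideal I := [/\ I `<=` H, I 0, forall x y, I x -> I y -> I (x + y)
  & forall h x, H h -> I x -> I (h * x)].

Definition noetherian := forall I, ideal I ->
  exists n (g : 'I_n -> R), (forall i, I (g i)) /\
    forall x, I x -> exists2 c : 'I_n -> R,
      (forall i, H (c i)) & x = \sum_i c i * g i.

Definition maximal_ideal m := [/\ ideal m, m <> H
  & forall J, ideal J -> m `<=` J -> J = m \/ J = H].

Definition zero_locus (S : set R) : set (set R) :=
  [set m | maximal_ideal m /\ S `<=` m].

Definition zariski_closed V := exists2 I, ideal I & V = zero_locus I.

Definition irreducible V := V !=set0 /\
  forall C D, zariski_closed C -> zariski_closed D -> V `<=` C `|` D ->
    V `<=` C \/ V `<=` D.

Definition irreducible_chain V n (Z : nat -> set (set R)) :=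
  (forall i, (i <= n)%N -> [/\ zariski_closed (Z i), irreducible (Z i) & Z i `<=` V])
  /\ forall i, (i < n)%N -> Z i `<` Z i.+1.

Definition has_dimension V d := (exists Z, irreducible_chain V d Z) /\
  forall n Z, irreducible_chain V n Z -> (n <= d)%N.
End MaxSpec.

Section Varieties.
Variables (k : fieldType) (A : algType k).
Local Open Scope classical_set_scope.
Implicit Types (H I : set (HH A)) (M N : lmodType A).

Definition indecomposable_algebra :=
  forall (B C : algType k) (f : {lrmorphism A -> (B * C)%type}), ~ bijective f.

Definition homogeneous I := forall n x, I x -> I (hh_part n x).

Definition graded_subalgebra H :=
  GRing.subalg_closed (mem H) /\ homogeneous H.

Definition contains_HH0 H := forall x, hh_part 0 x = x -> H x.

(* The annihilator of Ext M N in H. *)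
Definition ann H M N : set (HH A) :=
  [set h | H h /\ forall x : Ext M N, ext_act x h = 0].

Definition fg_ext H M N := exists n (g : 'I_n -> Ext M N),
  forall x, exists2 c : 'I_n -> HH A,
    (forall i, H (c i)) & x = \sum_i ext_act (g i) (c i).

Definition variety H M : set (set (HH A)) :=
  zero_locus H (ann H M (mod_radical A)).

Definition line H (V : set (set (HH A))) :=
  [/\ exists2 I, ideal H I /\ homogeneous I & V = zero_locus H I,
      irreducible H V & has_dimension H V 1].
End Varieties.

(* Main.v *)
(* Periodicity of M yields a class g in Ext^n(M, M), n > 0, such that composition
   with g is onto from Ext^i(M, N) to Ext^(i+n)(M, N) and injective for i > 0.
   If x in H has degree s, then x^n acts on M as u g^s for some u in End(M), and
   commutes with End(M).  End(M) is local with residue field k, so u is nilpotent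
   or invertible: hence x is nilpotent on M, or injective on the nonzero module
   Ext^(>0)(M, L/r), and two elements of the same degree are proportional modulo
   the ideal P of elements all of whose components are nilpotent on M.  Thus P is
   a homogeneous prime ideal, V_H(M) is its zero locus, and H / P has dimension at
   most one in each degree.  Finite generation of Ext(M, M) and noetherianity of
   H provide h of positive degree outside P.  Then every f outside P divides a
   nonzero polynomial in h modulo P, which gives enough points to prove that V_H(M)
   is irreducible, and forces its proper irreducible subsets to be points. *)
Require Import Defs.
From HB Require Import structures.
From mathcomp Require Import all_boot all_algebra all_field classical_sets.
From mathcomp Require Import boolp functions.
Set Implicit Arguments. Unset Strict Implicit. Unset Printing Implicit Defensive.
Import GRing.Theory.
Local Open Scope ring_scope.

(** * Cochains *)

(** Composition with the periodicity class is not injective in degree 0: a map that factors through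
    a projective dies. Cancellation is therefore always stated for classes that vanish on the empty
    sequence. A nonzero class of degree one from M to L/r then serves three times: it makes
    nilpotent and injective exclude each other, it puts the annihilator of Ext(M, L/r) inside P, and
    it shows that the powers of g are nonzero, so that Ext(M, M) lives in arbitrarily high degrees.
    Passing to x^n is forced, since powers of g only live in degrees divisible by n; over an
    algebraically closed field this is undone by splitting x^n - c y^n into linear factors. The
    geometry needs no normalization theorem: the products f^i h^j with bounded exponents outnumber
    the degrees available to them, so they are dependent modulo P, and this dependence is the source
    of the polynomial in h. *)

Section Cochains.
Variables (k : fieldType) (A : algType k).
Implicit Types M N P Q : lmodType A.

Definition kcochain M N (u : M -> N) (s : seq A) : M -> N :=
  if s is [::] then u else 0.

Lemma klinear_scale M N (u : M -> N) c x : klinear u -> u (c%:A *: x) = c%:A *: u x.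
Proof.
move=> ul; have u0 : u 0 = 0.
  by apply: (@addrI _ (u 0)); rewrite -klinear_add// !addr0.
by rewrite -[_ *: x]addr0 ul u0 addr0.
Qed.

Lemma klinear_zero M N (u : M -> N) : klinear u -> u 0 = 0.
Proof. by move=> ul; apply: (@addrI _ (u 0)); rewrite -klinear_add// !addr0. Qed.

Lemma klinear_opp M N (u : M -> N) x : klinear u -> u (- x) = - u x.
Proof.
by move=> ul; apply: (@addrI _ (u x)); rewrite -klinear_add// !subrr klinear_zero.
Qed.

Lemma klinear_sum M N (u : M -> N) I (r : seq I) (F : I -> M) : klinear u ->
  u (\sum_(i <- r) F i) = \sum_(i <- r) u (F i).
Proof.
move=> ul; elim: r => [|i r IH]; first by rewrite !big_nil klinear_zero.
by rewrite !big_cons klinear_add// IH.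
Qed.

Lemma linear_klinear M N (u : M -> N) : linear u -> klinear u.
Proof. by move=> ul c x y; exact: ul. Qed.

Lemma kcochainP M N (u : M -> N) : klinear u -> ext_cochain (kcochain u).
Proof.
move=> ul; split.
- by move=> c a b [|d s1] s2 /=; rewrite scaler0 addr0.
- by exists 1%N => -[].
- by move=> [|a s] //=; exact: klinear0.
Qed.

Lemma bar_tail0 M N a t :
  bar_tail (@precomp k A M N) (fun=> (0 : M -> N)) a t = 0.
Proof. by elim: t a => [|b t IH] a //=; rewrite IH subr0. Qed.

Lemma ext_diff_kcochain M N (u : M -> N) a m :
  ext_diff (kcochain u) [:: a] m = a *: u m - u (a *: m).
Proof. by rewrite /ext_diff bar_diffE. Qed.

Lemma ext_diff_kcochain2 M N (u : M -> N) a b t :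
  ext_diff (kcochain u) [:: a, b & t] = 0.
Proof. by rewrite /ext_diff bar_diffE /= bar_tail0 scaler0 !subr0. Qed.

Lemma ext_diff_linear M N (u : M -> N) : linear u -> ext_diff (kcochain u) = 0.
Proof.
move=> ul; apply/funext => -[|a [|b t]] //; last by rewrite ext_diff_kcochain2.
apply/funext => m; rewrite ext_diff_kcochain.
have u0 := klinear_zero (linear_klinear ul).
by rewrite -[a *: m]addr0 ul u0 addr0 subrr.
Qed.

(** On [[:: a]] the cocycle equation says that [f [::]] commutes with a. *)
Lemma cocycle_nil_linear M N (f : seq A -> M -> N) :
  f \in @ext_cocycles k A M N -> linear (f [::]).
Proof.
move=> /asboolP[[_ _ fl] df] a x y; rewrite (klinear_add (fl _)); congr (_ + _).
have := congr1 (@^~ [:: a]) df; rewrite /ext_diff bar_diffE /=.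
by move=> /subr0_eq/(congr1 (@^~ x))/esym.
Qed.

Lemma kcochain_in M N (u : M -> N) : linear u -> kcochain u \in @ext_cocycles k A M N.
Proof.
move=> ul; apply/asboolP; split; last exact: ext_diff_linear.
exact/kcochainP/linear_klinear.
Qed.

Lemma comp_cup_kr M N P (f : seq A -> N -> P) (u : M -> N) :
  (forall s, klinear (f s)) -> comp_cup f (kcochain u) = fun s => f s \o u.
Proof.
move=> fl; apply/funext => s; rewrite /comp_cup /cup big_ord_recr /= drop_oversize//.
rewrite take_oversize// big1 ?add0r// => i _.
case E: (drop i s) => [|a t] /=.
  by have := size_drop i s; rewrite E /= => /esym/eqP; rewrite subn_eq0 leqNgt ltn_ord.
by apply/funext => m /=; rewrite klinear_zero.
Qed.

Lemma comp_cup_kl M N P (g : seq A -> M -> N) (u : N -> P) :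
  comp_cup (kcochain u) g = fun s => u \o g s.
Proof.
apply/funext => s; rewrite /comp_cup /cup big_ord_recl /= take0 drop0.
rewrite big1 ?addr0// => i _; rewrite /bump /=.
by case: s i => [|a s] i //=; case: i.
Qed.

Lemma comp_cupDl M N P (f f' : seq A -> N -> P) (g : seq A -> M -> N) :
  comp_cup (f + f') g = comp_cup f g + comp_cup f' g.
Proof. exact: (@cupDl A (N -> P) (M -> N) (M -> P) (fun u v => u \o v)). Qed.

Lemma comp_cupNl M N P (f : seq A -> N -> P) (g : seq A -> M -> N) :
  comp_cup (- f) g = - comp_cup f g.
Proof. exact: (@cupNl A (N -> P) (M -> N) (M -> P) (fun u v => u \o v)). Qed.

Lemma comp_cupDr M N P (f : seq A -> N -> P) (g g' : seq A -> M -> N) :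
    (forall s, klinear (f s)) ->
  comp_cup f (g + g') = comp_cup f g + comp_cup f g'.
Proof.
move=> fl; apply/funext => s; apply/funext => m.
rewrite -[RHS]/(comp_cup f g s m + comp_cup f g' s m).
rewrite /comp_cup /cup !fct_sumE -big_split; apply: eq_bigr => i _ /=.
exact: klinear_add.
Qed.

Lemma comp_cupNr M N P (f : seq A -> N -> P) (g : seq A -> M -> N) :
    (forall s, klinear (f s)) ->
  comp_cup f (- g) = - comp_cup f g.
Proof.
move=> fl; apply: (@addrI _ (comp_cup f g)).
by rewrite -comp_cupDr// !subrr comp_cup0r.
Qed.

Lemma comp_cupA M N P Q (f : seq A -> P -> Q) (g : seq A -> N -> P)
    (h : seq A -> M -> N) : (forall s, klinear (f s)) ->
  comp_cup f (comp_cup g h) = comp_cup (comp_cup f g) h.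
Proof.
move=> fl; apply/funext => s; elim: s f fl => [|a s IH] f fl.
  by rewrite /comp_cup !cup_nil.
rewrite /comp_cup !cup_cons !cup_nil -!/(comp_cup _ _).
have -> : (fun u => comp_cup f g (a :: u)) =
    (fun u => f [::] \o g (a :: u)) + comp_cup (fun u => f (a :: u)) g.
  by apply/funext => u; rewrite /comp_cup cup_cons.
rewrite comp_cupDl IH; last by move=> t; exact: fl.
apply/funext => m; rewrite -[LHS]/(f [::] (_ + _) + _) (klinear_add (fl _)).
rewrite -[RHS]/(f [::] _ + (_ + _)) addrA; congr (_ + _ + _).
rewrite /comp_cup /cup !fct_sumE klinear_sum//.
Qed.

Lemma flip_cup M N P (f : seq A -> N -> P) (g : seq A -> M -> N) :
    (forall s, klinear (f s)) ->
  flip_odd (comp_cup f g) = comp_cup (flip_odd f) (flip_odd g).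
Proof.
move=> fl; apply/funext => s; rewrite /flip_odd /comp_cup /cup scaler_sumr.
apply: eq_bigr => i _; apply/funext => m /=.
rewrite -[LHS]/(_ *: f _ _) -[RHS]/(_ *: f _ (_ *: g _ _)).
have -> : (-1) ^+ size s = (-1) ^+ size (take i s) * (-1) ^+ size (drop i s) :> A.
  by rewrite -exprD -size_cat cat_take_drop.
rewrite -scalerA; congr (_ *: _); rewrite -signr_odd.
by case: odd; rewrite ?expr0 ?scale1r// expr1 !scaleN1r klinear_opp.
Qed.

Lemma flip_kcochain M N (u : M -> N) : flip_odd (kcochain u) = kcochain u.
Proof.
by apply/funext => -[|a s]; rewrite /flip_odd /= ?expr0 ?scale1r ?scaler0.
Qed.

Lemma ext_diff_flip M N (f : seq A -> M -> N) :
  ext_diff (flip_odd f) = - flip_odd (ext_diff f).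
Proof. exact: (bar_diff_flip (@precompD k A M N)). Qed.

Lemma ext_diffD M N (f g : seq A -> M -> N) : ext_diff (f + g) = ext_diff f + ext_diff g.
Proof. exact: (bar_diffD (@precompD k A M N)). Qed.

Lemma ext_diffN M N (f : seq A -> M -> N) : ext_diff (- f) = - ext_diff f.
Proof. exact: (bar_diffN (@precompD k A M N)). Qed.

Lemma ext_cochainN M N (f : seq A -> M -> N) : ext_cochain f -> ext_cochain (- f).
Proof.
move=> fc; have -> : - f = (-1)%:A *: f.
  by apply/funext => s; apply/funext => m; rewrite -[RHS]/(_ *: f s m) !scaleN1r.
exact: ext_cochainZ.
Qed.

Lemma flip_odd0 M N : flip_odd (0 : seq A -> M -> N) = 0.
Proof. by apply/funext => s; rewrite /flip_odd scaler0. Qed.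

Lemma flip_in M N (f : seq A -> M -> N) :
  f \in @ext_cocycles k A M N -> flip_odd f \in @ext_cocycles k A M N.
Proof.
move=> /asboolP[fc df]; apply/asboolP; split; first exact: ext_cochain_flip.
by rewrite ext_diff_flip df flip_odd0 oppr0.
Qed.

Lemma cochain_klinear M N (f : seq A -> M -> N) : ext_cochain f -> forall s, klinear (f s).
Proof. by case. Qed.

Lemma cocycle_cochain M N (f : seq A -> M -> N) : f \in @ext_cocycles k A M N -> ext_cochain f.
Proof. by move=> /asboolP[]. Qed.

Lemma cocycle_diff M N (f : seq A -> M -> N) : f \in @ext_cocycles k A M N -> ext_diff f = 0.
Proof. by move=> /asboolP[]. Qed.

End Cochains.

(** * Finite dimension *)

Section FiniteDimension.
Variables (k : fieldType) (A : algType k).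
Implicit Types (X Y : lmodType A).

Lemma kscaleD X (c d : k) (x : X) : (c + d)%:A *: x = c%:A *: x + d%:A *: x.
Proof. by rewrite !scalerDl. Qed.

Lemma kscaleA X (c d : k) (x : X) : (c * d)%:A *: x = c%:A *: (d%:A *: x).
Proof. by rewrite scalerA mulr_algl scalerA. Qed.

Definition ksubspace X (U : set X) :=
  U 0 /\ forall (c : k) x y, U x -> U y -> U (c%:A *: x + y).

Definition lincomb X n (e : 'I_n -> X) (r : 'rV[k]_n) : X :=
  \sum_i (r 0 i)%:A *: e i.

Lemma lincombD X n (e : 'I_n -> X) c r s :
  lincomb e (c *: r + s) = c%:A *: lincomb e r + lincomb e s.
Proof.
rewrite /lincomb scaler_sumr -big_split; apply: eq_bigr => i _ /=.
by rewrite !mxE kscaleD kscaleA.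
Qed.

Lemma lincomb0 X n (e : 'I_n -> X) : lincomb e 0 = 0.
Proof. by rewrite /lincomb big1// => i _; rewrite mxE !scale0r. Qed.

(** [W] has maximal rank among the matrices whose row space is sent into [U]: a row sent into [U]
    but outside [W] could be adjoined and would raise the rank. *)
Lemma subspace_matrix X n (e : 'I_n -> X) (U : set X) : ksubspace U ->
  exists W : 'M[k]_n, forall r, (r <= W)%MS <-> U (lincomb e r).
Proof.
move=> [U0 UD].
pose Q m := `[< exists2 W : 'M[k]_n, \rank W = m &
  forall r : 'rV_n, (r <= W)%MS -> U (lincomb e r) >].
have Q0 : exists m, Q m.
  exists 0%N; apply/asboolP; exists 0; first by rewrite mxrank0.
  by move=> r; rewrite submx0 => /eqP ->; rewrite lincomb0.
have Qb m : Q m -> (m <= n)%N by move=> /asboolP[W <- _]; exact: rank_leq_row.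
case: (ex_maxnP Q0 Qb) => m /asboolP[W rW WU] Wmax; exists W => r.
split; [exact: WU|move=> Ur; apply/negPn/negP => rNW].
suff /Wmax : Q (\rank (W + r)%MS).
  rewrite leqNgt => /negP; apply; rewrite -rW; apply: rank_ltmx.
  by rewrite ltmxE addsmxSl /= addsmx_sub submx_refl.
apply/asboolP; exists (W + r)%MS => // v /sub_addsmxP[[u1 u2] /= ->].
rewrite [u2]mx11_scalar mul_scalar_mx addrC lincombD.
by apply: UD => //; apply: WU; exact: submxMl.
Qed.

(** The family [e] need not be a basis: k-linear coordinates that reconstruct x present X as a
    retract of k^n. *)
Definition fin_dim X := exists n (e : 'I_n -> X) (c : 'I_n -> X -> k),
  (forall i a x y, c i (a%:A *: x + y) = a * c i x + c i y) /\
  forall x, x = \sum_i (c i x)%:A *: e i.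

(** Chosen coordinates need not be linear in x; they become so after a projection of k^n whose
    kernel is the space of relations of [e]. *)
Lemma spanned_fin_dim X n (e : 'I_n -> X) :
  (forall x, exists r, x = lincomb e r) -> fin_dim X.
Proof.
move=> sp; have [r rE] := choice sp.
have U0 : ksubspace ([set 0] : set X).
  by split=> // c x y -> ->; rewrite scaler0 addr0.
have [W WE] := subspace_matrix e U0.
(* [v *m Q] depends only on v modulo the relations [W], and it differs from v by a relation. *)
pose Q := cokermx W *m pinvmx (cokermx W).
have QE v : lincomb e (v *m Q) = lincomb e v.
  have : (v - v *m Q <= W)%MS.
    by rewrite submxE mulmxBl /Q mulmxA mulmxKpV ?submxMl// subrr.
  move=> /WE /= /eqP; rewrite addrC -scaleN1r lincombD scaleN1r scaleN1r addrC.
  by rewrite subr_eq0 => /eqP.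
have Q_eq v w : lincomb e v = lincomb e w -> v *m Q = w *m Q.
  move=> vw; apply/eqP; rewrite -subr_eq0 -mulmxBl.
  have : (v - w <= W)%MS.
    by apply/WE; rewrite /= addrC -scaleN1r lincombD vw !scaleN1r addrC subrr.
  by rewrite submxE => /eqP Qvw; rewrite /Q mulmxA Qvw mul0mx.
exists n, e, (fun i x => (r x *m Q) 0 i); split.
  move=> i a x y; rewrite (_ : _ *m Q = a *: (r x *m Q) + r y *m Q) ?mxE//.
  by rewrite scalemxAl -mulmxDl; apply: Q_eq; rewrite -rE lincombD -!rE.
by move=> x; rewrite -/(lincomb _ _) QE.
Qed.

(** [mu U] is the rank of the preimage of U in k^n, which plays the role of a dimension in the chain
    arguments; on sets that are not subspaces its value is arbitrary. *)
Lemma fin_dim_measure X : fin_dim X -> exists (n : nat) (mu : set X -> nat),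
  forall U V, ksubspace U -> ksubspace V -> (U `<=` V)%classic -> ~ (V `<=` U)%classic ->
  (mu U < mu V <= n)%N.
Proof.
move=> [n [e [c [_ eE]]]]; exists n.
have W_ (U : set X) : exists W : 'M[k]_n, ksubspace U ->
    forall r, (r <= W)%MS <-> U (lincomb e r).
  have [/(subspace_matrix e)[W WP]|nU] := pselect (ksubspace U); first by exists W.
  by exists 0.
have [W WP] := choice W_; exists (fun U => \rank (W U)) => U V Us Vs UV nVU.
rewrite rank_leq_row andbT; apply: rank_ltmx; rewrite ltmxE; apply/andP; split.
  by apply/row_subP => i; apply/(WP _ Vs)/UV/(WP _ Us)/row_sub.
apply/negP => VU; apply: nVU => x; rewrite [x]eE.
have -> : \sum_i (c i x)%:A *: e i = lincomb e (\row_i c i x).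
  by apply: eq_bigr => i _; rewrite mxE.
by move=> /(WP _ Vs) xV; apply/(WP _ Us)/(submx_trans xV).
Qed.

Lemma ex_maximal_subspace X (Q : set X -> Prop) : fin_dim X ->
    (exists U, Q U) -> (forall U, Q U -> ksubspace U) ->
  exists2 U, Q U & forall V, Q V -> (U `<=` V)%classic -> (V `<=` U)%classic.
Proof.
move=> /fin_dim_measure[n [mu muP]] [U0 QU0] Qs; apply: contrapT => nmax.
have step U : Q U -> exists2 V, Q V & (mu U < mu V <= n)%N.
  move=> QU; apply: contrapT => nV; apply: nmax; exists U => // V QV UV.
  by apply: contrapT => nVU; apply: nV; exists V => //; apply: muP => //; exact: Qs.
suff H m : exists2 U, Q U & (m <= mu U)%N.
  have [U QU nU] := H n.
  by have [V QV /andP[UV /(leq_trans UV)]] := step U QU; rewrite ltnNge nU.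
elim: m => [|m [U QU mU]]; first by exists U0.
by have [V QV /andP[UV _]] := step U QU; exists V => //; exact: leq_ltn_trans UV.
Qed.

Lemma ex_minimal_subspace X (Q : set X -> Prop) : fin_dim X ->
    (exists U, Q U) -> (forall U, Q U -> ksubspace U) ->
  exists2 U, Q U & forall V, Q V -> (V `<=` U)%classic -> (U `<=` V)%classic.
Proof.
move=> /fin_dim_measure[n [mu muP]] [U0 QU0] Qs; apply: contrapT => nmin.
have H m U : Q U -> (m <= mu U)%N.
  elim: m U => [//|m IH] U QU; rewrite ltnNge; apply/negP => Um.
  apply: nmin; exists U => // V QV VU; apply: contrapT => nUV.
  have /andP[VUm _] := muP _ _ (Qs _ QV) (Qs _ QU) VU nUV.
  by have := leq_trans VUm Um; rewrite ltnNge IH.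
by have := H (mu U0).+1 U0 QU0; rewrite ltnn.
Qed.

(** Take a finite family in X whose span has maximal image in Y. Adjoining any x does not enlarge
    the image, so by injectivity the family already spans X. *)
Lemma sub_fin_dim X Y (i : X -> Y) : linear i -> injective i -> fin_dim Y -> fin_dim X.
Proof.
move=> il iI fY; have ik := linear_klinear il.
pose sp n (e : 'I_n -> X) : set Y := fun y => exists r, y = i (lincomb e r).
pose Q (U : set Y) := exists n (e : 'I_n -> X), U = sp n e.
have spD n (e : 'I_n -> X) : ksubspace (sp n e).
  split; first by exists 0; rewrite lincomb0 klinear_zero.
  by move=> c _ _ [r ->] [s ->]; exists (c *: r + s); rewrite lincombD ik.
have [||U [n [e UE]] Umax] := @ex_maximal_subspace Y Q fY.
- by exists (sp 0%N (fun=> 0)), 0%N, (fun=> 0).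
- by move=> U [n [e ->]].
apply: (@spanned_fin_dim _ n e) => x.
pose e' j : X := if unlift ord0 j is Some j' then e j' else x.
have lE r : lincomb e' r = (r 0 ord0)%:A *: x + lincomb e (\row_j r 0 (lift ord0 j)).
  rewrite /lincomb big_ord_recl /e' unlift_none; congr (_ + _).
  by apply: eq_bigr => j _; rewrite mxE liftK.
have := Umax (sp _ e') (ex_intro _ _ (ex_intro _ e' erefl)).
rewrite UE => H; have /H : (sp n e `<=` sp n.+1 e')%classic.
  move=> _ [r ->]; exists (\row_j if unlift ord0 j is Some j' then r 0 j' else 0).
  rewrite lE mxE unlift_none !scale0r add0r; congr (i _); apply: eq_bigr => j _.
  by rewrite !mxE liftK.
move=> /(_ (i x)); case; last by move=> r /iI ->; exists r.
exists (\row_j if unlift ord0 j is Some j' then 0 else 1); rewrite lE mxE unlift_none !scale1r.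
congr (i _); rewrite -[LHS]addr0; congr (_ + _); rewrite -(lincomb0 e); congr lincomb.
by apply/rowP => j; rewrite !mxE liftK.
Qed.

(** Lifting each [e i] and extending by the linear coordinates is enough; the section is k-linear
    and in general not A-linear. *)
Lemma fin_dim_klinear_section X Y (p : X -> Y) : fin_dim Y -> linear p ->
    (forall y, exists x, p x = y) ->
  exists2 s : Y -> X, klinear s & cancel s p.
Proof.
move=> [n [e [c [cl eE]]]] pl ps; have pk := linear_klinear pl.
have [t tE] := choice (fun i => ps (e i)).
exists (fun y => \sum_i (c i y)%:A *: t i).
  move=> a x y; rewrite scaler_sumr -big_split; apply: eq_bigr => i _ /=.
  by rewrite cl kscaleD kscaleA.
move=> y; rewrite klinear_sum// [RHS]eE; apply: eq_bigr => i _.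
by rewrite klinear_scale// tE.
Qed.

End FiniteDimension.

Lemma fg_fin_dim (k : fieldType) (A : falgType k) (X : lmodType A) :
  fg_module X -> fin_dim X.
Proof.
move=> [n [g gE]]; pose b := vbasis {:A}; pose d := \dim {:A}.
pose e (j : 'I_#|{: 'I_n * 'I_d}|) : X :=
  let ij := enum_val j in b`_ij.2 *: g ij.1.
apply: (@spanned_fin_dim _ _ _ _ e) => x; have [c ->] := gE x.
exists (\row_j (let ij := enum_val j in coord b ij.2 (c ij.1))).
rewrite /lincomb /e.
under [RHS]eq_bigr do rewrite mxE /= scalerA mulr_algl.
rewrite [RHS](reindex (@enum_rank {: 'I_n * 'I_d}))/=; last first.
  by exists enum_val => ? _; rewrite ?enum_rankK ?enum_valK.
under [RHS]eq_bigr do rewrite enum_rankK.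
rewrite -(pair_bigA _ (fun i j => (coord b j (c i) *: b`_j) *: g i)) /=.
apply: eq_bigr => i _; rewrite -scaler_suml; congr (_ *: _).
by rewrite -coord_vbasis// memvf.
Qed.

(** * Syzygies and connecting classes *)

Section DualBasis.
Variables (R : nzRingType) (P : lmodType R).

Definition dual_basis n (q : 'I_n -> P) (tau : 'I_n -> P -> R^o) :=
  (forall j, linear (tau j)) /\ forall x, x = \sum_j tau j x *: q j.

Lemma projective_dual_basis : projective P -> fg_module P ->
  exists n (q : 'I_n -> P) (tau : 'I_n -> P -> R^o), dual_basis q tau.
Proof.
move=> Pproj [n [q qE]]; exists n, q.
pose f (r : 'rV[R]_n) : P := \sum_j r 0 j *: q j.
have fl : linear f.
  move=> a x y; rewrite /f scaler_sumr -big_split; apply: eq_bigr => j _ /=.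
  by rewrite !mxE scalerDl scalerA.
pose F : {linear 'rV[R]_n -> P} := HB.pack f (GRing.isLinear.Build _ _ _ _ f fl).
have Fs y : exists x, F x = y.
  have [c ->] := qE y; exists (\row_j c j); rewrite -[LHS]/(\sum_j _ *: _).
  by apply: eq_bigr => j _; rewrite mxE.
have [h hE] := Pproj _ _ F (idfun : {linear P -> P}) Fs.
exists (fun j x => h x 0 j); split=> [j a x y|x].
  by rewrite linearP !mxE.
by have := hE x; rewrite /= => {1}<-.
Qed.
End DualBasis.

(** * Acyclicity of bar cochains on a projective module *)

Section Homotopy.
Variables (k : fieldType) (A : algType k) (P N : lmodType A).
Variables (n : nat) (q : 'I_n -> P) (tau : 'I_n -> P -> A^o).
Hypothesis qtau : dual_basis q tau.
Implicit Types f : seq A -> P -> N.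

(* Contracting homotopy of Hom_A(Bar (x)_A P, N): since x = \sum_j tau_j(x) q_j
   with tau_j linear, x |-> \sum_j tau_j(x) (x) q_j splits A (x) P -> P. *)
Definition contraction f (s : seq A) (x : P) : N :=
  \sum_j f (rcons s (tau j x)) (q j).

(** The last face makes [tau j x] act on [q j], and the sum over j gives back x; linearity of [tau]
    turns the face before it into the right action on the contraction. *)
Lemma bar_tail_contraction f a t x : (forall s, klinear (f s)) ->
  \sum_j bar_tail (@precomp k A P N) f a (rcons t (tau j x)) (q j) =
    bar_tail (@precomp k A P N) (contraction f) a t x - (-1) ^+ size t *: f (a :: t) x.
Proof.
have [taul qE] := qtau; elim: t f a => [|b t IH] f a fl /=.
  rewrite expr0 scale1r sumrB; congr (_ - _).
    rewrite /precomp /contraction; apply: eq_bigr => j _ /=; congr (f [:: _] _).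
    by have /= := linearZ_LR (HB.pack (tau j) (GRing.isLinear.Build _ _ _ _ _ (taul j)) :
         {linear P -> A^o}) a x => ->.
  by rewrite [x in RHS]qE (klinear_sum _ _ (fl _)).
rewrite sumrB (IH (fun u => f (a :: u))) => [|s]; last exact: fl.
by rewrite opprB exprS mulN1r scaleNr opprK addrA addrAC.
Qed.

Lemma ext_diff_contraction f : f \in @ext_cocycles k A P N -> f [::] = 0 ->
  ext_diff (contraction (flip_odd f)) = f.
Proof.
move=> /flip_in fZ f0; apply/funext => -[|a t]; first by rewrite f0.
have fl := cochain_klinear (cocycle_cochain fZ).
apply/funext => x; rewrite /ext_diff bar_diffE.
rewrite -[LHS]/(a *: contraction _ t x - bar_tail _ _ a t x).
(* The cocycle equation on [a :: rcons t (tau j x)], evaluated at [q j] and summed over j, is the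
   homotopy identity. It says nothing on the empty sequence, whence the hypothesis [f [::] = 0]. *)
have /eqP : \sum_j ext_diff (flip_odd f) (a :: rcons t (tau j x)) (q j) = 0.
  by rewrite big1// => j _; rewrite cocycle_diff.
under eq_bigr do rewrite /ext_diff bar_diffE.
rewrite -[X in X == _]/(\sum_j (a *: _ (q j) - bar_tail _ _ _ _ (q j))).
rewrite sumrB bar_tail_contraction// -scaler_sumr -/(contraction _ t x).
rewrite opprB addrA addrAC addr_eq0 => /eqP ->.
rewrite -[flip_odd f _ x]/(_ *: f _ x) scalerA -scaleNr exprS mulrA mulrN1 mulNr opprK.
by rewrite -expr2 sqrr_sign scale1r.
Qed.

Lemma contraction_cochain f : ext_cochain f -> ext_cochain (contraction f).
Proof.
have [taul qE] := qtau.
move=> [fm [m fb] fl]; split.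
- move=> c a b s1 s2; apply/funext => x.
  rewrite -[RHS]/(c%:A *: contraction f _ x + contraction f _ x) /contraction.
  rewrite scaler_sumr -big_split; apply: eq_bigr => j _ /=.
  by rewrite !rcons_cat /= fm.
- exists m => s ms; apply/funext => x; rewrite /contraction big1// => j _.
  by rewrite fb// size_rcons ltnW.
- move=> s c x y; rewrite /contraction scaler_sumr -big_split; apply: eq_bigr => j _ /=.
  rewrite taul -!cats1 -[c%:A *: tau j x]/(c%:A * (tau j x : A)) mulr_algl.
  by rewrite fm.
Qed.

Lemma projective_coboundary f : f \in @ext_cocycles k A P N -> f [::] = 0 ->
  exists2 g, ext_cochain g & f = ext_diff g.
Proof.
move=> fZ f0; exists (contraction (flip_odd f)); last by rewrite ext_diff_contraction.
exact/contraction_cochain/ext_cochain_flip/cocycle_cochain.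
Qed.
End Homotopy.

(** * The connecting class of a short exact sequence *)

Section ShortExact.
Variables (k : fieldType) (A : algType k) (K P M : lmodType A).
Variables (i : K -> P) (p : P -> M).
Hypotheses (il : linear i) (pl : linear p) (i_inj : injective i).
Hypothesis ker_im : forall x, p x = 0 <-> exists y, i y = x.
Variable sg : M -> P.
Hypotheses (sgl : klinear sg) (sgK : cancel sg p).

Lemma section_complement x : exists y, i y = x - sg (p x).
Proof.
apply/ker_im; rewrite -[p _]/(p (_ + - _)) (klinear_add (linear_klinear pl)).
by rewrite (klinear_opp _ (linear_klinear pl)) sgK subrr.
Qed.

Definition retraction x : K := projT1 (cid (section_complement x)).

Lemma retractionE x : i (retraction x) = x - sg (p x).
Proof. by rewrite /retraction; case: cid. Qed.

Let ik := linear_klinear il.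
Let pk := linear_klinear pl.

Lemma retraction_klinear : klinear retraction.
Proof.
move=> c x y; apply: i_inj; rewrite ik !retractionE pk sgl scalerBr opprD.
by rewrite addrACA.
Qed.
Let rk := retraction_klinear.

Lemma retractionK : cancel i retraction.
Proof.
move=> y; apply: i_inj; rewrite retractionE.
by rewrite (proj2 (ker_im (i y)) (ex_intro _ y erefl)) klinear_zero// subr0.
Qed.

Local Notation "f ** g" := (comp_cup f g) (at level 40, left associativity).
Local Notation C := (@kcochain k A _ _).
Local Notation d := (@ext_diff k A _ _).

(** The extension class: [d (C sg)] measures how far [sg] is from being A-linear, takes values in
    the kernel of [p], and the retraction brings it back to K. *)
Definition connecting : seq A -> M -> K := C retraction ** d (C sg).

Let Ck (M' N' : lmodType A) (u : M' -> N') : klinear u -> forall s, klinear (C u s).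
Proof. by move=> /(@kcochainP k A) /cochain_klinear. Qed.

Lemma comp_proj_incl : C p ** C i = 0.
Proof.
rewrite comp_cup_kl; apply/funext => -[|a s]; apply/funext => y /=.
  by apply/ker_im; exists y.
exact: klinear_zero.
Qed.

Lemma comp_proj_section : C p ** C sg = C id.
Proof.
rewrite comp_cup_kl; apply/funext => -[|a s]; apply/funext => y /=; first exact: sgK.
exact: klinear_zero.
Qed.

Lemma comp_retraction_incl : C retraction ** C i = C id.
Proof.
rewrite comp_cup_kl; apply/funext => -[|a s]; apply/funext => y /=; first exact: retractionK.
exact: klinear_zero.
Qed.

Lemma comp_incl_retraction : C i ** C retraction = C id - C sg ** C p.
Proof.
rewrite !comp_cup_kl; apply/funext => -[|a s]; apply/funext => y /=; first exact: retractionE.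
by rewrite -[RHS]/(0 - sg 0) (klinear_zero sgl) subr0; exact: klinear_zero.
Qed.

Lemma comp_cup1l (N N' : lmodType A) (f : seq A -> N -> N') : C id ** f = f.
Proof. by rewrite comp_cup_kl; apply/funext. Qed.

Lemma comp_cup1r (N N' : lmodType A) (f : seq A -> N -> N') : (forall s, klinear (f s)) -> f ** C id = f.
Proof. by move=> fl; rewrite comp_cup_kr//; apply/funext. Qed.

Lemma ext_diff_klinear (M' N' : lmodType A) (u : M' -> N') : klinear u -> forall s, klinear (d (C u) s).
Proof.
move=> ul [|a [|b s]]; [exact: klinear0| |rewrite ext_diff_kcochain2; exact: klinear0].
move=> c x y; rewrite !ext_diff_kcochain ul scalerDr scalerDr scalerA -Defs.algC -scalerA.
rewrite [a *: (c%:A *: x)]scalerA -Defs.algC -scalerA ul scalerBr.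
by rewrite opprD addrACA.
Qed.

Lemma comp_proj_diff_section : C p ** d (C sg) = 0.
Proof.
have := ext_diff_comp (C sg) (Ck pk); rewrite comp_proj_section ext_diff_linear// ext_diff_linear// comp_cup0l add0r.
by rewrite flip_kcochain.
Qed.

Lemma i_connecting : C i ** connecting = d (C sg).
Proof.
rewrite /connecting comp_cupA; last exact: Ck.
rewrite comp_incl_retraction comp_cupDl comp_cup1l comp_cupNl -comp_cupA; last exact: Ck.
by rewrite comp_proj_diff_section comp_cup0r ?oppr0 ?addr0//; exact: Ck.
Qed.

Lemma comp_incl_inj (M' : lmodType A) (f g : seq A -> M' -> K) : C i ** f = C i ** g -> f = g.
Proof.
rewrite !comp_cup_kl => fg; apply/funext => s; apply/funext => m; apply: i_inj.
exact: (congr1 (fun h => h s m) fg).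
Qed.

Lemma ext_diffK (M' N' : lmodType A) (f : seq A -> M' -> N') : d (d f) = 0.
Proof.
apply: bar_diffK => // x c e; apply/funext => m.
by rewrite /precomp scalerA.
Qed.

Lemma ext_diff_kcochain_cochain (M' N' : lmodType A) (u : M' -> N') :
  klinear u -> ext_cochain (d (C u)).
Proof.
move=> ul; split; last exact: ext_diff_klinear.
  move=> c a b s1 s2; case: (ltnP 0 (size s1 + size s2)%N) => [lt0|]; last first.
    case: s1 s2 => [|? ?] [|? ?] // _; rewrite !cat0s; apply/funext => x.
    rewrite -[RHS]/(c%:A *: d (C u) [:: a] x + d (C u) [:: b] x) !ext_diff_kcochain.
    rewrite !scalerDl -[c *: a]mulr_algl -!scalerA ul scalerBr opprD.
    by rewrite addrACA.
  have d0 (e : A) : d (C u) (s1 ++ e :: s2) = 0.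
    by case: s1 s2 lt0 => [|? [|? ?]] [|? ?] // _; exact: ext_diff_kcochain2.
  by rewrite !d0 scaler0 addr0.
by exists 2%N => -[|a [|b s]] // _; rewrite ext_diff_kcochain2.
Qed.

Lemma connecting_in : connecting \in @ext_cocycles k A M K.
Proof.
apply/asboolP; split.
  by apply: ext_cochain_comp; [exact: kcochainP|exact: ext_diff_kcochain_cochain].
apply: comp_incl_inj; rewrite comp_cup0r; last exact: Ck.
have := ext_diff_comp connecting (Ck ik); rewrite i_connecting ext_diffK ext_diff_linear//.
by rewrite comp_cup0l add0r flip_kcochain.
Qed.

(** This expresses that [connecting] lives in odd degree. It is checked after composing with [i],
    where the class is d(sg): the sign change fixes [C sg] and anticommutes with d. *)
Lemma connecting_flip : flip_odd connecting = - connecting.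
Proof.
apply: comp_incl_inj; rewrite comp_cupNr; last exact: Ck.
rewrite i_connecting -{1}(flip_kcochain i) -flip_cup; last exact: Ck.
rewrite i_connecting -{2}(flip_kcochain sg) ext_diff_flip opprK.
by [].
Qed.

(** As [C i] is a cocycle of degree 0, i d(rho) = d(i rho) = d(id - sg p) = - d(sg) p = - i delta p,
    and i can be cancelled. *)
Lemma d_retraction : d (C retraction) = - connecting ** C p.
Proof.
apply: comp_incl_inj; rewrite comp_cupNl comp_cupNr; last exact: Ck.
rewrite comp_cupA; last exact: Ck.
rewrite i_connecting.
have := ext_diff_comp (C retraction) (Ck ik); rewrite ext_diff_linear// comp_cup0l add0r flip_kcochain => <-.
rewrite comp_incl_retraction ext_diffD ext_diffN ext_diff_linear//.
rewrite add0r ext_diff_comp; last exact: Ck.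
by rewrite (ext_diff_linear pl) flip_kcochain comp_cup0r ?addr0//; exact: Ck.
Qed.

(* With w a primitive of f p, d(w sg) = f + flip(w) i delta. *)
Lemma connecting_surj (N : lmodType A) (f : seq A -> M -> N) (w : seq A -> P -> N) :
    f \in @ext_cocycles k A M N -> ext_cochain w -> f ** C p = d w ->
  - (flip_odd w ** C i) \in @ext_cocycles k A K N /\
  f = - (flip_odd w ** C i) ** connecting + d (w ** C sg).
Proof.
move=> fZ wc fp; have fl := cochain_klinear (cocycle_cochain fZ).
have fwc := ext_cochain_flip wc.
split.
  apply/asboolP; split; first by apply/ext_cochainN/ext_cochain_comp => //; exact: kcochainP.
  rewrite ext_diffN ext_diff_comp; last exact: cochain_klinear.
  rewrite ext_diff_linear// comp_cup0r ?addr0; last by rewrite flip_oddK; exact: cochain_klinear.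
  rewrite ext_diff_flip -fp comp_cupNl opprK (flip_cup _ fl) flip_kcochain.
  rewrite -comp_cupA ?comp_proj_incl ?comp_cup0r//; exact/cochain_klinear/ext_cochain_flip/cocycle_cochain.
rewrite ext_diff_comp; last exact: cochain_klinear.
rewrite -fp -comp_cupA// comp_proj_section comp_cup1r// comp_cupNl -comp_cupA; last exact: cochain_klinear.
by rewrite i_connecting addrCA addNr addr0.
Qed.

(* From i d(rho) = - d(sg) p one gets d(eta rho) = - flip(eta) delta p. *)
Lemma connecting_inj (N : lmodType A) (f : seq A -> K -> N) :
    f \in @ext_cocycles k A K N -> f ** connecting \in @ext_coboundaries k A M N ->
  exists2 w, w \in @ext_cocycles k A P N & w ** C i = f.
Proof.
move=> fZ /asboolP[v vc dv]; have fc := cocycle_cochain fZ; have fl := cochain_klinear fc.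
have vl := cochain_klinear (ext_cochain_flip vc).
have fr : ext_cochain (f ** C retraction) by apply: ext_cochain_comp => //; exact: kcochainP.
have vp : ext_cochain (flip_odd v ** C p).
  by apply: ext_cochain_comp; [exact: ext_cochain_flip|exact: kcochainP].
(* Along [i] the first summand restricts to f and the second to 0. The second is there to cancel d(f
   rho), because d v = f delta. *)
exists (f ** C retraction + flip_odd v ** C p).
  apply/asboolP; split; first exact: ext_cochainD.
  rewrite ext_diffD !ext_diff_comp// (ext_diff_linear pl) (cocycle_diff fZ) comp_cup0l add0r.
  rewrite flip_oddK comp_cup0r ?addr0; last exact: cochain_klinear.
  rewrite d_retraction ext_diff_flip -dv flip_cup// connecting_flip.
  have ffl := cochain_klinear (ext_cochain_flip fc).
  rewrite comp_cupNr// opprK comp_cupA//.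
  by rewrite (comp_cupNr _ ffl) comp_cupNl addNr.
rewrite comp_cupDl -!comp_cupA// comp_retraction_incl comp_proj_incl comp_cup1r// comp_cup0r// addr0//.
Qed.
End ShortExact.

(** * Ext classes and their degrees *)

Section DegreeParts.
Variables (A : pzRingType) (X Y W : lmodType A).

Lemma deg_partD n (f g : seq A -> X) : deg_part n (f + g) = deg_part n f + deg_part n g.
Proof.
apply/funext => s; rewrite -[RHS]/(deg_part n f s + deg_part n g s) /deg_part.
by case: ifP; rewrite // addr0.
Qed.

Lemma deg_part0 n : deg_part n (0 : seq A -> X) = 0.
Proof. by apply/funext => s; rewrite /deg_part; case: ifP. Qed.

Lemma deg_part_part m n (f : seq A -> X) :
  deg_part m (deg_part n f) = if m == n then deg_part n f else 0.
Proof.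
apply/funext => s; rewrite /deg_part; case: (m =P n) => [->|/eqP mn]; first by case: (size s == n).
by case: ifP => // /eqP ->; rewrite (negPf mn).
Qed.

Lemma sum_deg_part N (f : seq A -> X) : (forall s, (N <= size s)%N -> f s = 0) ->
  f = \sum_(n < N) deg_part n f.
Proof.
move=> fN; apply/funext => s; rewrite fct_sumE; have [sN|sN] := ltnP (size s) N.
  rewrite (bigD1 (Ordinal sN)) //= big1 ?addr0 /deg_part ?eqxx// => i.
  by rewrite -val_eqE eq_sym => /negPf /= ->.
by rewrite fN// big1// => i _; rewrite /deg_part fN//; case: ifP.
Qed.

Lemma deg_part_cup (p : X -> Y -> W) n f g :
    (forall y, p 0 y = 0) -> (forall s, p (f s) 0 = 0) ->
  deg_part n (cup p f g) =
    \sum_(i < n.+1) (cup p (deg_part i f) (deg_part (n - i)%N g) : seq A -> W).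
Proof.
move=> p0l p0r; apply/funext => s; rewrite fct_sumE {1}/deg_part /cup exchange_big /=.
case: eqP => [sn|/eqP sn].
  apply: eq_big_seq => /= j _; have jn : (j <= n)%N by rewrite -sn -ltnS.
  have jn1 : (j < n.+1)%N by [].
  have ts : size (take j s) = j by rewrite size_take_min; apply/minn_idPl; rewrite -ltnS.
  have ds : size (drop j s) = (n - j)%N by rewrite -sn size_drop.
  rewrite (bigD1 (Ordinal jn1)) //= /deg_part ts ds !eqxx big1 ?addr0// => i.
  by rewrite -val_eqE eq_sym => /negPf /= ->.
rewrite big1// => j _; rewrite big1// => i _; rewrite /deg_part.
case: eqP => [ti|]; last by rewrite p0l.
case: eqP => [di|]; last by rewrite p0r.
case/negP: sn; rewrite -(cat_take_drop j s) size_cat ti di subnKC//.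
by rewrite -ltnS.
Qed.
End DegreeParts.

Section ExtClasses.
Variables (k : fieldType) (A : algType k).
Implicit Types M N P Q : lmodType A.

Local Notation Z M N := (@ext_cocycles k A M N).

Lemma cocyclesD M N f g : f \in Z M N -> g \in Z M N -> f + g \in Z M N.
Proof.
have [_ hl] := ext_cocycles_closed M N => fZ gZ.
by have := hl 1 f g fZ gZ; rewrite scale1r.
Qed.

Lemma cocycles0 M N : 0 \in Z M N.
Proof. by have [] := ext_cocycles_closed M N. Qed.

Lemma cocyclesN M N f : f \in Z M N -> - f \in Z M N.
Proof.
have [h0 hl] := ext_cocycles_closed M N => fZ.
by have := hl (-1) f 0 fZ h0; rewrite scaleN1r addr0.
Qed.

Lemma ext_clsD M N f g : f \in Z M N -> g \in Z M N ->
  ext_cls (f + g) = ext_cls f + ext_cls g :> Ext M N.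
Proof. exact: clsD. Qed.

Lemma ext_cls0 M N : ext_cls 0 = 0 :> Ext M N.
Proof. by apply: (@addrI _ (ext_cls 0)); rewrite -ext_clsD ?cocycles0 ?addr0. Qed.

Lemma ext_cls_eq0 M N f : f \in Z M N -> (ext_cls f == 0 :> Ext M N) = (f \in @ext_coboundaries k A M N).
Proof.
move=> fZ; rewrite -ext_cls0 /ext_cls cls_eq ?cocycles0//.
by rewrite subr0.
Qed.

Lemma ext_clsN M N f : f \in Z M N -> ext_cls (- f) = - ext_cls f :> Ext M N.
Proof.
move=> fZ; apply: (@addrI _ (ext_cls f)).
by rewrite -ext_clsD ?cocyclesN// !subrr ext_cls0.
Qed.

Lemma ext_clsP M N (x : Ext M N) : exists2 f, f \in Z M N & x = ext_cls f.
Proof. by exists (ext_rep x); rewrite ?ext_repK ?ext_repP. Qed.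

Lemma yonedaDl M N P (x x' : Ext N P) (y : Ext M N) :
  yoneda (x + x') y = yoneda x y + yoneda x' y.
Proof.
have [f fZ ->] := ext_clsP x; have [f' f'Z ->] := ext_clsP x'; have [g gZ ->] := ext_clsP y.
by rewrite -ext_clsD// !yonedaE ?cocyclesD// comp_cupDl ext_clsD ?comp_cup_in.
Qed.

Lemma yonedaDr M N P (x : Ext N P) (y y' : Ext M N) :
  yoneda x (y + y') = yoneda x y + yoneda x y'.
Proof.
have [f fZ ->] := ext_clsP x; have [g gZ ->] := ext_clsP y; have [g' g'Z ->] := ext_clsP y'.
rewrite -ext_clsD// !yonedaE ?cocyclesD// comp_cupDr ?ext_clsD ?comp_cup_in//.
exact/cochain_klinear/cocycle_cochain.
Qed.

Lemma yonedaA M N P Q (x : Ext P Q) (y : Ext N P) (z : Ext M N) :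
  yoneda x (yoneda y z) = yoneda (yoneda x y) z.
Proof.
have [f fZ ->] := ext_clsP x; have [g gZ ->] := ext_clsP y; have [h hZ ->] := ext_clsP z.
rewrite !yonedaE ?comp_cup_in// comp_cupA//.
exact/cochain_klinear/cocycle_cochain.
Qed.

Lemma yoneda0l M N P (y : Ext M N) : yoneda (0 : Ext N P) y = 0.
Proof. by apply: (@addrI _ (yoneda 0 y)); rewrite -yonedaDl !addr0. Qed.

Lemma yoneda0r M N P (x : Ext N P) : yoneda x (0 : Ext M N) = 0.
Proof. by apply: (@addrI _ (yoneda x 0)); rewrite -yonedaDr !addr0. Qed.

Lemma yonedaNl M N P (x : Ext N P) (y : Ext M N) : yoneda (- x) y = - yoneda x y.
Proof. by apply: (@addrI _ (yoneda x y)); rewrite -yonedaDl !subrr yoneda0l. Qed.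

Lemma yoneda_suml M N P I (r : seq I) (B : pred I) (F : I -> Ext N P) (y : Ext M N) :
  yoneda (\sum_(i <- r | B i) F i) y = \sum_(i <- r | B i) yoneda (F i) y.
Proof.
elim/big_rec2: _ => [|i u v _ <-]; first exact: yoneda0l.
by rewrite yonedaDl.
Qed.

Lemma yoneda_sumr M N P I (r : seq I) (B : pred I) (F : I -> Ext M N) (x : Ext N P) :
  yoneda x (\sum_(i <- r | B i) F i) = \sum_(i <- r | B i) yoneda x (F i).
Proof.
elim/big_rec2: _ => [|i u v _ <-]; first exact: yoneda0r.
by rewrite yonedaDr.
Qed.

Definition ext0 M N (u : M -> N) : Ext M N := ext_cls (kcochain u).

Lemma ext0_comp M N P (u : N -> P) (v : M -> N) : linear u -> linear v ->
  yoneda (ext0 u) (ext0 v) = ext0 (u \o v).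
Proof.
move=> ul vl; rewrite yonedaE ?kcochain_in//; congr ext_cls.
rewrite comp_cup_kl; apply/funext => -[|a s]//=; apply/funext => x /=.
exact/(@klinear_zero k A)/linear_klinear.
Qed.

Lemma yoneda1r M N (x : Ext M N) : yoneda x (ext0 id) = x.
Proof.
have [f fZ ->] := ext_clsP x; rewrite yonedaE ?kcochain_in//.
by rewrite comp_cup_kr//; exact/cochain_klinear/cocycle_cochain.
Qed.

(* Coboundaries vanish on the empty sequence, so this does not depend on the
   choice of a cocycle. *)
Definition ext_value0 M N (x : Ext M N) : M -> N := ext_rep x [::].

Lemma ext_value0_cls M N f : f \in Z M N -> ext_value0 (ext_cls f) = f [::].
Proof.
move=> fZ; have /asboolP[g _ E] := ext_rep_cls fZ.
by apply/subr0_eq; have := congr1 (@^~ [::]) E.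
Qed.

Definition ext_part M N n (x : Ext M N) : Ext M N := ext_cls (deg_part n (ext_rep x)).

Lemma part_cochain M N n (f : seq A -> M -> N) : ext_cochain f -> ext_cochain (deg_part n f).
Proof.
move=> [fm fb fl]; split.
- exact: multilinear_part.
- exact: (@bounded_part k A (M -> N)).
- by move=> s; rewrite /deg_part; case: ifP => _ //; exact: klinear0.
Qed.

Lemma ext_diff_part M N n (f : seq A -> M -> N) :
  ext_diff (deg_part n f) = deg_part n.+1 (ext_diff f).
Proof. exact: (bar_diff_part (@precompD k A M N)). Qed.

Lemma part_in M N n f : f \in Z M N -> deg_part n f \in Z M N.
Proof.
move=> fZ; apply/asboolP; split; first exact/part_cochain/cocycle_cochain.
by rewrite ext_diff_part cocycle_diff// deg_part0.
Qed.

Lemma ext_part_cls M N n f : f \in Z M N -> ext_part n (ext_cls f) = ext_cls (deg_part n f).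
Proof.
move=> fZ; apply: ext_cls_eq; rewrite ?part_in ?ext_repP//.
have /asboolP[g gc E] := ext_rep_cls fZ.
have -> : deg_part n (ext_rep (ext_cls f)) - deg_part n f = deg_part n (ext_diff g).
  apply/funext => s; rewrite -E -[LHS]/(deg_part n _ s - deg_part n _ s) /deg_part.
  by case: ifP; rewrite // subr0.
case: n => [|n].
  have -> : deg_part 0 (ext_diff g) = 0 by apply/funext => -[].
  by have [] := ext_coboundaries_closed M N.
apply/asboolP; exists (deg_part n g); first exact: part_cochain.
by rewrite ext_diff_part.
Qed.

Lemma ext_partD M N n (x y : Ext M N) : ext_part n (x + y) = ext_part n x + ext_part n y.
Proof.
have [f fZ ->] := ext_clsP x; have [g gZ ->] := ext_clsP y.
by rewrite -ext_clsD// !ext_part_cls ?cocyclesD// deg_partD ext_clsD ?part_in.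
Qed.

Lemma ext_part0 M N n : ext_part n (0 : Ext M N) = 0.
Proof. by apply: (@addrI _ (ext_part n 0)); rewrite -ext_partD !addr0. Qed.

Lemma ext_part_sum M N n I (r : seq I) (B : pred I) (F : I -> Ext M N) :
  ext_part n (\sum_(i <- r | B i) F i) = \sum_(i <- r | B i) ext_part n (F i).
Proof.
elim/big_rec2: _ => [|i u v _ <-]; first exact: ext_part0.
by rewrite ext_partD.
Qed.

Lemma ext_part_part M N m n (x : Ext M N) :
  ext_part m (ext_part n x) = if m == n then ext_part n x else 0.
Proof.
have [f fZ ->] := ext_clsP x; rewrite !ext_part_cls ?part_in// deg_part_part.
by case: ifP => // _; rewrite ext_cls0.
Qed.

Lemma ext_cls_sum M N I (r : seq I) (B : pred I) (F : I -> seq A -> M -> N) :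
    (forall i, F i \in Z M N) ->
  ext_cls (\sum_(i <- r | B i) F i) = \sum_(i <- r | B i) ext_cls (F i) :> Ext M N.
Proof.
move=> FZ; elim: r => [|i r IH]; first by rewrite !big_nil ext_cls0.
rewrite !big_cons; case: ifP => // _; rewrite ext_clsD ?IH//.
by elim/big_rec: _ => [|j x _ xZ]; rewrite ?cocycles0// cocyclesD.
Qed.

Lemma ext_sum_parts M N (x : Ext M N) : exists n,
  (forall m, (n <= m)%N -> ext_part m x = 0) /\ x = \sum_(i < n) ext_part i x.
Proof.
have [f fZ ->] := ext_clsP x; have [_ [n fn] _] := cocycle_cochain fZ.
exists n; split=> [m nm|].
  rewrite ext_part_cls// (_ : deg_part m f = 0) ?ext_cls0//; apply/funext => s.
  by rewrite /deg_part; case: eqP => // sm; rewrite fn// sm.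
under eq_bigr do rewrite ext_part_cls//.
rewrite -ext_cls_sum; last by move=> i; exact: part_in.
by rewrite -(sum_deg_part fn).
Qed.

Lemma ext_part_yoneda M N P n (x : Ext N P) (y : Ext M N) :
  ext_part n (yoneda x y) = \sum_(i < n.+1) yoneda (ext_part i x) (ext_part (n - i)%N y).
Proof.
have [f fZ ->] := ext_clsP x; have [g gZ ->] := ext_clsP y.
rewrite yonedaE// ext_part_cls ?comp_cup_in// /comp_cup deg_part_cup => [|//|s]; last first.
  apply/funext => m; apply: klinear_zero; exact/cochain_klinear/cocycle_cochain.
under [RHS]eq_bigr do rewrite !ext_part_cls// yonedaE ?part_in//.
by rewrite -ext_cls_sum// => i; rewrite comp_cup_in ?part_in.
Qed.

Definition ext_deg M N n (x : Ext M N) := ext_part n x = x.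

Lemma ext_degP M N n (x : Ext M N) : ext_deg n x ->
  exists2 f, f \in Z M N /\ (forall s, size s != n -> f s = 0) & x = ext_cls f.
Proof.
move=> <-; exists (deg_part n (ext_rep x)) => //; split; first exact/part_in/ext_repP.
by move=> s /negPf sn; rewrite /deg_part sn.
Qed.

Lemma ext_deg_part M N n (x : Ext M N) : ext_deg n (ext_part n x).
Proof. by rewrite /ext_deg ext_part_part eqxx. Qed.

Lemma ext_deg_cls M N n f : f \in Z M N -> (forall s, size s != n -> f s = 0) ->
  ext_deg n (ext_cls f : Ext M N).
Proof.
move=> fZ fn; rewrite /ext_deg ext_part_cls//; congr ext_cls; apply/funext => s.
by rewrite /deg_part; case: ifPn => // /fn ->.
Qed.

Lemma ext_part_deg M N m n (x : Ext M N) : ext_deg n x ->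
  ext_part m x = if m == n then x else 0.
Proof. by move=> <-; rewrite ext_part_part. Qed.

Lemma ext_deg_yoneda M N P m n (x : Ext N P) (y : Ext M N) :
  ext_deg m x -> ext_deg n y -> ext_deg (m + n)%N (yoneda x y).
Proof.
move=> xm yn; rewrite /ext_deg ext_part_yoneda.
have mn : (m < (m + n).+1)%N by rewrite ltnS leq_addr.
rewrite (bigD1 (Ordinal mn)) //= (ext_part_deg _ xm) eqxx addKn yn big1 ?addr0// => i.
by rewrite -val_eqE /= => /negPf im; rewrite (ext_part_deg _ xm) im yoneda0l.
Qed.

Lemma ext0_deg M N (u : M -> N) : linear u -> ext_deg 0 (ext0 u).
Proof. by move=> ul; apply: ext_deg_cls; [exact: kcochain_in|case]. Qed.

Lemma ext_deg0P M N (x : Ext M N) : ext_deg 0 x ->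
  exists2 u : M -> N, linear u & x = ext0 u.
Proof.
move=> /ext_degP[f [fZ f0] ->]; exists (f [::]); first exact: (@cocycle_nil_linear k A).
by congr ext_cls; apply/funext => -[|a s] //=; rewrite f0.
Qed.

Lemma ext_value0_deg M N n (x : Ext M N) : ext_deg n.+1 x -> ext_value0 x = 0.
Proof. by move=> /ext_degP[f [fZ f0] ->]; rewrite ext_value0_cls// f0. Qed.

Lemma ext_value0_yoneda M N P (x : Ext N P) (y : Ext M N) :
  ext_value0 (yoneda x y) = ext_value0 x \o ext_value0 y.
Proof.
have [f fZ ->] := ext_clsP x; have [g gZ ->] := ext_clsP y.
by rewrite yonedaE// !ext_value0_cls ?comp_cup_in// /comp_cup cup_nil.
Qed.

Lemma tensor_part M n (h : HH A) : ext_part n (tensor M h) = tensor M (hh_part n h).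
Proof.
rewrite -[h]repK -/(hh_cls _) hh_partE ?HH_in// !tensorE ?hh_cocycle_comp ?HH_in//.
rewrite ext_part_cls ?tensor_cochain_in ?HH_in//; congr ext_cls.
apply/funext => s; rewrite /deg_part /tensor_cochain; case: ifP => // _.
by apply/funext => m; rewrite scale0r.
Qed.

Lemma tensorD M (g h : HH A) : tensor M (g + h) = tensor M g + tensor M h.
Proof.
rewrite -[g]repK -[h]repK -!/(hh_cls _) -hh_clsD ?HH_in//.
have ghZ : rep g + rep h \in @hh_cocycles k A.
  by have [_ hl] := @hh_cocycles_closed k A; rewrite -[rep g]scale1r hl ?HH_in.
rewrite !tensorE ?HH_in// -ext_clsD ?tensor_cochain_in ?HH_in//; congr ext_cls.
by apply/funext => s; apply/funext => m; exact: scalerDl.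
Qed.

Lemma tensor0 M : tensor M 0 = 0.
Proof. by apply: (@addrI _ (tensor M 0)); rewrite -tensorD !addr0. Qed.

Lemma tensorN M (h : HH A) : tensor M (- h) = - tensor M h.
Proof. by apply: (@addrI _ (tensor M h)); rewrite -tensorD !subrr tensor0. Qed.

Lemma tensor_sum M I (r : seq I) (B : pred I) (F : I -> HH A) :
  tensor M (\sum_(i <- r | B i) F i) = \sum_(i <- r | B i) tensor M (F i).
Proof. by elim/big_rec2: _ => [|i u v _ <-]; [exact: tensor0|rewrite tensorD]. Qed.

Lemma tensor_scale M (c : k) : linear (fun x : M => c%:A *: x).
Proof. by move=> a x y; rewrite scalerDr !scalerA Defs.algC. Qed.

Lemma tensorZ M (c : k) (h : HH A) :
  tensor M (c *: h) = yoneda (ext0 (fun x : M => c%:A *: x)) (tensor M h).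
Proof.
rewrite -[h]repK -!/(hh_cls _) -hh_clsZ ?HH_in//.
have chZ : c *: rep h \in @hh_cocycles k A.
  by have [h0 hl] := @hh_cocycles_closed k A; rewrite -[_ *: _]addr0 hl ?HH_in.
have sl := @tensor_scale M c.
rewrite !tensorE ?HH_in// yonedaE ?tensor_cochain_in ?HH_in ?kcochain_in//; congr ext_cls.
rewrite comp_cup_kl; apply/funext => s; apply/funext => m /=.
by rewrite /tensor_cochain scalerA mulr_algl.
Qed.

Lemma tensor1 M : tensor M 1 = ext0 (id : M -> M).
Proof.
rewrite tensorE ?hh_one_in//; congr ext_cls; apply/funext => -[|a s]; apply/funext => m.
  exact: scale1r.
exact: scale0r.
Qed.

(** The values of a tensor cochain are scalings by elements of A, which linear maps respect. This
    naturality is what lets Hochschild classes commute with End(M). *)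
Lemma tensor_comm M N (u : M -> N) (h : HH A) : linear u ->
  yoneda (tensor N h) (ext0 u) = yoneda (ext0 u) (tensor M h).
Proof.
move=> ul; rewrite -[h]repK -!/(hh_cls _) !tensorE ?HH_in//.
rewrite !yonedaE ?tensor_cochain_in ?HH_in ?kcochain_in//; congr ext_cls.
rewrite comp_cup_kl comp_cup_kr; last first.
  exact/cochain_klinear/cocycle_cochain/tensor_cochain_in/HH_in.
apply/funext => s; apply/funext => m /=; rewrite /tensor_cochain.
have u0 := klinear_zero (linear_klinear ul).
by rewrite -[_ *: m]addr0 ul u0 addr0.
Qed.

Lemma tensor_deg M n (h : HH A) : hh_part n h = h -> ext_deg n (tensor M h).
Proof. by move=> hn; rewrite /ext_deg tensor_part hn. Qed.

End ExtClasses.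

(** * The radical quotient *)

Section Submodules.
Variable (R : nzRingType).
Implicit Types (X : lmodType R) (I : {pred R^o}).

Definition submodule X (U : X -> Prop) :=
  U 0 /\ forall a x y, U x -> U y -> U (a *: x + y).

Lemma submoduleD X (U : X -> Prop) x y : submodule U -> U x -> U y -> U (x + y).
Proof. by move=> [_ UD] Ux Uy; rewrite -[x]scale1r; exact: UD. Qed.

Lemma submoduleZ X (U : X -> Prop) a x : submodule U -> U x -> U (a *: x).
Proof. by move=> [U0 UD] Ux; rewrite -[_ *: _]addr0; exact: UD. Qed.

Lemma submoduleN X (U : X -> Prop) x : submodule U -> U x -> U (- x).
Proof. by move=> Us Ux; rewrite -scaleN1r; exact: submoduleZ. Qed.

Lemma submoduleB X (U : X -> Prop) x y : submodule U -> U x -> U y -> U (x - y).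
Proof. by move=> Us Ux Uy; apply: submoduleD => //; exact: submoduleN. Qed.

Lemma submod_closedP X (U : {pred X}) : submod_closed U <-> submodule (fun x => x \in U).
Proof. by split. Qed.

Lemma submodule_pred X (U : X -> Prop) : submodule U ->
  submod_closed ((fun x => `[< U x >]) : {pred X}).
Proof.
move=> [U0 UD]; split; first exact/asboolP.
by move=> a x y /asboolP Ux /asboolP Uy; apply/asboolP; exact: UD.
Qed.

Lemma submodule_add X (U : X -> Prop) x : submodule U ->
  submodule (fun y => exists a, U (y - a *: x)).
Proof.
move=> Us; split; first by exists 0; rewrite scale0r subr0; case: Us.
move=> a y z [b Ub] [c Uc]; exists (a * b + c).
rewrite scalerDl -scalerA opprD addrACA -scalerBr.
by case: Us => _; exact.
Qed.

(** By maximality the left ideal generated by I and c contains 1. *)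
Lemma maximal_left_ideal_inv I c : maximal_left_ideal I -> c \notin I ->
  exists b, 1 - b * c \in I.
Proof.
move=> [Is Ip Imax] cI.
have Js := submodule_pred (submodule_add c ((submod_closedP I).1 Is)).
set J := (X in submod_closed X) in Js.
have [] := Imax J Js; last 1 first.
- by move=> JT; have := JT 1; rewrite inE => /asboolP[b]; exists b.
- by move=> x xI; apply/asboolP; exists 0; rewrite scale0r subr0.
move=> JI; case/negP: cI; rewrite -JI; apply/asboolP; exists 1.
by rewrite scale1r subrr; case: Is.
Qed.

Lemma jacobson_sub I : maximal_left_ideal I -> {subset @jacobson R <= I}.
Proof. by move=> mI x /asboolP; exact. Qed.

Lemma notin_jacobson (x : R) : x \notin @jacobson R ->
  exists2 I, maximal_left_ideal I & x \notin I.
Proof.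
move=> /negP xJ; apply: contrapT => nI; apply: xJ; apply/asboolP => I mI.
by apply/negPn/negP => xI; apply: nI; exists I.
Qed.

Lemma one_notin_maximal I : maximal_left_ideal I -> 1 \notin I.
Proof.
move=> [Is Ip _]; apply/negP => I1; apply: Ip => x; rewrite [RHS]inE.
by have := submoduleZ x Is I1; rewrite -[x *: 1]/(x * 1) mulr1.
Qed.

Local Notation radcls := (@cls R R^o _ _ (predT_closed R) (@jacobson_closed R)).

Lemma radclsD (a b : R) : radcls (a + b) = radcls a + radcls b.
Proof. exact: clsD. Qed.

Lemma radclsZ (a b : R) : radcls (a * b) = a *: radcls b.
Proof. exact: clsZ. Qed.

Lemma radcls_eq (a b : R) : (radcls a == radcls b) = (a - b \in @jacobson R).
Proof. exact: cls_eq. Qed.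

Lemma radcls0 : radcls 0 = 0.
Proof. by apply: (@addrI _ (radcls 0)); rewrite -radclsD !addr0. Qed.

Lemma radcls_rep (x : mod_radical R) : radcls (rep x) = x.
Proof. exact: repK. Qed.

(** [rep] is linear only up to the radical, but the radical lies in I. So a maximal left ideal cuts
    out a submodule of the radical quotient. *)
Lemma radical_rep_in I (phi : mod_radical R) (psi : mod_radical R) a : maximal_left_ideal I ->
  rep phi \in I -> rep psi \in I -> rep (a *: phi + psi) \in I.
Proof.
move=> mI phiI psiI; have [Is _ _] := mI.
have : rep (a *: phi + psi) - (a * rep phi + rep psi) \in @jacobson R.
  by rewrite -radcls_eq radclsD radclsZ !radcls_rep.
move=> /(jacobson_sub mI) dI.
rewrite -[rep (_ + _)](subrK (a * rep phi + rep psi)).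
by apply: (submoduleD Is dI); case: Is => _; exact.
Qed.
End Submodules.

(** * Embedding simple modules into the radical quotient *)

Section RadicalQuotient.
Variables (k : fieldType) (A : falgType k).

Lemma submodule_ksubspace (X : lmodType A) (U : X -> Prop) : submodule U -> ksubspace (U : set X).
Proof. by move=> [U0 UD]; split=> // c x y; exact: UD. Qed.

Lemma regular_fin_dim : fin_dim A^o.
Proof.
apply: fg_fin_dim; exists 1%N, (fun=> 1 : A^o) => x; exists (fun=> x).
by rewrite big_ord1 -[RHS]/(x * 1) mulr1.
Qed.

(* A left ideal C minimal among those containing the radical and not contained
   in the maximal left ideal I is a complement of I modulo the radical. *)
Lemma radical_complement (I : {pred A^o}) : maximal_left_ideal I ->
  exists C : A^o -> Prop, [/\ submodule C, (exists2 c, C c & c \notin I) &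
    forall a, C a -> a \in I -> a \in @jacobson A].
Proof.
move=> mI; have [Is Ip _] := mI.
pose Q (C : set A^o) := [/\ submodule C, (forall a, a \in @jacobson A -> C a) &
  exists2 c, C c & c \notin I].
have [||C [Cs CJ [c0 Cc0 c0I]] Cmin] := @ex_minimal_subspace _ _ A^o Q regular_fin_dim.
- exists setT; split=> //; exists 1 => //; exact: one_notin_maximal.
- by move=> U [Us _ _]; exact: submodule_ksubspace.
exists C; split=> //; first by exists c0.
move=> a Ca aI; apply: contrapT => /negP /notin_jacobson[N mN aN].
have [Ns _ _] := mN.
have NIs : submodule (fun x => C x /\ x \in N).
  split; first by case: Cs; case: Ns.
  move=> b x y [Cx Nx] [Cy Ny]; split; first by case: Cs => _; exact.
  by case: Ns => _; exact.
(* If the intersection of C and N is not inside I, minimality puts C inside N, although a is in C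
   and not in N. Otherwise take b with b a = 1 modulo N: then c0 - c0 b a lies in both C and N,
   hence in I, and since a is in I so would be c0. *)
have [[c [Cc cN] cI]|nc] := pselect (exists2 c, C c /\ c \in N & c \notin I).
  have QN : Q (fun x => C x /\ x \in N).
    split=> //; last by exists c.
    by move=> x xJ; split; [exact: CJ|exact: jacobson_sub mN _ xJ].
  have [] := Cmin _ QN _ a Ca; first by move=> x [].
  by move=> _ /idPn; rewrite aN.
have [b bN] := maximal_left_ideal_inv mN aN.
have cbaC : C (c0 *: (b *: a)) by do 2!apply: submoduleZ => //.
have : C (c0 - c0 *: (b *: a)) by exact: submoduleB.
have -> : c0 - c0 *: (b *: a) = c0 *: (1 - b * a) :> A^o.
  by rewrite scalerBr -[c0 *: 1]/(c0 * 1) mulr1.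
move=> C1; have N1 := submoduleZ c0 ((submod_closedP N).1 Ns) bN.
apply: nc; exists (c0 *: (1 - b * a)) => //; apply/negP => I1.
case/negP: c0I; rewrite -[c0](subrK (c0 *: (b *: a))).
have Iba := submoduleZ c0 ((submod_closedP I).1 Is) (submoduleZ b ((submod_closedP I).1 Is) aI).
apply: (submoduleD ((submod_closedP I).1 Is)) Iba.
by rewrite /= (_ : _ - _ = c0 *: (1 - b * a)) // scalerBr -[c0 *: 1]/(c0 * 1) mulr1.
Qed.

Local Notation radcls := (@cls A A^o _ _ (predT_closed A) (@jacobson_closed A)).

(** For a maximal submodule K' and x outside it, K/K' is A/I with I the annihilator of x modulo K'.
    Right multiplication by a suitable e then embeds A/I into A modulo its radical. *)
Lemma nonzero_map_to_radical_quotient (K : lmodType A) : fin_dim K -> (exists x : K, x != 0) ->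
  exists2 theta : K -> mod_radical A, linear theta & exists x, theta x != 0.
Proof.
move=> fK [x0 x0n].
pose Q (U : set K) := submodule U /\ exists x, ~ U x.
have [||K' [Ks [x xK]] Kmax] := @ex_maximal_subspace _ _ K Q fK.
- exists (fun x => x = 0); split; last by exists x0; apply/eqP.
  by split=> // a ? ? -> ->; rewrite scaler0 addr0.
- by move=> U [Us _]; exact: submodule_ksubspace.
have span y (z : K) : ~ K' z -> exists a, K' (y - a *: z).
  move=> zK; apply: contrapT => nb.
  have QV : Q (fun y => exists a, K' (y - a *: z)).
    by split; [exact: submodule_add|exists y].
  apply: zK; apply: (Kmax _ QV); first by move=> u; exists 0; rewrite scale0r subr0.
  by exists 1; rewrite scale1r subrr; case: Ks.
pose I : {pred A^o} := fun a => `[< K' (a *: x) >].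
have Is : submodule (fun a : A^o => K' (a *: x)).
  split; first by rewrite scale0r; case: Ks.
  by move=> a b c Kb Kc; rewrite scalerDl -scalerA; case: Ks => _; exact.
have mI : maximal_left_ideal I.
  split; first exact: submodule_pred.
  - by move=> /(_ 1); rewrite inE => /asboolP; rewrite scale1r.
  - move=> J Js IJ; have [JI|nJI] := pselect (J =i I); [by left|right].
    have [a aJ aI] : exists2 a, a \in J & a \notin I.
      apply: contrapT => na; apply: nJI => a; apply/idP/idP => [aJ|/IJ//].
      by apply/negPn/negP => aI; apply: na; exists a.
    have [|b Kb] := span x (a *: x).
      by move=> Ka; case/negP: aI; apply/asboolP.
    have ba : 1 - b *: a \in J.
      by apply/IJ/asboolP; rewrite scalerBl scale1r -scalerA.
    have J1 : 1 \in J.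
      rewrite -(subrK (b *: a) 1); apply: (submoduleD Js ba).
      exact: (submoduleZ b Js aJ).
    move=> c; rewrite [RHS]inE; have := submoduleZ c Js J1.
    by rewrite -[c *: 1]/(c * 1) mulr1.
have [C [Cs [c0 Cc0 c0I] CIJ]] := radical_complement mI.
have [b bc0] := maximal_left_ideal_inv mI c0I.
(* e lies in C and is 1 modulo I. Hence for a in I the product a e is in both C and I, so in the
   radical, while e itself is not in I. *)
pose e : A := b * c0; have Ce : C e by exact: (submoduleZ b Cs Cc0).
have IeJ (a : A) : K' (a *: x) -> a * e \in @jacobson A.
  move=> Ka; apply: CIJ; first exact: (submoduleZ a Cs Ce).
  have Ia : a \in I by apply/asboolP.
  have Iae := submoduleZ a (submodule_pred Is) bc0.
  rewrite -(subrK a (a * e)); apply: (submoduleD (submodule_pred Is)) Ia.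
  have := submoduleN (submodule_pred Is) Iae.
  by rewrite scalerBr opprB -[a *: 1]/(a * 1) mulr1.
have [t tE] := choice (fun y => span y x xK).
have radE y a : K' (y - a *: x) -> radcls (t y * e) = radcls (a * e).
  move=> Ka; apply/eqP; rewrite radcls_eq -mulrBl; apply: IeJ.
  rewrite scalerBl; have := submoduleB Ks Ka (tE y).
  by rewrite opprB addrC addrA subrK.
exists (fun y => radcls (t y * e)).
  move=> a y z; rewrite (radE _ (a * t y + t z)).
    by rewrite mulrDl -mulrA radclsD radclsZ.
  rewrite scalerDl -scalerA opprD addrACA -scalerBr.
  by case: Ks => _; apply; exact: tE.
exists x; rewrite (radE _ 1); last by rewrite scale1r subrr; case: Ks.
rewrite mul1r -radcls0 radcls_eq subr0; apply/negP => /(jacobson_sub mI) eI.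
have := one_notin_maximal mI => /negP; apply; rewrite -(subrK e 1).
exact: (submoduleD (submodule_pred Is) bc0 eI).
Qed.
End RadicalQuotient.

(** * Periodicity *)

Section Syzygies.
Variable (R : nzRingType).
Implicit Types M N P K : lmodType R.

Lemma cover_superfluous P M (p : {linear P -> M}) (U : P -> Prop) : projective_cover p ->
    submodule U -> (forall x, exists2 u, U u & p u = p x) ->
  forall x, U x.
Proof.
move=> [_ _ sup] Us Up x; have Upred := submodule_pred Us.
have /(_ x) : (fun x => `[< U x >]) =i (predT : {pred P}).
  apply: sup => // y; have [u Uu pu] := Up y.
  exists u, (y - u); split; first exact/asboolP.
    by rewrite linearB /= pu subrr.
  by rewrite addrC subrK.
by rewrite [RHS]inE => /asboolP.
Qed.

(** Lifts of generators of M span a submodule that still maps onto M, and minimality of the cover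
    makes it all of P. *)
Lemma cover_fg P M (p : {linear P -> M}) : projective_cover p -> fg_module M -> fg_module P.
Proof.
move=> pc [n [g gE]]; have [_ ps _] := pc; have [q qE] := choice (fun j => ps (g j)).
exists n, q; apply: (cover_superfluous pc).
  split; first by exists (fun=> 0); rewrite big1// => j _; rewrite scale0r.
  move=> a _ _ [c ->] [d ->]; exists (fun j => a * c j + d j).
  rewrite scaler_sumr -big_split; apply: eq_bigr => j _.
  by rewrite scalerDl -scalerA.
move=> x; have [c cE] := gE (p x); exists (\sum_j c j *: q j); first by exists c.
by rewrite linear_sum cE; apply: eq_bigr => j _; rewrite linearZ /= qE.
Qed.

Lemma syzygy_zero M K : (forall x : M, x = 0) -> is_syzygy M K -> forall x : K, x = 0.
Proof.
move=> M0 [P [p [i [pc ii _]]]] x; apply: ii; rewrite linear0.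
apply: (@cover_superfluous _ _ p (fun x => x = 0) pc) => [|y].
  by split=> // a y z -> ->; rewrite scaler0 addr0.
by exists 0 => //; rewrite [LHS]M0 [RHS]M0.
Qed.

(** Used contrapositively: since M comes back after a full period, the first syzygy of a nonzero
    periodic module is nonzero. *)
Lemma nth_syzygy_zero n M K : (forall x : M, x = 0) -> is_nth_syzygy n M K ->
  forall x : K, x = 0.
Proof.
elim: n M => [|n IH] M M0 /=; last by move=> [L /(syzygy_zero M0) L0]; exact: IH.
by move=> [f [g gK fK]] x; rewrite -[x]fK (M0 (g x)) linear0.
Qed.
End Syzygies.

(** * Dimension shift along syzygies *)

Section Shift.
Variables (k : fieldType) (A : falgType k).
Implicit Types M N P K : lmodType A.

Lemma fin_dim_fg M : fin_dim M -> fg_module M.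
Proof. by move=> [n [e [c [_ cE]]]]; exists n, e => x; exists (fun i => (c i x)%:A). Qed.

(** Surjectivity is asked from degree 0 on, but injectivity only for classes without degree 0
    component, as maps that factor through a projective are killed. With this form shifts
    compose. *)
Definition ext_shift n M K (g : Ext M K) :=
  ext_deg n g /\ forall N,
    (forall i (x : Ext M N), ext_deg (i + n)%N x -> exists2 y, ext_deg i y & x = yoneda y g)
    /\ (forall y : Ext K N, ext_value0 y = 0 -> yoneda y g = 0 -> y = 0).

Lemma ext_shift_comp m n M K L (g : Ext M K) (h : Ext K L) :
  ext_shift m g -> ext_shift n h -> ext_shift (n + m)%N (yoneda h g).
Proof.
move=> [gm gP] [hn hP]; split; first exact: ext_deg_yoneda.
move=> N; have [gS gI] := gP N; have [hS hI] := hP N; split.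
  move=> i x; rewrite addnA => /gS[y /hS[z zi ->] ->].
  by exists z => //; rewrite yonedaA.
move=> y y0; rewrite yonedaA => /gI yh; apply: hI => //; apply: yh.
by rewrite ext_value0_yoneda y0.
Qed.

Lemma isomorphic_shift M K : isomorphic M K -> exists g : Ext M K, ext_shift 0 g.
Proof.
move=> [f [f' f'K fK]]; exists (ext0 f); have fl : linear f by exact: linearP.
have f'l : linear f' by exact: (can2_linear f'K fK).
split; first exact: ext0_deg.
move=> N; split=> [i x|y _ yf].
  rewrite addn0 => xi; exists (yoneda x (ext0 f')).
    by rewrite -[i]addn0; apply: ext_deg_yoneda => //; exact: ext0_deg.
  rewrite -yonedaA ext0_comp// (_ : f' \o f = id) ?yoneda1r//.
  by apply/funext => z /=; rewrite f'K.
rewrite -[y]yoneda1r (_ : id = f \o f'); last by apply/funext => z /=; rewrite fK.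
by rewrite -ext0_comp// yonedaA yf yoneda0l.
Qed.

(** The final clause describes what happens in degree 0, where injectivity fails: the kernel
    consists of the maps that extend along [i] to P. *)
Lemma syzygy_connecting M K : fg_module M -> is_syzygy M K ->
  fg_module K /\ exists P (p : {linear P -> M}) (i : {linear K -> P}) (g : Ext M K),
    [/\ projective_cover p, injective i, (forall x, p x = 0 <-> exists y, i y = x),
        ext_shift 1 g & forall N (theta : K -> N), linear theta ->
          yoneda (ext0 theta) g = 0 -> exists2 phi : P -> N, linear phi & phi \o i = theta].
Proof.
move=> fgM [P [p [i [pc ii ex]]]]; have fgP := cover_fg pc fgM.
have il : linear i by exact: linearP.
have pl : linear p by exact: linearP.
have fK : fin_dim K := sub_fin_dim il ii (fg_fin_dim fgP).
split; first exact: fin_dim_fg.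
have [Pp ps _] := pc.
have [sg sgl sgK] := fin_dim_klinear_section (fg_fin_dim fgM) pl ps.
pose delta := connecting pl ex sgK.
have dZ : delta \in @ext_cocycles k A M K by exact: connecting_in.
have key N y : y \in @ext_cocycles k A K N -> yoneda (ext_cls y) (ext_cls delta) = 0 :> Ext M N ->
    exists2 w, w \in @ext_cocycles k A P N & comp_cup w (kcochain i) = y.
  move=> yZ; rewrite yonedaE// => /eqP; rewrite ext_cls_eq0; last exact: comp_cup_in yZ dZ.
  exact: connecting_inj.
have [n [q [tau qtau]]] := projective_dual_basis Pp fgP.
exists P, p, i, (ext_cls delta); split=> //; last first.
  move=> N theta thl /key; rewrite kcochain_in// => /(_ isT)[w wZ wi].
  exists (w [::]); first exact: cocycle_nil_linear wZ.
  have := congr1 (@^~ [::]) wi; rewrite comp_cup_kr//.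
  exact/cochain_klinear/cocycle_cochain.
split.
  apply: ext_deg_cls => // s s1; rewrite /delta /connecting comp_cup_kl.
  apply/funext => m /=; case: s s1 => [|a [|b s]] // _.
    by rewrite (klinear_zero (retraction_klinear il pl ii ex sgl sgK)).
  by rewrite ext_diff_kcochain2 (klinear_zero (retraction_klinear il pl ii ex sgl sgK)).
move=> N; split=> [j x|y y0 yd].
  rewrite addn1 => /ext_degP[f [fZ fj] ->].
  have fl := cochain_klinear (cocycle_cochain fZ).
  have fpZ : comp_cup f (kcochain p) \in @ext_cocycles k A P N.
    by rewrite comp_cup_in ?kcochain_in.
  have fpE : comp_cup f (kcochain p) = fun s => f s \o p by rewrite comp_cup_kr.
  have [|w wc fw] := projective_coboundary qtau fpZ.
    by rewrite fpE fj.
  (* The degree j component of the primitive w is still a primitive, as f p is concentrated in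
     degree j + 1, and it makes the preimage homogeneous. *)
  have wjc : ext_cochain (deg_part j w) by exact: part_cochain.
  have [|eZ eE] := connecting_surj il pl ex sgl sgK fZ wjc.
    rewrite ext_diff_part -fw; apply/funext => s; rewrite /deg_part.
    by case: ifPn => // sj; rewrite fpE fj.
  set e := - _ in eZ eE; exists (ext_cls e).
    apply: ext_deg_cls => // s sj; rewrite /e -[LHS]/(- (comp_cup _ _ s)) comp_cup_kr.
      rewrite /flip_odd /deg_part (negPf sj) scaler0; exact: oppr0.
    exact/cochain_klinear/ext_cochain_flip.
  rewrite yonedaE//; apply: ext_cls_eq => //; first by rewrite comp_cup_in.
  apply/asboolP; exists (comp_cup (deg_part j w) (kcochain sg)).
    by apply: ext_cochain_comp => //; exact: kcochainP.
  by rewrite {1}eE addrC addKr.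
have [f fZ fE] := ext_clsP y; rewrite fE in y0 yd *.
have [w wZ wi] := key _ _ fZ yd; rewrite ext_value0_cls// in y0.
have wl := cochain_klinear (cocycle_cochain wZ).
(* Dropping the degree 0 part makes [projective_coboundary] applicable; the restriction along [i] is
   unchanged because y has no degree 0 component. *)
pose w' := w + - deg_part 0 w.
have w'Z : w' \in @ext_cocycles k A P N by apply: cocyclesD => //; exact/cocyclesN/part_in.
have w'i : comp_cup w' (kcochain i) = f.
  rewrite comp_cup_kr; last exact/cochain_klinear/cocycle_cochain.
  rewrite -wi comp_cup_kr//; apply/funext => -[|a s]; apply/funext => z; last first.
    exact: subr0.
  rewrite -[RHS]/(w [::] (i z)) -[LHS]/(w [::] (i z) - w [::] (i z)) subrr.
  by have := congr1 (@^~ z) y0; rewrite -wi comp_cup_kr.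
have [|h hc w'E] := projective_coboundary qtau w'Z; first exact: subrr.
apply/eqP; rewrite ext_cls_eq0//; apply/asboolP; exists (comp_cup h (kcochain i)).
  by apply: ext_cochain_comp => //; exact/kcochainP/linear_klinear.
rewrite ext_diff_comp; last exact: cochain_klinear.
rewrite -w'E w'i (ext_diff_linear il) comp_cup0r ?addr0//.
exact/cochain_klinear/ext_cochain_flip.
Qed.

Lemma nth_syzygy_shift n M K : fg_module M -> is_nth_syzygy n M K ->
  exists g : Ext M K, ext_shift n g.
Proof.
elim: n M => [|n IH] M fgM /=; first exact: isomorphic_shift.
move=> [L ML LK]; have [fgL [P [p [i [d [_ _ _ dS _]]]]]] := syzygy_connecting fgM ML.
by have [g gS] := IH L fgL LK; exists (yoneda g d); rewrite -addn1; exact: ext_shift_comp.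
Qed.

Lemma ext1_radical_quotient M : fg_module M -> (exists x : M, x != 0) -> periodic M ->
  exists2 x : Ext M (mod_radical A), ext_deg 1 x & x != 0.
Proof.
move=> fgM [x0 x0n] [[//|n] _ [K MK KM]].
have [fgK [P [p [i [d [pc ii ex [d1 _] dinj]]]]]] := syzygy_connecting fgM MK.
have [||theta thl [y thy]] := @nonzero_map_to_radical_quotient _ A K.
- exact: fg_fin_dim.
- apply: contrapT => nK; case/negP: x0n; apply/eqP; apply: nth_syzygy_zero KM x0 => x.
  by apply/eqP/negPn/negP => xn; apply: nK; exists x.
exists (yoneda (ext0 theta) d).
  by have := ext_deg_yoneda (ext0_deg thl) d1; rewrite add0n.
apply/eqP => /(dinj _ _ thl)[phi phil phii].
have th_rep : rep (phi (i y)) \notin @jacobson A.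
  apply/negP => rJ; case/negP: thy; rewrite -phii /= -[phi _]radcls_rep -radcls0.
  by rewrite radcls_eq subr0.
have [I mI yI] := notin_jacobson th_rep; have [Is _ _] := mI.
case/negP: (yI); apply: (cover_superfluous pc (U := fun z => rep (phi z) \in I)).
  have phi0 := klinear_zero (linear_klinear phil).
  split; last by move=> a u v uI vI; rewrite phil; exact: radical_rep_in.
  rewrite phi0; apply: (jacobson_sub mI).
  by rewrite -[rep _]subr0 -radcls_eq radcls_rep radcls0.
move=> z; have [b bI] := maximal_left_ideal_inv mI yI.
(* Since b inverts [rep (phi (i y))] modulo I, subtracting this multiple of the kernel element [i y]
   moves z into the submodule without changing its image in M. *)
pose c := - (rep (phi z) * b); exists (c *: i y + z); last first.
  rewrite linearD linearZ /= (proj2 (ex (i y))) ?scaler0 ?add0r//.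
  by exists y.
have Is' := (submod_closedP I).1 Is.
rewrite phil -(subrK (c * rep (phi (i y)) + rep (phi z)) (rep _)).
apply: (submoduleD Is').
  by apply: (jacobson_sub mI); rewrite -radcls_eq radclsD radclsZ !radcls_rep.
have := submoduleZ (rep (phi z)) Is' bI; rewrite /c.
by rewrite -[_ *: (1 - _)]/(_ * (1 - _)) mulrBr mulr1 mulrA mulNr addrC.
Qed.
End Shift.

(** * Endomorphisms of an indecomposable module *)

Lemma row_dependence (k : fieldType) m n (B : 'M[k]_(m, n)) : (n < m)%N ->
  exists2 v : 'rV_m, v != 0 & v *m B = 0.
Proof.
move=> nm; have K0 : kermx B != 0.
  rewrite -mxrank_eq0 mxrank_ker -lt0n subn_gt0.
  exact: leq_ltn_trans (rank_leq_col B) nm.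
exists (nz_row (kermx B)); first by rewrite nz_row_eq0.
by apply/sub_kermxP; exact: nz_row_sub.
Qed.

(** Turns an internal decomposition into the product of modules that [indecomposable] speaks of.
    Uniqueness of the components makes the chosen projection linear. *)
Lemma split_indecomposable (R : nzRingType) (M : lmodType R) (U V : {pred M}) :
    indecomposable M -> submod_closed U -> submod_closed V ->
    (forall x, x \in U -> x \in V -> x = 0) ->
    (forall x, exists y, y \in U /\ x - y \in V) ->
  (forall x, x \in U -> x = 0) \/ (forall x, x \in V -> x = 0).
Proof.
move=> [_ indec] Us Vs UV0 UVT; have [a aP] := choice UVT.
have aU x : a x \in sq_num Us by case: (aP x).
have aV x : x - a x \in sq_num Vs by case: (aP x).
have al : linear a.
  move=> c x y; apply/subr0_eq/UV0.
    exact: (submoduleB Us (aU _) (Us.2 c _ _ (aU x) (aU y))).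
  have := submoduleB Vs (Vs.2 c _ _ (aV x) (aV y)) (aV (c *: x + y)).
  by rewrite scalerBr addrACA -opprD opprB [X in X \in _ -> _]addrC addrA subrK.
pose f x : (sq_sub Us * sq_sub Vs)%type := (SqSub (aU x), SqSub (aV x)).
have fl : linear f.
  move=> c x y; congr pair; apply: val_inj; rewrite linearP /=; first exact: al.
  by rewrite al scalerBr opprD addrACA.
pose F : {linear M -> _} := HB.pack f (GRing.isLinear.Build _ _ _ _ f fl).
have F_bij : isomorphic M (sq_sub Us * sq_sub Vs)%type.
  exists F; exists (fun z => val z.1 + val z.2) => [x|[u v]] /=.
    by rewrite addrC subrK.
  have uU : val u \in U := valP u.
  have vV : val v \in V := valP v.
  have auv : a (val u + val v) = val u.
    apply/subr0_eq/UV0; first exact: (submoduleB Us (aU _) uU).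
    have := submoduleB Vs vV (aV (val u + val v)).
    by rewrite opprB [X in X \in _ -> _]addrC opprD addrA subrK.
  by congr pair; apply: val_inj; rewrite /= auv // addrC addKr.
have [U0|V0] := indec _ _ F_bij; [left|right] => x xU.
  by have := congr1 val (U0 (SqSub (xU : x \in sq_num Us))).
by have := congr1 val (V0 (SqSub (xU : x \in sq_num Vs))).
Qed.

(** * Fitting's lemma and eigenvalues *)

Section Fitting.
Variables (k : fieldType) (A : algType k) (M : lmodType A).
Hypothesis fdM : fin_dim M.
Implicit Types u v : M -> M.

Lemma linear_iter n u : linear u -> linear (iter n u).
Proof. by move=> ul a x y; elim: n => //= n ->; rewrite ul. Qed.

Lemma iter_linear0 n u : linear u -> iter n u 0 = 0.
Proof. by move=> /(linear_iter n)/(@linear_klinear k A)/klinear_zero. Qed.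

Definition nilpotent_map u := exists n, forall x, iter n u x = 0.

Lemma fitting_chain u : linear u -> exists n,
  (forall x, iter (n.+1 + n.+1) u x = 0 -> iter n.+1 u x = 0) /\
  (forall x, exists y, iter n.+1 u x = iter (n.+1 + n.+1) u y).
Proof.
move=> ul; pose ker n : set M := fun x => iter n u x = 0.
pose im n : set M := fun x => exists y, x = iter n u y.
have kerS m n : (m <= n)%N -> (ker m `<=` ker n)%classic.
  by move=> /subnK <- x; rewrite /ker iterD => ->; exact: iter_linear0.
have imS m n : (m <= n)%N -> (im n `<=` im m)%classic.
  by move=> /subnKC <- _ [y ->]; exists (iter (n - m) u y); rewrite iterD.
have [||_ [m ->] mmax] := @ex_maximal_subspace _ _ M (fun U => exists n, U = ker n) fdM.
- by exists (ker 0%N), 0%N.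
- move=> _ [n ->]; split; first exact: iter_linear0.
  move=> c x y; rewrite /ker (linear_iter _ ul) => -> ->.
  by rewrite scaler0 addr0.
have [||_ [l ->] lmin] := @ex_minimal_subspace _ _ M (fun U => exists n, U = im n) fdM.
- by exists (im 0%N), 0%N.
- move=> _ [n ->]; split; first by exists 0; rewrite iter_linear0.
  move=> c _ _ [x ->] [y ->]; exists (c%:A *: x + y).
  by rewrite (linear_iter _ ul).
(* Kernels are stable from m on and images from l on. The exponent is [n.+1] and not n, so that a
   preimage under u can be read off from one under the power. *)
pose n := (m + l)%N; exists n; split=> x.
  move=> nx; apply: (kerS m); first by rewrite leqW ?leq_addr.
  apply: (mmax (ker (n.+1 + n.+1)%N)) nx; first by exists (n.+1 + n.+1)%N.
  by apply: kerS; rewrite addSn leqW// /n -addnA leq_addr.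
apply: (lmin (im (n.+1 + n.+1)%N)); first by exists (n.+1 + n.+1)%N.
  by apply: imS; rewrite addnS leqW// /n addnA leq_addl.
by apply: (imS _ n.+1); [rewrite leqW ?leq_addl|exists x].
Qed.

(** For a stable power, M is the direct sum of its kernel and its image; indecomposability makes one
    of them zero. *)
Lemma nilpotent_or_bijective u : indecomposable M -> linear u ->
  nilpotent_map u \/ exists v, [/\ linear v, cancel u v & cancel v u].
Proof.
move=> indec ul; have [n' [kern imn]] := fitting_chain ul.
set n := n'.+1 in kern imn; have nl := linear_iter n ul; have nk := linear_klinear nl.
pose ker x := iter n u x = 0; pose im x := exists y, x = iter n u y.
have kers : submodule ker.
  split; first exact: iter_linear0.
  by move=> a x y; rewrite /ker nl => -> ->; rewrite scaler0 addr0.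
have ims : submodule im.
  split; first by exists 0; rewrite iter_linear0.
  by move=> a _ _ [x ->] [y ->]; exists (a *: x + y); rewrite nl.
have split x : exists y, iter n u (x - iter n u y) = 0.
  have [y yE] := imn x; exists y.
  by rewrite (klinear_add nk) (klinear_opp _ nk) yE iterD subrr.
have [||H|H] := split_indecomposable indec (submodule_pred kers) (submodule_pred ims).
- move=> x /asboolP xk /asboolP[y yE]; rewrite yE; apply: kern.
  by rewrite iterD -yE.
- move=> x; have [y yE] := split x; exists (x - iter n u y).
  by split; apply/asboolP => //; exists y; rewrite opprB addrC subrK.
- right; have ui : injective u.
    move=> x y uxy; apply/subr0_eq/H/asboolP; rewrite /ker /n iterSr.
    rewrite (klinear_add (linear_klinear ul)) (klinear_opp _ (linear_klinear ul)).
    by rewrite uxy subrr iter_linear0.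
  have us y : exists x, u x = y.
    have [z /asboolP/H/subr0_eq ->] := split y; exists (iter n' u z).
    by rewrite /n iterS.
  have [v vK] := choice us; exists v; have uK : cancel u v by move=> x; apply: ui; rewrite vK.
  by split=> // a x y; apply: ui; rewrite ul !vK.
- by left; exists n => x; apply: H; apply/asboolP; exists x.
Qed.

Definition poly_eval (u : M -> M) n (p : {poly k}) (x : M) : M :=
  \sum_(i < n) (p`_i)%:A *: iter i u x.

Lemma poly_eval_factor u n (p : {poly k}) z x : klinear u -> (size p <= n)%N ->
  poly_eval u n.+1 (('X - z%:P) * p) x = u (poly_eval u n p x) - z%:A *: poly_eval u n p x.
Proof.
move=> ul pn; rewrite /poly_eval klinear_sum// scaler_sumr.
under eq_bigr do rewrite mulrBl coefB coefXM coefCM scalerBl scalerBl.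
rewrite sumrB; congr (_ - _).
  rewrite big_ord_recl /= !scale0r add0r; apply: eq_bigr => i _ /=.
  by rewrite klinear_scale.
rewrite big_ord_recr /= nth_default// mulr0 !scale0r addr0.
by apply: eq_bigr => i _; rewrite kscaleA.
Qed.

Lemma poly_eval_injective u (s : seq k) x : klinear u ->
    (forall z, z \in s -> forall y, u y - z%:A *: y = 0 -> y = 0) ->
  poly_eval u (size s).+1 (\prod_(z <- s) ('X - z%:P)) x = 0 -> x = 0.
Proof.
move=> ul; elim: s => [|z s IH] sE.
  by rewrite big_nil /poly_eval big_ord1 coef1 /= !scale1r.
rewrite big_cons poly_eval_factor//; last by rewrite size_prod_XsubC.
move=> /(sE _ (mem_head _ _)); apply: IH => y ys.
by apply: sE; rewrite inE ys orbT.
Qed.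

End Fitting.

(** The n + 1 iterates of u at a nonzero x have n coordinates, so a nonzero polynomial in u kills x.
    It splits into factors u - c; were all of them injective, x would be 0. *)
Lemma ex_eigenvalue (k : closedFieldType) (A : algType k) (M : lmodType A) (u : M -> M) :
  fin_dim M -> (exists x : M, x != 0) -> klinear u ->
  exists c : k, ~ injective (fun x => u x - c%:A *: x).
Proof.
move=> [n [e [c [cl eE]]]] [x x0] ul; apply: contrapT => uinj.
pose B := \matrix_(i < n.+1, j < n) c j (iter i u x).
have [v v0 vB] := row_dependence B (ltnSn n).
pose p := \poly_(i < n.+1) v 0 (inord i).
have pE : poly_eval u n.+1 p x = 0.
  rewrite /poly_eval; under eq_bigr do rewrite coef_poly ltn_ord inord_val [iter _ _ _]eE scaler_sumr.
  rewrite exchange_big big1// => j _.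
  under eq_bigr do rewrite -kscaleA; rewrite -scaler_suml -scaler_suml.
  have := congr1 (fun r : 'rV_n => r 0 j) vB; rewrite !mxE => E.
  rewrite [X in X%:A](_ : _ = 0) ?scale0r// -[RHS]E; apply: eq_bigr => i _.
  by rewrite mxE.
have p0 : p != 0.
  have /rV0Pn[i vi] := v0; apply/eqP => /(congr1 (fun q : {poly k} => q`_i))/eqP.
  by rewrite coef_poly ltn_ord inord_val coef0 (negPf vi).
have [r pr] := closed_field_poly_normal p.
have sr : (size r <= n)%N.
  have := size_poly n.+1 (fun i => v 0 (inord i)); rewrite -/p pr size_scale ?lead_coef_eq0//.
  by rewrite size_prod_XsubC.
case/eqP: x0; apply: (@poly_eval_injective _ _ _ u r x ul) => [z zr y uy|].
  apply: contrapT => /eqP y0; apply: uinj; exists z => inj.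
  case/eqP: y0; apply: inj; rewrite uy (klinear_zero ul) scaler0 subr0//.
have : poly_eval u n.+1 p x = (lead_coef p)%:A *: poly_eval u (size r).+1 (\prod_(z <- r) ('X - z%:P)) x.
  rewrite [in LHS]pr /poly_eval (big_ord_widen n.+1 (fun i => ((\prod_(z <- r) ('X - z%:P))`_i)%:A *: iter i u x)) ?ltnS//.
  rewrite scaler_sumr [RHS]big_mkcond; apply: eq_bigr => i _.
  rewrite coefZ kscaleA; case: ifPn => //; rewrite ltnNge negbK => ri.
  by rewrite [_`_i]nth_default ?size_prod_XsubC// !scale0r scaler0.
rewrite pE => /esym/(congr1 (fun y => (lead_coef p)^-1%:A *: y)).
by rewrite -kscaleA mulVf ?lead_coef_eq0// scaler0 !scale1r => ->.
Qed.

(** For an eigenvalue c the map u - c is not injective, so the Fitting alternative leaves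
    nilpotence. *)
Lemma ex_nilpotent_shift (k : closedFieldType) (A : algType k) (M : lmodType A) (u : M -> M) :
  fin_dim M -> indecomposable M -> linear u ->
  exists c : k, linear (fun x => u x - c%:A *: x) /\ nilpotent_map (fun x => u x - c%:A *: x).
Proof.
move=> fdM indec ul; have [c cu] := ex_eigenvalue fdM indec.1 (linear_klinear ul).
have cl : linear (fun x => u x - c%:A *: x).
  move=> a x y; rewrite ul scalerBr (tensor_scale c) opprD.
  by rewrite addrACA.
exists c; split=> //.
have [//|[v [_ uv _]]] := nilpotent_or_bijective fdM indec cl.
by case: cu; exact: can_inj uv.
Qed.

(** * Degrees in Hochschild cohomology *)

Section HochschildParts.
Variables (k : fieldType) (A : algType k).
Implicit Types x y : HH A.

Local Notation Z := (@hh_cocycles k A).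

Lemma hh_clsP x : exists2 f, f \in Z & x = hh_cls f.
Proof. by exists (rep x); [exact: HH_in|exact/esym/repK]. Qed.

Lemma hh_cocyclesD f g : f \in Z -> g \in Z -> f + g \in Z.
Proof.
have [_ hl] := @hh_cocycles_closed k A => fZ gZ.
by have := hl 1 f g fZ gZ; rewrite scale1r.
Qed.

Lemma hh_cls0 : hh_cls 0 = 0 :> HH A.
Proof.
have [Z0 _] := @hh_cocycles_closed k A.
by apply: (@addrI _ (hh_cls 0)); rewrite -hh_clsD// !addr0.
Qed.

Lemma hh_cls_sum I (r : seq I) (B : pred I) (F : I -> seq A -> A) :
  (forall i, F i \in Z) ->
  hh_cls (\sum_(i <- r | B i) F i) = \sum_(i <- r | B i) hh_cls (F i) :> HH A.
Proof.
move=> FZ; elim: r => [|i r IH]; first by rewrite !big_nil hh_cls0.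
rewrite !big_cons; case: ifP => // _; rewrite hh_clsD ?IH//.
have [Z0 _] := @hh_cocycles_closed k A.
by elim/big_rec: _ => [|j x _ xZ]; rewrite ?Z0// hh_cocyclesD.
Qed.

Lemma hh_partD n x y : hh_part n (x + y) = hh_part n x + hh_part n y.
Proof.
have [f fZ ->] := hh_clsP x; have [g gZ ->] := hh_clsP y.
rewrite -hh_clsD// !hh_partE ?hh_cocyclesD// (@deg_partD A A^o) hh_clsD//; exact: hh_cocycle_comp.
Qed.

Lemma hh_partZ n (c : k) x : hh_part n (c *: x) = c *: hh_part n x.
Proof.
have [f fZ ->] := hh_clsP x; have [Z0 Zl] := @hh_cocycles_closed k A.
have cfZ : c *: f \in Z by rewrite -[_ *: _]addr0 Zl.
rewrite -hh_clsZ// !hh_partE// -hh_clsZ ?hh_cocycle_comp//; congr hh_cls.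
apply/funext => s; rewrite -[RHS]/(c *: (deg_part n (f : seq A -> A^o) s : A)) /deg_part.
by case: ifP; rewrite ?scaler0.
Qed.

Lemma hh_part_zero n : hh_part n (0 : HH A) = 0.
Proof. by apply: (@addrI _ (hh_part n 0)); rewrite -hh_partD !addr0. Qed.

Lemma hh_part_sum n I (r : seq I) (B : pred I) (F : I -> HH A) :
  hh_part n (\sum_(i <- r | B i) F i) = \sum_(i <- r | B i) hh_part n (F i).
Proof.
elim/big_rec2: _ => [|i u v _ <-]; first exact: hh_part_zero.
by rewrite hh_partD.
Qed.

Lemma hh_part_part m n x : hh_part m (hh_part n x) = if m == n then hh_part n x else 0.
Proof.
have [f fZ ->] := hh_clsP x.
rewrite !hh_partE ?hh_cocycle_comp// (@deg_part_part A A^o).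
by case: ifP => // _; exact: hh_cls0.
Qed.

Lemma hh_sum_parts x : exists n,
  (forall m, (n <= m)%N -> hh_part m x = 0) /\ x = \sum_(i < n) hh_part i x.
Proof.
have [f fZ ->] := hh_clsP x; have /asboolP[[fm [n fn]] _] := fZ.
exists n; split=> [m nm|].
  rewrite hh_partE// (_ : deg_part m _ = 0) ?hh_cls0//; apply/funext => s.
  by rewrite /deg_part; case: eqP => // sm; rewrite fn// sm.
under eq_bigr do rewrite hh_partE//.
rewrite -hh_cls_sum; last by move=> i; exact: hh_cocycle_comp.
by congr hh_cls; exact: (@sum_deg_part A A^o).
Qed.

Lemma hh_part_mul n x y :
  hh_part n (x * y) = \sum_(i < n.+1) hh_part i x * hh_part (n - i)%N y.
Proof.
have [f fZ ->] := hh_clsP x; have [g gZ ->] := hh_clsP y.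
rewrite -[_ * _]/(hh_mul _ _) hh_mulE// hh_partE ?hh_cup_in//.
rewrite /hh_cup (@deg_part_cup A A^o A^o A^o) => [|u|s]; [|exact: mul0r|exact: mulr0].
under [RHS]eq_bigr => i _ do rewrite !hh_partE// -[_ * _]/(hh_mul _ _) hh_mulE ?hh_cocycle_comp//.
rewrite -hh_cls_sum// => i; apply: hh_cup_in; exact: hh_cocycle_comp.
Qed.

Lemma hh_part_one : hh_part 0 (1 : HH A) = 1.
Proof.
rewrite hh_partE ?hh_one_in//; congr hh_cls; apply/funext => -[|a s] //.
Qed.

Definition hh_deg n x := hh_part n x = x.

Lemma hh_deg_part n x : hh_deg n (hh_part n x).
Proof. by rewrite /hh_deg hh_part_part eqxx. Qed.

Lemma hh_part_deg m n x : hh_deg n x -> hh_part m x = if m == n then x else 0.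
Proof. by move=> <-; rewrite hh_part_part. Qed.

Lemma hh_deg_mul m n x y : hh_deg m x -> hh_deg n y -> hh_deg (m + n)%N (x * y).
Proof.
move=> xm yn; rewrite /hh_deg hh_part_mul.
have mn : (m < (m + n).+1)%N by rewrite ltnS leq_addr.
rewrite (bigD1 (Ordinal mn)) //= (hh_part_deg _ xm) eqxx addKn yn big1 ?addr0// => i.
by rewrite -val_eqE /= => /negPf im; rewrite (hh_part_deg _ xm) im mul0r.
Qed.

Lemma hh_deg_exp m n x : hh_deg m x -> hh_deg (m * n)%N (x ^+ n).
Proof.
move=> xm; elim: n => [|n IH]; first by rewrite muln0 expr0; exact: hh_part_one.
by rewrite mulnS exprS; exact: hh_deg_mul.
Qed.

Lemma hh_degB n x y : hh_deg n x -> hh_deg n y -> hh_deg n (x - y).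
Proof.
by move=> xn yn; rewrite /hh_deg hh_partD -scaleN1r hh_partZ xn yn.
Qed.

Lemma hh_degZ n (c : k) x : hh_deg n x -> hh_deg n (c *: x).
Proof. by move=> xn; rewrite /hh_deg hh_partZ xn. Qed.

End HochschildParts.

(** * Nilpotent or injective *)

Section HomogeneousEvaluation.
Variables (k : fieldType) (R : algType k).

(** The homogenization of p to degree m, evaluated at (x, y). *)
Definition hom_eval (p : {poly k}) m (x y : R) : R :=
  \sum_(i < m.+1) p`_i *: (x ^+ i * y ^+ (m - i)).

Lemma hom_eval_factor m (p : {poly k}) (z : k) (x y : R) : GRing.comm x y -> (size p <= m.+1)%N ->
  hom_eval (('X - z%:P) * p) m.+1 x y = (x - z *: y) * hom_eval p m x y.
Proof.
move=> cxy pm; rewrite /hom_eval [RHS]mulrBl !mulr_sumr.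
under eq_bigr do rewrite mulrBl coefB coefXM coefCM scalerBl.
rewrite sumrB; congr (_ - _).
  rewrite big_ord_recl /= !scale0r add0r; apply: eq_bigr => i _ /=.
  by rewrite exprS subSS -scalerAr mulrA.
rewrite big_ord_recr /= nth_default// mulr0 !scale0r addr0.
apply: eq_bigr => i _; rewrite -[LHS]scalerA -scalerAl -scalerAr; congr (_ *: (_ *: _)).
have im : (i <= m)%N by rewrite -ltnS.
by rewrite subSn// exprS !mulrA; congr (_ * _); exact/commr_sym/commrX/commr_sym.
Qed.

Lemma hom_eval_binomial n (c : k) (x y : R) : (0 < n)%N ->
  hom_eval ('X^n - c%:P) n x y = x ^+ n - c *: y ^+ n.
Proof.
move=> n_gt0; rewrite /hom_eval; under eq_bigr do rewrite coefB coefXn coefC scalerBl.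
rewrite sumrB; congr (_ - _).
  rewrite (bigD1 ord_max) //= eqxx scale1r subnn mulr1 big1 ?addr0// => i.
  by rewrite -val_eqE /= => /negPf ->; rewrite scale0r.
rewrite (bigD1 ord0) //= mul1r subn0 big1 ?addr0// => i.
by rewrite -val_eqE /= => /negPf ->; rewrite scale0r.
Qed.

End HomogeneousEvaluation.

Section NilOrInjective.
Variables (k : closedFieldType) (A : falgType k) (M X : lmodType A).
Implicit Types x y z : HH A.

Definition nil_on x := exists n, tensor M (x ^+ n) = 0.

(** The condition on [ext_value0] matches the range in which a shift class can be cancelled. *)
Definition injective_on x :=
  forall e : Ext M X, ext_value0 e = 0 -> yoneda e (tensor M x) = 0 -> e = 0.

Lemma nil_onD x y : GRing.comm x y -> nil_on x -> nil_on y -> nil_on (x + y).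
Proof.
move=> cxy [m xm] [n yn]; exists (m + n)%N; rewrite exprDn_comm//.
rewrite tensor_sum big1// => i _; rewrite -mulr_natr.
rewrite tensorM (_ : tensor M (_ * _) = 0) ?yoneda0l//.
have [ni|ni] := leqP n i.
  by rewrite -(subnKC ni) [y ^+ _]exprD !tensorM yn yoneda0l yoneda0r.
have mi : (m <= m + n - i)%N by rewrite -addnBA ?leq_addr// ltnW.
by rewrite -(subnK mi) exprD !tensorM xm yoneda0r yoneda0l.
Qed.

Lemma nil_onM x y : GRing.comm x y -> nil_on x -> nil_on (x * y).
Proof.
move=> cxy [m xm]; exists m; rewrite exprMn_comm// tensorM xm yoneda0l//.
Qed.

Lemma nil_on0 : nil_on 0.
Proof. by exists 1%N; rewrite expr1 tensor0. Qed.

Lemma nil_on_exp x n : nil_on (x ^+ n) -> nil_on x.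
Proof. by move=> [m xm]; exists (n * m)%N; rewrite exprM. Qed.

Lemma injective_onM x y : injective_on x -> injective_on y -> injective_on (x * y).
Proof.
move=> xi yi e e0; rewrite tensorM yonedaA => /yi exy; apply: xi => //; apply: exy.
by rewrite ext_value0_yoneda e0.
Qed.

Lemma injective_on1 : injective_on 1.
Proof. by move=> e _; rewrite tensor1 yoneda1r. Qed.

Lemma injective_on_exp x n : injective_on x -> injective_on (x ^+ n).
Proof.
move=> xi; elim: n => [|n IH]; first by rewrite expr0; exact: injective_on1.
by rewrite exprS; exact: injective_onM.
Qed.

Lemma exp_injective_on x n : (0 < n)%N -> injective_on (x ^+ n) -> injective_on x.
Proof.
case: n => // n _ xi e e0 ex; apply: xi => //.
by rewrite exprS tensorM yonedaA ex yoneda0l.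
Qed.

Lemma nil_injective_absurd x (e : Ext M X) : ext_value0 e = 0 -> e != 0 ->
  injective_on x -> ~ nil_on x.
Proof.
move=> e0 en xi [n xn]; case/eqP: en.
by have := @injective_on_exp x n xi e e0; rewrite xn yoneda0r; exact.
Qed.

(* Since tensor M w commutes with u, (u G)^m = u^m G_m for some G_m. *)
Lemma nil_on_factor w (u : M -> M) (G : Ext M M) : linear u -> nilpotent_map u ->
  tensor M w = yoneda (ext0 u) G -> nil_on w.
Proof.
move=> ul [m um] wE; exists m.
have [G' ->] : exists G', tensor M (w ^+ m) = yoneda (ext0 (iter m u)) G'.
  elim: m {um} => [|m [G' IH]].
    by exists (ext0 id); rewrite expr0 tensor1 yoneda1r.
  exists (yoneda G' G); rewrite exprSr tensorM wE yonedaA tensor_comm// IH.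
  rewrite !yonedaA ext0_comp//; [exact: linear_iter].
rewrite (_ : iter m u = fun=> 0); last exact/funext.
rewrite (_ : ext0 _ = 0) ?yoneda0l//.
by rewrite -ext_cls0; congr ext_cls; apply/funext => -[].
Qed.

Variables (n : nat) (g : Ext M M).
Hypotheses (n_gt0 : (0 < n)%N) (gS : ext_shift n g).
Hypotheses (fdM : fin_dim M) (indec : indecomposable M).

Lemma ext_shift_exp s : exists G : Ext M M, ext_shift (s * n)%N G.
Proof.
elim: s => [|s [G GS]]; last by exists (yoneda g G); rewrite mulSn; exact: ext_shift_comp.
exists (ext0 id); split=> [|N]; first exact: ext0_deg.
split=> [i e|e _]; last by rewrite yoneda1r.
by rewrite addn0 => ei; exists e; rewrite // yoneda1r.
Qed.

(** The n-th power brings x to the degree s n of G, so surjectivity of the shift leaves a factor of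
    degree 0, that is, an endomorphism. *)
Lemma tensor_factor s x (G : Ext M M) : hh_deg s x -> ext_shift (s * n)%N G ->
  exists2 u : M -> M, linear u & tensor M (x ^+ n) = yoneda (ext0 u) G.
Proof.
move=> xs [_ /(_ M)[GS _]].
have /GS[e /ext_deg0P[u ul ->] E] : ext_deg (0 + s * n)%N (tensor M (x ^+ n)).
  exact/tensor_deg/hh_deg_exp.
by exists u.
Qed.

Lemma injective_on_factor s w (u v : M -> M) (G : Ext M M) : ext_shift s G -> linear u ->
  linear v -> cancel v u -> tensor M w = yoneda (ext0 u) G -> injective_on w.
Proof.
move=> [_ /(_ X)[_ GI]] ul vl vK wE e e0; rewrite wE yonedaA => /GI eu.
have {}eu : yoneda e (ext0 u) = 0 by apply: eu; rewrite ext_value0_yoneda e0.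
rewrite -[e]yoneda1r (_ : id = u \o v); last by apply/funext => x /=; rewrite vK.
by rewrite -ext0_comp// yonedaA eu yoneda0l.
Qed.

Lemma nil_or_injective s x : hh_deg s x -> nil_on x \/ injective_on x.
Proof.
move=> xs; have [G GS] := ext_shift_exp s; have [u ul uE] := tensor_factor xs GS.
have [un|[v [vl uv vu]]] := nilpotent_or_bijective fdM indec ul.
  by left; apply: (@nil_on_exp _ n); exact: nil_on_factor uE.
right; apply: (exp_injective_on n_gt0); exact: injective_on_factor GS ul vl vu uE.
Qed.

Lemma ext0_sub_scale (u : M -> M) (c : k) : linear u ->
  ext0 (fun x : M => u x - c%:A *: x) = ext0 u - ext0 (fun x : M => c%:A *: x).
Proof.
move=> ul; have cl := @tensor_scale k A M c.
rewrite -ext_clsN ?kcochain_in// -ext_clsD ?kcochain_in//; last by rewrite cocyclesN ?kcochain_in.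
by congr ext_cls; apply/funext => -[|a s] //; rewrite -[RHS]/(0 - 0) subr0.
Qed.

(** Write x^n = u G and y^n = v G. As y is not nilpotent, v has an inverse w, so x^n = (u w) y^n,
    and c is chosen with u w - c nilpotent. *)
Lemma exp_proportional s x y : hh_deg s x -> hh_deg s y -> ~ nil_on y ->
  exists c : k, nil_on (x ^+ n - c *: y ^+ n).
Proof.
move=> xs ys yn; have [G GS] := ext_shift_exp s.
have [u ul uE] := tensor_factor xs GS; have [v vl vE] := tensor_factor ys GS.
have [vn|[w [wl wv vw]]] := nilpotent_or_bijective fdM indec vl.
  by case: yn; apply: (@nil_on_exp _ n); exact: nil_on_factor vE.
have uwl : linear (u \o w) by move=> a z t /=; rewrite wl ul.
have [c [cl cn]] := ex_nilpotent_shift fdM indec uwl; exists c.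
apply: (nil_on_factor cl cn (G := tensor M (y ^+ n))).
rewrite ext0_sub_scale// yonedaDl yonedaNl -tensorZ tensorD tensorN; congr (_ - _).
rewrite vE yonedaA ext0_comp// uE; congr (yoneda (ext0 _) _).
by apply/funext => z /=; rewrite wv.
Qed.

Variable e1 : Ext M X.
Hypotheses (e1_pos : ext_value0 e1 = 0) (e1_neq0 : e1 != 0).

Lemma nil_onE s x : hh_deg s x -> ~ nil_on x <-> injective_on x.
Proof.
move=> xs; split=> [xn|xi]; first by case: (nil_or_injective xs).
exact: (nil_injective_absurd e1_pos e1_neq0 xi).
Qed.

Lemma nil_on_mul_homogeneous s t x y : hh_deg s x -> hh_deg t y -> nil_on (x * y) ->
  nil_on x \/ nil_on y.
Proof.
move=> xs yt xyn; have [|xi] := nil_or_injective xs; first by left.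
have [|yi] := nil_or_injective yt; first by right.
by case: (nil_injective_absurd e1_pos e1_neq0 (injective_onM xi yi)).
Qed.

(* x^n - c y^n is a product of factors x - z y, one of which is nilpotent. *)
Lemma proportional s x y : GRing.comm x y -> hh_deg s x -> hh_deg s y -> ~ nil_on y ->
  exists c : k, nil_on (x - c *: y).
Proof.
move=> cxy xs ys yn; have [c cn] := exp_proportional xs ys yn.
apply: contrapT => noc.
have [r pr] := closed_field_poly_normal ('X^n - c%:P).
rewrite lead_coefDl ?lead_coefXn ?scale1r in pr; last first.
  by rewrite size_polyN size_polyXn ltnS (leq_trans (size_polyC_leq1 c))// n_gt0.
have sr : size r = n.
  have := congr1 (fun q : {poly k} => size q) pr.
  by rewrite (size_XnsubC _ n_gt0) size_prod_XsubC => -[].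
have : injective_on (hom_eval (\prod_(z <- r) ('X - z%:P)) (size r) x y).
  elim: r {pr sr} => [|z r IH].
    by rewrite big_nil /hom_eval big_ord1 coef1 /= scale1r mulr1; exact: injective_on1.
  rewrite big_cons /= (hom_eval_factor z cxy (eq_leq (size_prod_XsubC r id))).
  apply: injective_onM IH; apply: (proj1 (nil_onE (hh_degB xs (hh_degZ z ys)))).
  by move=> zn; apply: noc; exists z.
rewrite sr -pr (hom_eval_binomial _ _ _ n_gt0) => /(nil_injective_absurd e1_pos e1_neq0); exact.
Qed.

End NilOrInjective.

(** * Maximal ideals of a commutative subring *)

Local Open Scope classical_set_scope.
Local Open Scope ring_scope.

Section CommutativeSubring.
Variables (k : fieldType) (R : algType k) (H : set R).
Hypotheses (H1 : H 1) (HZD : forall (c : k) x y, H x -> H y -> H (c *: x + y)).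
Hypotheses (HM : forall x y, H x -> H y -> H (x * y)).
Hypothesis Hcomm : forall x y, H x -> H y -> x * y = y * x.
Implicit Types (I J m : set R) (Z : set (set R)).

Lemma carrier0 : H 0.
Proof. by have := HZD (-1) H1 H1; rewrite scaleN1r addNr. Qed.

Lemma carrierZ (c : k) x : H x -> H (c *: x).
Proof. by move=> Hx; rewrite -[_ *: _]addr0; apply: HZD => //; exact: carrier0. Qed.

Lemma carrierD x y : H x -> H y -> H (x + y).
Proof. by move=> Hx Hy; rewrite -[x]scale1r; exact: HZD. Qed.

Lemma carrierB x y : H x -> H y -> H (x - y).
Proof. by move=> Hx Hy; rewrite addrC -scaleN1r; exact: HZD. Qed.

Lemma carrierX n x : H x -> H (x ^+ n).
Proof. by move=> Hx; elim: n => [|n IH]; rewrite ?expr0// exprS; exact: HM. Qed.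

Lemma carrierC (c : k) : H c%:A. Proof. exact: carrierZ. Qed.

Lemma carrier_sum T (r : seq T) (B : pred T) (F : T -> R) :
  (forall i, B i -> H (F i)) -> H (\sum_(i <- r | B i) F i).
Proof. by move=> HF; elim/big_rec: _ => [|i x Bi Hx]; [exact: carrier0|apply: carrierD; auto]. Qed.

Lemma ideal_scale I (c : k) x : ideal H I -> I x -> I (c *: x).
Proof. by move=> [_ _ _ IM] Ix; rewrite -mulr_algl; apply: IM => //; exact: carrierC. Qed.

Lemma ideal_sub I x y : ideal H I -> I x -> I y -> I (x - y).
Proof.
by move=> Ii Ix Iy; rewrite -scaleN1r; case: (Ii) => _ _ ID _; apply: ID => //; exact: ideal_scale.
Qed.

Lemma ideal_mulr I x y : ideal H I -> I x -> H y -> I (x * y).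
Proof. by move=> [IH _ _ IM] Ix Hy; rewrite Hcomm//; [exact: IM|exact: IH]. Qed.

Lemma ideal_sum I T (r : seq T) (B : pred T) (F : T -> R) : ideal H I ->
  (forall i, B i -> I (F i)) -> I (\sum_(i <- r | B i) F i).
Proof. by move=> [_ I0 ID _] HF; elim/big_rec: _ => [|i x Bi Hx] //; apply: ID; auto. Qed.

Lemma ideal_add I x : ideal H I -> H x -> ideal H (fun y => H y /\ exists2 r, H r & I (y - x * r)).
Proof.
move=> Ii Hx; have [IH I0 ID IM] := Ii; split.
- by move=> y [].
- by split; [exact: carrier0|exists 0; [exact: carrier0|rewrite mulr0 subr0]].
- move=> y z [Hy [r Hr Iy]] [Hz [s Hs Iz]]; split; first exact: carrierD.
  exists (r + s); first exact: carrierD.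
  by rewrite mulrDr opprD addrACA; exact: ID.
- move=> a y Ha [Hy [r Hr Iy]]; split; first exact: HM.
  exists (a * r); first exact: HM.
  by rewrite mulrA -(Hcomm Ha Hx) -mulrA -mulrBr; exact: IM.
Qed.

Lemma sub_ideal_add I x : ideal H I -> H x -> I `<=` (fun y => H y /\ exists2 r, H r & I (y - x * r)).
Proof.
move=> [IH _ _ _] Hx y Iy; split; first exact: IH.
by exists 0; [exact: carrier0|rewrite mulr0 subr0].
Qed.

Lemma ideal_one I : ideal H I -> I 1 -> I = H.
Proof.
move=> Ii I1; have [IH _ _ IM] := Ii; apply/seteqP; split=> // x Hx.
by rewrite -[x]mulr1; exact: IM.
Qed.

Lemma maximal_one m : maximal_ideal H m -> ~ m 1.
Proof. by move=> [mi mH _] m1; apply: mH; exact: ideal_one. Qed.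

Lemma maximal_scalar m (c : k) : maximal_ideal H m -> m c%:A -> c = 0.
Proof.
move=> mm mc; apply: contrapT => /eqP c0; apply: (maximal_one mm).
have [mi _ _] := mm; have := ideal_scale c^-1 mi mc.
by rewrite scalerA mulVf// scale1r.
Qed.

Lemma maximal_prime m x y : maximal_ideal H m -> H x -> H y -> m (x * y) -> m x \/ m y.
Proof.
move=> [mi mH mmax] Hx Hy mxy; have [mx|nmx] := pselect (m x); [by left|right].
have [mE|JH] := mmax _ (ideal_add mi Hx) (sub_ideal_add mi Hx).
  case: nmx; rewrite -mE; split=> //; exists 1 => //.
  by rewrite mulr1 subrr; case: mi.
have := H1; rewrite -{1}JH => -[_ [r Hr m1]].
have [_ _ mD _] := mi.
rewrite -[y](subrK (x * y * r)); apply: mD; last exact: ideal_mulr.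
have -> : y - x * y * r = (1 - x * r) * y.
  by rewrite mulrBl mul1r -!mulrA (Hcomm Hr Hy).
exact: ideal_mulr.
Qed.

Lemma ideal_proper_maximal I : ideal H I -> ~ I 1 ->
  exists2 m, maximal_ideal H m & I `<=` m.
Proof.
move=> Ii I1; pose P (J : set R) := J = set0 \/ [/\ ideal H J, I `<=` J & ~ J 1].
have [|J [PJ Jmax]] := @Zorn_bigcup R P.
- move=> F FP Ftot; have [[J0 FJ0 J0n]|nF] := pselect (exists2 J, F J & J <> set0); last first.
    left; apply/seteqP; split=> // x [J FJ Jx]; apply: nF; exists J => // J0.
    by rewrite J0 in Jx.
  have [//|[J0i IJ0 J01]] := FP _ FJ0.
  have good J x : F J -> J x -> [/\ ideal H J, I `<=` J & ~ J 1].
    by move=> /FP[->|].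
  right; split.
  + split.
    * by move=> x [J FJ Jx]; have [[JH _ _ _] _ _] := good _ _ FJ Jx; exact: JH.
    * by exists J0 => //; case: J0i.
    * move=> x y [J FJ Jx] [J' FJ' Jy].
      have [[_ _ JD _] _ _] := good _ _ FJ Jx; have [[_ _ JD' _] _ _] := good _ _ FJ' Jy.
      have [JJ'|J'J] := Ftot _ _ FJ FJ'.
        by exists J' => //; apply: JD' => //; exact: JJ'.
      by exists J => //; apply: JD => //; exact: J'J.
    * move=> a x Ha [J FJ Jx]; have [[_ _ _ JM] _ _] := good _ _ FJ Jx.
      by exists J => //; exact: JM.
  + by move=> x /IJ0; exists J0.
  + by move=> [J FJ J1]; have [_ _] := good _ _ FJ J1.
have [J0|[Ji IJ J1]] := PJ.
  exfalso; apply: (Jmax I); last by right; split.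
  rewrite J0; split=> // I0; have [_ I00 _ _] := Ii.
  exact: (I0 _ I00).
exists J => //; split=> //; first by move=> JH; apply: J1; rewrite JH.
move=> J' J'i JJ'; have [J'1|nJ'1] := pselect (J' 1); first by right; exact: ideal_one.
left; apply: contrapT => J'J; apply: (Jmax J').
  by split=> // J'J'; apply: J'J; apply/seteqP.
by right; split=> // x /IJ; exact: JJ'.
Qed.

Lemma ideal_maximal m : maximal_ideal H m -> ideal H m. Proof. by case. Qed.

Lemma zero_locus_point m : maximal_ideal H m -> zero_locus H m = [set m].
Proof.
move=> mm; apply/seteqP; split=> [m' [m'm mm']|_ ->]; last by split.
have [_ _ mmax] := mm; have [m'i m'H _] := m'm.
by have [|] := mmax _ m'i mm'.
Qed.

Lemma principal_locus x m : H x -> maximal_ideal H m ->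
  zero_locus H (fun y => exists2 r, H r & y = x * r) m <-> m x.
Proof.
move=> Hx mm; have [mi _ _] := mm; split=> [[_ xm]|mx].
  by apply: xm; exists 1; rewrite ?mulr1.
by split=> // _ [r Hr ->]; exact: ideal_mulr.
Qed.

Lemma principal_ideal x : H x -> ideal H (fun y => exists2 r, H r & y = x * r).
Proof.
move=> Hx; split.
- by move=> _ [r Hr ->]; exact: HM.
- by exists 0; [exact: carrier0|rewrite mulr0].
- move=> _ _ [r Hr ->] [s Hs ->]; exists (r + s); first exact: carrierD.
  by rewrite mulrDr.
- move=> a _ Ha [r Hr ->]; exists (a * r); first exact: HM.
  by rewrite !mulrA (Hcomm Ha Hx).
Qed.

(** Z is covered by the zero loci of x and of y, each point being a prime ideal: the vanishing ideal
    of an irreducible set is prime. *)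
Lemma irreducible_prime Z x y : irreducible H Z -> (Z `<=` maximal_ideal H) -> H x -> H y ->
    (forall m, Z m -> m (x * y)) ->
  (forall m, Z m -> m x) \/ (forall m, Z m -> m y).
Proof.
move=> [_ Zirr] Zmax Hx Hy Zxy.
pose C x := zero_locus H (fun y => exists2 r, H r & y = x * r).
have Cc x' : H x' -> zariski_closed H (C x').
  by move=> Hx'; exists (fun y => exists2 r, H r & y = x' * r) => //; exact: principal_ideal.
have [|ZC|ZC] := Zirr _ _ (Cc x Hx) (Cc y Hy).
- move=> m Zm; have mm := Zmax _ Zm.
  have [mx|my] := maximal_prime mm Hx Hy (Zxy _ Zm); [left|right]; exact/principal_locus.
- by left=> m Zm; apply/(principal_locus Hx (Zmax _ Zm))/ZC.
- by right=> m Zm; apply/(principal_locus Hy (Zmax _ Zm))/ZC.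
Qed.

Lemma carrier_horner (p : {poly k}) x : H x -> H (horner_alg x p).
Proof.
move=> Hx; rewrite /horner_alg /= /horner_morph horner_coef; apply: carrier_sum => i _.
apply: HM; last exact: carrierX.
by rewrite coef_map; exact: carrierC.
Qed.

Lemma horner_scalar (p : {poly k}) x (c : k) : H x ->
  exists2 r, H r & horner_alg x p - p.[c]%:A = (x - c%:A) * r.
Proof.
move=> Hx; have /factor_theorem[q qE] : root (p - p.[c]%:P) c.
  by rewrite /root !hornerE subrr.
exists (horner_alg x q); first exact: carrier_horner.
have := congr1 (horner_alg x) qE.
rewrite rmorphB rmorphM rmorphB /= !horner_algC horner_algX => ->.
by apply: Hcomm; [exact: carrier_horner|apply: carrierB => //; exact: carrierC].
Qed.

End CommutativeSubring.

(** * A graded curve *)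

Section GradedCurve.
Variables (k : closedFieldType) (R : algType k) (H : set R).
Hypotheses (H1 : H 1) (HZD : forall (c : k) x y, H x -> H y -> H (c *: x + y)).
Hypotheses (HM : forall x y, H x -> H y -> H (x * y)).
Hypothesis Hcomm : forall x y, H x -> H y -> x * y = y * x.

Variable part : nat -> R -> R.
Hypotheses (part_H : forall n x, H x -> H (part n x))
  (partD : forall n x y, part n (x + y) = part n x + part n y)
  (partZ : forall n (c : k) x, part n (c *: x) = c *: part n x)
  (part_part : forall m n x, part m (part n x) = if m == n then part n x else 0)
  (sum_parts : forall x, exists n,
    (forall m, (n <= m)%N -> part m x = 0) /\ x = \sum_(i < n) part i x)
  (part_mul : forall n x y,
    part n (x * y) = \sum_(i < n.+1) part i x * part (n - i)%N y)
  (part_one : part 0%N 1 = 1).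

Variable I : set R.
Hypotheses (Ii : ideal H I) (I1 : ~ I 1) (part_I : forall n x, I x -> I (part n x)).
Local Notation deg n x := (part n x = x).
Hypothesis I_prime_hom : forall m n x y, H x -> H y -> deg m x -> deg n y ->
  I (x * y) -> I x \/ I y.
Hypothesis I_proportional : forall n x y, H x -> H y -> deg n x -> deg n y -> ~ I y ->
  exists c : k, I (x - c *: y).
Variables (h : R) (d : nat).
Hypotheses (Hh : H h) (hd : deg d h) (d0 : (0 < d)%N) (hI : ~ I h).

Let IH : I `<=` H. Proof. by case: Ii. Qed.
Let I0 : I 0. Proof. by case: Ii. Qed.
Let ID x y : I x -> I y -> I (x + y). Proof. by case: Ii => _ _ + _; exact. Qed.
Let IM a x : H a -> I x -> I (a * x). Proof. by case: Ii => _ _ _; exact. Qed.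
Let IZ (c : k) x : I x -> I (c *: x). Proof. exact: (ideal_scale H1 HZD _ Ii). Qed.
Let IB x y : I x -> I y -> I (x - y). Proof. exact: (ideal_sub H1 HZD Ii). Qed.
Let IMr x y : I x -> H y -> I (x * y). Proof. exact: (ideal_mulr Hcomm Ii). Qed.
Let Hc (c : k) : H c%:A. Proof. exact: (carrierC H1 HZD). Qed.

Lemma partN n x : part n (- x) = - part n x.
Proof. by rewrite -scaleN1r partZ scaleN1r. Qed.

Lemma deg_of_part n x : deg n (part n x).
Proof. by rewrite part_part eqxx. Qed.

Lemma part_of_deg m n x : deg n x -> part m x = if m == n then x else 0.
Proof. by move=> <-; rewrite part_part. Qed.

Lemma deg_mul m n x y : deg m x -> deg n y -> deg (m + n)%N (x * y).
Proof.
move=> xm yn; rewrite part_mul.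
have mn : (m < (m + n).+1)%N by rewrite ltnS leq_addr.
rewrite (bigD1 (Ordinal mn)) //= (part_of_deg _ xm) eqxx addKn yn big1 ?addr0// => i.
by rewrite -val_eqE /= => /negPf im; rewrite (part_of_deg _ xm) im mul0r.
Qed.

Lemma deg_exp m n x : deg m x -> deg (m * n)%N (x ^+ n).
Proof.
move=> xm; elim: n => [|n IHn]; first by rewrite muln0 expr0.
by rewrite mulnS exprS; exact: deg_mul.
Qed.

Lemma sum_parts_bound N x : (forall n, (N <= n)%N -> part n x = 0) ->
  x = \sum_(j < N) part j x.
Proof.
move=> xN; have [n [xn xE]] := sum_parts x.
have widen m p : (forall i, (m <= i)%N -> part i x = 0) ->
    \sum_(j < m + p) part j x = \sum_(j < m) part j x.
  by move=> xm; rewrite big_split_ord /= [X in _ + X]big1 ?addr0// => i _; rewrite xm ?leq_addr.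
by rewrite {1}xE -(widen n N xn) addnC widen.
Qed.

(** This is the leading term modulo I; components above it need not be zero, only in I. *)
Lemma top_part x : H x -> ~ I x -> exists n, ~ I (part n x) /\
  forall m, (n < m)%N -> I (part m x).
Proof.
move=> Hx xI; have [N [xN xE]] := sum_parts x.
have : exists n, (n <= N)%N /\ forall m, (n <= m)%N -> I (part m x).
  by exists N; split=> // m /xN ->.
move=> ex; have ex' : exists n, `[< forall m, (n <= m)%N -> I (part m x) >].
  by have [n [_ nP]] := ex; exists n; apply/asboolP.
case: (ex_minnP ex') => -[|n] /asboolP nP nmin.
  by case: xI; rewrite xE; apply: (ideal_sum _ Ii) => i _; exact: nP.
exists n; split=> // In; have := nmin n; rewrite ltnn => /(_ _)/negP; apply => //.
by apply/asboolP => m; rewrite leq_eqVlt => /predU1P[<-//|]; exact: nP.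
Qed.

(** Modulo I, the component of x y in degree a + b is the product of the two leading terms, so
    homogeneous primality suffices. *)
Lemma I_prime x y : H x -> H y -> I (x * y) -> I x \/ I y.
Proof.
move=> Hx Hy xyI; apply: contrapT => /not_orP[xI yI].
have [a [xa xtop]] := top_part Hx xI; have [b [yb ytop]] := top_part Hy yI.
suff : I (part a x * part b y).
  by move=> /(I_prime_hom (part_H _ Hx) (part_H _ Hy) (deg_of_part _ _) (deg_of_part _ _))[].
have := part_I (a + b) xyI; rewrite part_mul.
have ab : (a < (a + b).+1)%N by rewrite ltnS leq_addr.
rewrite (bigD1 (Ordinal ab)) //= addKn => abI.
set s := (X in _ + X) in abI.
have sI : I s.
  apply: (ideal_sum _ Ii) => i; rewrite -val_eqE /= neq_ltn => /orP[ia|ai]; last first.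
    by apply: IMr (part_H _ Hy); exact: xtop.
  apply: IM (part_H _ Hx) _; apply: ytop.
  by rewrite ltn_subRL ltn_add2r.
by rewrite -[part a x * _](addrK s); exact: IB.
Qed.

Lemma I_prime_exp x n : H x -> I (x ^+ n) -> I x.
Proof.
move=> Hx; elim: n => [/I1//|n IHn]; rewrite exprS => /I_prime[]//.
exact: carrierX.
Qed.

(* The quotient by I has at most one dimension in each degree. *)
Lemma dependent_mod_I N (T : finType) (x : T -> R) : (N < #|T|)%N ->
    (forall t, H (x t)) -> (forall t n, (N <= n)%N -> part n (x t) = 0) ->
  exists2 c : T -> k, (exists t, c t != 0) & I (\sum_t c t *: x t).
Proof.
move=> NT Hx xN.
(* [b j] spans the degree j part of H modulo I; it is 0 when that part lies in I. *)
have b_ j : exists b, H b /\ forall y, H y -> deg j y -> exists a : k, I (y - a *: b).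
  have [[b [Hb bj bI]]|nb] := pselect (exists b, [/\ H b, deg j b & ~ I b]).
    by exists b; split=> // y Hy yj; exact: (I_proportional Hy Hb yj bj bI).
  exists 0; split=> [|y Hy yj]; first exact: (carrier0 H1 HZD).
  exists 0; rewrite scale0r subr0; apply: contrapT => yI; apply: nb; by exists y.
have [b bHP] := choice b_; have [Hb bP] := all_and2 bHP.
have a_ t j : exists a : k, I (part j (x t) - a *: b j) by apply: bP; [exact: part_H|exact: deg_of_part].
have a2 t : exists a : nat -> k, forall j, I (part j (x t) - a j *: b j).
  by have [a aP] := choice (a_ t); exists a.
have [a aP] := choice a2.
pose B := \matrix_(i < #|T|, j < N) a (enum_val i) j.
have [v v0 vB] := row_dependence B NT.
exists (fun t => v 0 (enum_rank t)).
  by have /rV0Pn[i vi] := v0; exists (enum_val i); rewrite enum_valK.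
(* The row relation v cancels all multiples of the [b j], so the combination of the x t equals the
   same combination of the remainders, which lie in I. *)
have <- : \sum_t v 0 (enum_rank t) *: \sum_(j < N) (part j (x t) - a t j *: b j) =
    \sum_t v 0 (enum_rank t) *: x t.
  rewrite (eq_bigr (fun t => v 0 (enum_rank t) *: x t - \sum_(j < N)
    (v 0 (enum_rank t) * a t j) *: b j)); last first.
    move=> t _; rewrite sumrB scalerBr -(sum_parts_bound (xN t)); congr (_ - _).
    by rewrite scaler_sumr; apply: eq_bigr => j _; rewrite scalerA.
  rewrite sumrB exchange_big [X in _ - X]big1 ?subr0// => j _.
  rewrite -scaler_suml; have := congr1 (fun r : 'rV_N => r 0 j) vB; rewrite !mxE => E.
  rewrite (_ : \sum_(i : T) _ = 0) ?scale0r// -[RHS]E (reindex (@enum_rank T)) /=; last first.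
    by exists enum_val => ? _; rewrite ?enum_rankK ?enum_valK.
  by apply: eq_bigr => t _; rewrite mxE enum_rankK.
by apply: (ideal_sum _ Ii) => t _; apply: IZ; apply: (ideal_sum _ Ii) => j _.
Qed.

Definition deg_le n x := forall m, (n < m)%N -> part m x = 0.

Lemma deg_le_mul m n x y : deg_le m x -> deg_le n y -> deg_le (m + n) (x * y).
Proof.
move=> xm yn p mnp; rewrite part_mul big1// => i _.
have [mi|im] := ltnP m i; first by rewrite xm ?mul0r.
by rewrite yn ?mulr0// ltn_subRL (leq_ltn_trans _ mnp)// leq_add2r.
Qed.

Lemma deg_le_exp m n x : deg_le m x -> deg_le (m * n) (x ^+ n).
Proof.
move=> xm; elim: n => [|n IHn]; last by rewrite mulnS exprS; exact: deg_le_mul.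
by rewrite muln0 expr0 => p p0; rewrite (part_of_deg _ part_one) gtn_eqF.
Qed.

Lemma ex_deg_le x : exists n, deg_le n x.
Proof. by have [n [xn _]] := sum_parts x; exists n => m /ltnW; exact: xn. Qed.

Lemma horner_alg_sum n (p : {poly k}) (x : R) : (size p <= n)%N ->
  horner_alg x p = \sum_(i < n) p`_i *: x ^+ i.
Proof.
move=> pn; rewrite /horner_alg /= /horner_morph (@horner_coef_wide _ n); last first.
  exact: leq_trans (size_poly _ _) pn.
by apply: eq_bigr => i _; rewrite coef_map /= mulr_algl.
Qed.

(** As long as the constant coefficient vanishes, a factor f can be removed, because I is prime and
    f is outside it. The first nonzero coefficient is then a multiple of f modulo I. *)
Lemma first_coefficient f n (P : nat -> {poly k}) : H f -> ~ I f ->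
    I (\sum_(i < n) f ^+ i * horner_alg h (P i)) -> (exists2 i, (i < n)%N & P i != 0) ->
  exists p : {poly k}, p != 0 /\ exists2 y, H y & I (horner_alg h p - f * y).
Proof.
move=> Hf fI; elim: n P => [|n IHn] P PI [i]//.
pose y := \sum_(i < n) f ^+ i * horner_alg h (P i.+1).
have Hp (p : {poly k}) : H (horner_alg h p) by exact: (carrier_horner H1 HZD HM).
have Hy : H y.
  apply: (carrier_sum H1 HZD) => j _; apply: HM => //.
  exact: (carrierX H1 HM).
have {}PI : I (horner_alg h (P 0%N) + f * y).
  move: PI; rewrite big_ord_recl expr0 mul1r mulr_sumr.
  by under eq_bigr do rewrite /= /bump /= add1n exprS -mulrA.
have [P0|P0] := eqVneq (P 0%N) 0.
  case: i => [|i]; first by rewrite P0 eqxx.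
  rewrite ltnS => ni Pi; apply: (IHn (fun i => P i.+1)); last by exists i.
  by move: PI; rewrite P0 rmorph0 add0r => /(I_prime Hf Hy)[].
move=> _ _; exists (P 0%N); split=> //; exists (- y).
  by rewrite -scaleN1r; exact: (carrierZ H1 HZD).
by rewrite mulrN opprK.
Qed.

(* The (D + d + 1)^2 products f^i h^j with i, j <= D + d have degree at most
   (D + d)^2, where D is the degree of f. *)
Lemma algebraic_mod_I f : H f -> ~ I f -> exists p : {poly k}, p != 0 /\
  exists2 y, H y & I (horner_alg h p - f * y).
Proof.
move=> Hf fI; have [D fD] := ex_deg_le f.
have hD : deg_le d h by move=> m dm; rewrite (part_of_deg _ hd) gtn_eqF.
pose n := (D + d)%N; pose x (ij : 'I_n.+1 * 'I_n.+1) := f ^+ ij.1 * h ^+ ij.2.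
have [||ij m nm|c [[i0 j0] c0] cI] := @dependent_mod_I (n * n).+1 _ x.
(* There are n^2 + 2 n + 1 products for n^2 + 1 degrees; n is positive because d is. *)
- rewrite card_prod card_ord mulSn mulnS addnA !addSn ltnS.
  by rewrite -[X in (X < _)%N]add0n ltn_add2r /n !addn_gt0 d0 !orbT.
- by move=> ij; apply: HM; exact: carrierX.
- have xd : deg_le (D * ij.1 + d * ij.2) (x ij).
    by apply: deg_le_mul; exact: deg_le_exp.
  apply: xd; apply: leq_trans nm; rewrite ltnS /n mulnDl leq_add// leq_mul2l -ltnS ltn_ord orbT//.
pose P (i : 'I_n.+1) := \poly_(j < n.+1) c (i, inord j).
have PE : \sum_(i < n.+1) f ^+ i * horner_alg h (P i) = \sum_t c t *: x t.
  transitivity (\sum_i \sum_j c (i, j) *: x (i, j)); last first.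
    by rewrite pair_bigA; apply: eq_bigr => -[].
  apply: eq_bigr => i _; rewrite (horner_alg_sum (n := n.+1)) ?size_poly// mulr_sumr.
  by apply: eq_bigr => j _; rewrite coef_poly ltn_ord inord_val -scalerAr.
have P0 : P i0 != 0.
  apply/eqP => /(congr1 (fun q : {poly k} => q`_j0))/eqP.
  by rewrite coef_poly ltn_ord inord_val coef0 (negPf c0).
rewrite -PE in cI; apply: (@first_coefficient f n.+1 (fun i => P (inord i)) Hf fI).
  by under eq_bigr do rewrite inord_val.
by exists i0; rewrite ?inord_val.
Qed.

Local Notation V := (zero_locus H I).

(** It suffices that I and h - c generate a proper ideal. If 1 were (h - c) y modulo I, the leading
    term of y multiplied by h would lie in I. *)
Lemma ex_point (c : k) : exists2 m, V m & m (h - c%:A).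
Proof.
have Hhc : H (h - c%:A) by exact: (carrierB HZD).
have Ji := ideal_add H1 HZD HM Hcomm Ii Hhc.
have [|m mm Jm] := ideal_proper_maximal H1 Ji.
  move=> [_ [y Hy y1]].
  have [|a [ya ytop]] := top_part Hy.
    by move=> yI; apply: I1; rewrite -(subrK ((h - c%:A) * y) 1); apply: ID => //; exact: IM.
  (* In degree a + d, which is positive and above a, the unit has no component and c y contributes
     only an element of I. *)
  have := part_I (a + d)%N y1; rewrite mulrBl mulr_algl opprB addrA addrAC.
  rewrite 2!partD partN partZ (part_of_deg _ part_one) addn_eq0 (gtn_eqF d0) andbF add0r.
  have -> : part (a + d)%N (h * y) = h * part a y.
    rewrite part_mul; have dad : (d < (a + d).+1)%N by rewrite ltnS leq_addl.
    rewrite (bigD1 (Ordinal dad)) //= hd addnK big1 ?addr0// => i.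
    by rewrite -val_eqE /= => /negPf id'; rewrite (part_of_deg _ hd) id' mul0r.
  rewrite addrC => hyI; have ytI : I (c *: part (a + d)%N y).
    by apply/IZ/ytop; rewrite -[X in (X < _)%N]addn0 ltn_add2l.
  have {hyI}: I (h * part a y).
    by rewrite -[h * _](subKr (c *: part (a + d)%N y)); apply: IB.
  by move=> /(I_prime Hh (part_H _ Hy))[].
exists m; first by split=> // x /(sub_ideal_add H1 HZD Ii Hhc)/Jm.
apply: Jm; split=> //; exists 1 => //.
by rewrite mulr1 subrr.
Qed.

(** g divides some nonzero p(h) modulo I. At a point with h = c and p(c) nonzero, g cannot
    vanish. *)
Lemma jacobson_property g : H g -> ~ I g -> exists2 m, V m & ~ m g.
Proof.
move=> Hg gI; have [p [/closed_nonrootP[c pc] [y Hy pI]]] := algebraic_mod_I Hg gI.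
have [m [mm Im] mc] := ex_point c; exists m => // mg; have [mi _ _] := mm.
have [_ _ mD _] := mi.
have mp : m (horner_alg h p).
  rewrite -(subrK (g * y) (horner_alg h p)); apply: mD; first exact: Im.
  exact: ideal_mulr mi mg Hy.
have [r Hr rE] := horner_scalar H1 HZD HM Hcomm p c Hh.
have : m (p.[c]%:A).
  rewrite -(subKr (horner_alg h p) p.[c]%:A); apply: (ideal_sub H1 HZD mi) => //.
  by rewrite rE; exact: ideal_mulr mi mc Hr.
by move=> /(maximal_scalar H1 HZD mm)/eqP; apply/negP.
Qed.

Lemma curve_irreducible : irreducible H V.
Proof.
split; first by have [m Vm _] := ex_point 0; exists m.
move=> C D [J1 J1i ->] [J2 J2i ->] VCD; apply: contrapT => /not_orP[nC nD].
have nonvanishing J : ideal H J -> ~ (V `<=` zero_locus H J) -> exists2 f, J f & ~ I f.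
  move=> Ji nVJ; apply: contrapT => nf; apply: nVJ => m [mm Im]; split=> // x Jx.
  by apply: contrapT => mx; apply: nf; exists x => // /Im.
have [f J1f fI] := nonvanishing _ J1i nC; have [g J2g gI] := nonvanishing _ J2i nD.
have [[J1H _ _ _] [J2H _ _ _]] := (J1i, J2i).
have Hf := J1H _ J1f; have Hg := J2H _ J2g.
have [||m Vm mfg] := @jacobson_property (f * g); first exact: HM.
  by move=> /(I_prime Hf Hg)[].
have [mi _ _] := Vm.1; have [_ _ _ mM] := mi.
have [[_ J1m]|[_ J2m]] := VCD _ Vm; apply: mfg.
  exact: ideal_mulr mi (J1m _ J1f) Hg.
by apply: mM => //; exact: J2m.
Qed.

(** * Irreducible subsets on which some element outside I vanishes *)

Section Subvariety.
Variable Z : set (set R).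
Hypotheses (Zirr : irreducible H Z) (ZV : Z `<=` V).
Local Notation van x := (forall m, Z m -> m x).

Let Zmax : Z `<=` maximal_ideal H. Proof. by move=> m /ZV[]. Qed.

Lemma van1 : ~ van 1.
Proof. by case: Zirr => -[m Zm] _ /(_ m Zm); exact: (maximal_one (Zmax Zm)). Qed.

(** Split p into linear factors: the product of the x - c vanishes on the irreducible set Z, hence
    so does one of them. *)
Lemma van_root (p : {poly k}) x : H x -> p != 0 -> van (horner_alg x p) ->
  exists c : k, van (x - c%:A).
Proof.
move=> Hx p0; have [r pr] := closed_field_poly_normal p.
have Hxc c : H (x - c%:A) by exact: (carrierB HZD).
rewrite pr linearZ /= => pv.
have {pv} : van (horner_alg x (\prod_(z <- r) ('X - z%:P))).
  move=> m Zm; have [mi _ _] := Zmax Zm.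
  have := ideal_scale H1 HZD (lead_coef p)^-1 mi (pv m Zm).
  by rewrite mulr_algl scalerA mulVf ?lead_coef_eq0// scale1r.
elim: r {pr} => [|c r IHr]; first by rewrite big_nil rmorph1 => /van1.
rewrite big_cons rmorphM rmorphB /= horner_algX horner_algC => /(irreducible_prime
  H1 HZD HM Hcomm Zirr Zmax (Hxc c))[||//]; last by exists c.
exact: (carrier_horner H1 HZD HM).
Qed.

Variable f : R.
Hypotheses (Hf : H f) (fI : ~ I f) (fv : van f).

(** Some nonzero polynomial in h is a multiple of f modulo I, so it vanishes on Z together with
    f. *)
Lemma van_h : exists c : k, van (h - c%:A).
Proof.
have [p [p0 [y Hy pI]]] := algebraic_mod_I Hf fI.
apply: (van_root Hh p0) => m Zm; have [mm Im] := ZV Zm; have [mi _ _] := mm.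
rewrite -(subrK (f * y) (horner_alg h p)); have [_ _ mD _] := mi; apply: mD.
  exact: Im.
exact: ideal_mulr mi (fv Zm) Hy.
Qed.

(* x^d is a multiple of h^n modulo I, and h is constant on Z. *)
Lemma van_homogeneous n x : H x -> deg n x -> exists c : k, van (x - c%:A).
Proof.
move=> Hx xn; have [c hc] := van_h.
have [a aI] : exists a : k, I (x ^+ d - a *: h ^+ n).
  apply: (@I_proportional (n * d)%N); try exact: (carrierX H1 HM).
  - exact: deg_exp.
  - by rewrite mulnC; exact: deg_exp.
  - by move=> /(I_prime_exp Hh).
(* On Z the element h equals c, so x is there a root of X^d - a c^n. *)
apply: (@van_root ('X^d - (a * c ^+ n)%:P)) => //.
  by rewrite -size_poly_gt0 size_XnsubC.
move=> m Zm; have [mm Im] := ZV Zm; have [mi _ _] := mm; have [_ _ mD _] := mi.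
rewrite rmorphB rmorphXn /= horner_algX horner_algC.
have [r Hr rE] := horner_scalar H1 HZD HM Hcomm 'X^n c Hh.
rewrite rmorphXn /= horner_algX hornerXn in rE.
have -> : x ^+ d - (a * c ^+ n)%:A = (x ^+ d - a *: h ^+ n) + a *: (h ^+ n - (c ^+ n)%:A).
  by rewrite scalerBr scalerA addrA subrK.
apply: mD; first exact: Im.
apply: (ideal_scale H1 HZD) => //; rewrite rE.
exact: ideal_mulr mi (hc m Zm) Hr.
Qed.

Lemma van_all x : H x -> exists c : k, van (x - c%:A).
Proof.
move=> Hx; have [N [_ xE]] := sum_parts x.
have [c cP] := choice (fun n => van_homogeneous (part_H n Hx) (deg_of_part n x)).
exists (\sum_(i < N) c i) => m Zm; have [mi _ _] := Zmax Zm.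
rewrite {1}xE scaler_suml -sumrB; apply: (ideal_sum _ mi) => i _.
exact: cP.
Qed.

(** Every x in H equals a constant c on Z. If x lies in one point of Z, then so does c, hence c = 0
    and x lies in every point of Z. *)
Lemma subvariety_point m m' : Z m -> Z m' -> m = m'.
Proof.
suff sub m1 m2 : Z m1 -> Z m2 -> m1 `<=` m2 by move=> Zm Zm'; apply/seteqP; split; exact: sub.
move=> Z1 Z2 x m1x; have mm1 := Zmax Z1; have [[m1H _ _ _] _ _] := mm1.
have [c cv] := van_all (m1H _ m1x).
have : m1 c%:A.
  rewrite -(subKr x c%:A); apply: (ideal_sub H1 HZD) => //; last exact: cv.
  by case: mm1.
move=> /(maximal_scalar H1 HZD mm1) c0; have := cv m2 Z2.
by rewrite c0 scale0r subr0.
Qed.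
End Subvariety.

Lemma curve_dimension : has_dimension H V 1.
Proof.
have Vc : zariski_closed H V by exists I.
split.
  (* The chain is a point with h = 0 inside V; a point with h = 1 shows that the inclusion is
     strict. *)
  have [m0 V0 m0h] := ex_point 0; have [m1 V1 m1h] := ex_point 1.
  rewrite scale0r subr0 in m0h.
  exists (fun n => if n is 0%N then [set m0] else V); split=> [[|i] _|[|i] // _].
  - split=> [||_ ->//].
      exists m0; first by case: V0.1.
      by rewrite (zero_locus_point V0.1).
    split; first by exists m0.
    by move=> C D _ _ CD; have [Cm|Dm] := CD m0 erefl; [left|right] => _ ->.
  - by split=> //; exact: curve_irreducible.
  split=> [_ ->//|/(_ _ V1) m10].
  have [mi _ _] := V1.1; apply: (maximal_one V1.1).
  have := ideal_sub H1 HZD mi (_ : m1 h) m1h; rewrite scale1r subKr; apply.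
  by rewrite m10.
(* In a chain of length two, Z_1 is proper in Z_2, so some f outside I vanishes on Z_1. Then Z_1 is
   a single point and cannot strictly contain the nonempty Z_0. *)
move=> n Z [Zc Zlt]; rewrite leqNgt; apply/negP => n2.
have [[J [JH _ _ _] Z1E] Z1i Z1V] := Zc 1%N (ltnW n2).
have [[_ [[m0 Z0m0] _] _] [_ _ Z2V]] := (Zc 0%N isT, Zc 2%N n2).
have [[Z01 nZ10] [_ nZ21]] := (Zlt 0%N (ltnW n2), Zlt 1%N n2).
have [f Jf fI] : exists2 f, J f & ~ I f.
  apply: contrapT => nf; apply: nZ21 => m /Z2V[mm Im]; rewrite Z1E; split=> // x Jx.
  by apply: Im; apply: contrapT => xI; apply: nf; exists x.
have fv m : Z 1%N m -> m f by rewrite Z1E => -[_]; exact.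
apply: nZ10 => m Z1m.
by rewrite (@subvariety_point _ Z1i Z1V f (JH _ Jf) fI fv m m0 Z1m)//; exact: Z01.
Qed.

End GradedCurve.

(** * Existence of a non-nilpotent element of positive degree *)

Section FiniteGeneration.
Variables (k : closedFieldType) (A : falgType k) (M : lmodType A) (H : set (HH A)).
Hypotheses (H1 : H 1) (HZD : forall (c : k) x y, H x -> H y -> H (c *: x + y)).
Hypotheses (HM : forall x y, H x -> H y -> H (x * y)).
Hypothesis Hcomm : forall x y, H x -> H y -> x * y = y * x.
Hypothesis (Hhom : homogeneous H).
Hypotheses (Hnoeth : noetherian H) (Hfg : fg_ext H M M).

(** The high-degree tail of Ext(M, M) is what matters: an element outside this set acts nontrivially
    in arbitrarily high degrees. *)
Definition kills_high_degrees (q : HH A) := exists e0 : nat,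
  forall e (x : Ext M M), (e0 <= e)%N -> ext_deg e x -> yoneda x (tensor M q) = 0.
Local Notation P := kills_high_degrees.

Lemma kills_mul r q : H r -> H q -> P q -> P (r * q).
Proof.
move=> Hr Hq [e0 qP]; exists e0 => e x e0e xe.
by rewrite Hcomm// tensorM yonedaA (qP e)// yoneda0l.
Qed.

(** Treating the b one after another, multiply by the largest power of b that stays outside [P]; the
    next power falls into [P]. *)
Lemma annihilated_by_nilpotents (s : seq (HH A)) q :
    (forall b, b \in s -> H b /\ nil_on M b) -> H q -> ~ P q ->
  exists2 r, H r & ~ P (r * q) /\ forall b, b \in s -> P (b * (r * q)).
Proof.
elim: s q => [|b s IHs] q sP Hq qP; first by exists 1; rewrite ?mul1r.
have [Hb [m bm]] := sP b (mem_head _ _).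
have ex : exists m, `[< P (b ^+ m * q) >].
  exists m; apply/asboolP; exists 0%N => e x _ _.
  by rewrite tensorM bm yoneda0l yoneda0r.
case: (ex_minnP ex) => -[|a] /asboolP aP amin; first by rewrite mul1r in aP.
have Ha : H (b ^+ a) by exact: (carrierX H1 HM).
have [||r Hr [rP rs]] := IHs (b ^+ a * q) _ (HM Ha Hq).
- by move=> c cs; apply: sP; rewrite inE cs orbT.
- by move=> /asboolP/amin; rewrite ltnn.
exists (r * b ^+ a); first exact: HM.
rewrite -mulrA.
split; first exact: rP.
move=> c; rewrite inE => /predU1P[->|]; last exact: rs.
have -> : b * (r * (b ^+ a * q)) = r * (b ^+ a.+1 * q).
  by rewrite exprS mulrA (Hcomm Hb Hr) -!mulrA.
apply: (kills_mul Hr _ aP).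
by apply: HM; [exact: (carrierX H1 HM)|exact: Hq].
Qed.

Definition positive_ideal : set (HH A) := fun x => H x /\ hh_part 0 x = 0.

Lemma positive_ideal_ideal : ideal H positive_ideal.
Proof.
split.
- by move=> x [].
- by split; [exact: (carrier0 H1 HZD)|exact: hh_part_zero].
- move=> x y [Hx x0] [Hy y0]; split; first exact: (carrierD HZD).
  by rewrite hh_partD x0 y0 addr0.
- move=> a x Ha [Hx x0]; split; first exact: HM.
  by rewrite hh_part_mul big_ord1 x0 mulr0.
Qed.

(** If all elements of positive degree were nilpotent, some q outside [P] would be sent into [P] by
    all components of the generators of the positive ideal. But in high degree every class is a sum
    of multiples of such components, by finite generation of Ext(M, M), so q would be in [P]. *)
Lemma ex_positive_nonnilpotent :
    (forall e0, exists e (x : Ext M M), [/\ (e0 <= e)%N, ext_deg e x & x != 0]) ->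
  exists s h, [/\ (0 < s)%N, H h, hh_deg s h & ~ nil_on M h].
Proof.
move=> Ext_inf; apply: contrapT => nilH.
have nil s x : (0 < s)%N -> H x -> hh_deg s x -> nil_on M x.
  by move=> s0 Hx xs; apply: contrapT => nx; apply: nilH; exists s, x.
have [r [a [aJ aE]]] := Hnoeth positive_ideal_ideal.
have [t [g gE]] := Hfg.
have [Na NaP] := choice (fun i => hh_sum_parts (a i)).
pose N := (\sum_i Na i)%N.
have aN i m : (N <= m)%N -> hh_part m (a i) = 0.
  move=> Nm; apply: (NaP i).1; apply: leq_trans Nm.
  by rewrite /N (bigD1 i)//= leq_addr.
have [Dg DgP] := choice (fun j => ext_sum_parts (g j)).
pose D := (\sum_j Dg j)%N.
have gD j m : (D <= m)%N -> ext_part m (g j) = 0.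
  move=> Dm; apply: (DgP j).1; apply: leq_trans Dm.
  by rewrite /D (bigD1 j)//= leq_addr.
pose b (is' : 'I_r * 'I_N) := hh_part is'.2 (a is'.1).
pose bs := [seq b is' | is' : 'I_r * 'I_N <- enum {: 'I_r * 'I_N} & (0 < is'.2)%N].
have Ha i : H (a i) by case: (aJ i).
have bsP c : c \in bs -> H c /\ nil_on M c.
  move=> /mapP[[i s]]; rewrite mem_filter /= => /andP[s0 _] ->.
  have Hb : H (b (i, s)) by exact/Hhom.
  by split=> //; apply: (nil s) => //; rewrite /hh_deg hh_part_part eqxx.
have P1 : ~ P 1.
  move=> [e0 e0P]; have [e [x [e0e xe]]] := Ext_inf e0.
  by case/eqP; have := e0P e x e0e xe; rewrite tensor1 yoneda1r.
have [q Hq [qP qb]] := annihilated_by_nilpotents bsP H1 P1.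
rewrite mulr1 in qP qb; apply: qP.
have E_ (is' : 'I_r * 'I_N) : exists e0, (0 < is'.2)%N -> forall e (x : Ext M M),
    (e0 <= e)%N -> ext_deg e x -> yoneda x (tensor M (b is' * q)) = 0.
  have [s0|] := boolP (0 < is'.2)%N; last by exists 0%N.
  have [|e0 e0P] := qb (b is'); last by exists e0.
  by apply/mapP; exists is' => //; rewrite mem_filter s0 mem_enum.
have [E EP] := choice E_; pose Emax := (\sum_is' E is')%N.
(* [D] bounds the degrees of the [g j], so their coefficients have positive degree in degree e.
   Splitting off a component of some [a i] costs less than [N], and the remaining factor still has
   degree at least [Emax]. *)
exists (D + (N + Emax))%N => e x ex_ge xe.
have [c Hc xE] := gE x; rewrite -xe xE ext_part_sum yoneda_suml big1// => j _.
rewrite ext_part_yoneda yoneda_suml big1// => -[l /= le] _.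
have [Dl|lD] := leqP D l; first by rewrite gD// !yoneda0l.
rewrite tensor_part -yonedaA -tensorM.
set n := (e - l)%N; set z := hh_part n (c j).
have n0 : (0 < n)%N.
  by rewrite subn_gt0 (leq_trans lD)// (leq_trans _ ex_ge)// leq_addr.
have zn : hh_part n z = z by rewrite hh_part_part eqxx.
have zJ : positive_ideal z.
  split; first exact: Hhom.
  by rewrite hh_part_part eq_sym (gtn_eqF n0).
have [w Hw zE] := aE z zJ.
rewrite -zn zE hh_part_sum mulr_suml tensor_sum yoneda_sumr big1// => i _.
rewrite hh_part_mul mulr_suml tensor_sum yoneda_sumr big1// => -[u /= un] _.
rewrite -mulrA tensorM yonedaA.
have [N_le|ltN] := leqP N (n - u)%N.
  by rewrite aN// mul0r tensor0 yoneda0r.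
have [nu0|nu0] := posnP (n - u)%N.
  by rewrite nu0 (aJ i).2 mul0r tensor0 yoneda0r.
apply: (EP (i, Ordinal ltN) nu0 (l + u)%N); last first.
  apply: ext_deg_yoneda; first exact: ext_deg_part.
  by apply: tensor_deg; rewrite hh_part_part eqxx.
have Ei : (E (i, Ordinal ltN) <= Emax)%N.
  by rewrite /Emax (bigD1 (i, Ordinal ltN))//= leq_addr.
have eE : (l + u + (n - u) = e)%N.
  by rewrite -addnA subnKC -1?ltnS// subnKC// -ltnS.
rewrite -(leq_add2r (n - u)%N) eE; apply: leq_trans (leq_add Ei (ltnW ltN)) _.
by apply: leq_trans ex_ge; rewrite [(N + _)%N]addnC leq_addl.
Qed.
End FiniteGeneration.

(** * The variety is a line *)

Section NilpotentIdeal.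
Variables (k : closedFieldType) (A : falgType k) (M : lmodType A) (H : set (HH A)).
Hypotheses (H1 : H 1) (HZD : forall (c : k) x y, H x -> H y -> H (c *: x + y)).
Hypotheses (HM : forall x y, H x -> H y -> H (x * y)).
Hypothesis Hcomm : forall x y, H x -> H y -> x * y = y * x.
Hypothesis (Hhom : homogeneous H).

(** Asking for nilpotence of each component makes homogeneity immediate. *)
Definition nilpotent_ideal : set (HH A) :=
  fun x => H x /\ forall n, nil_on M (hh_part n x).

Lemma nilpotent_ideal_ideal : ideal H nilpotent_ideal.
Proof.
split.
- by move=> x [].
- split; first exact: (carrier0 H1 HZD).
  by move=> n; rewrite hh_part_zero; exact: nil_on0.
- move=> x y [Hx xn] [Hy yn]; split; first exact: (carrierD HZD).
  move=> n; rewrite hh_partD; apply: nil_onD; [|exact: xn|exact: yn].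
  by apply: Hcomm; exact: Hhom.
- move=> a x Ha [Hx xn]; split; first exact: HM.
  move=> n; rewrite hh_part_mul.
  suff [] : H (\sum_(i < n.+1) hh_part i a * hh_part (n - i)%N x) /\
    nil_on M (\sum_(i < n.+1) hh_part i a * hh_part (n - i)%N x) by [].
  elim/big_rec: _ => [|i y _ [Hy yn]].
    by split; [exact: (carrier0 H1 HZD)|exact: nil_on0].
  have Hi := Hhom i Ha; have Hni := Hhom (n - i)%N Hx; have Hini := HM Hi Hni.
  split; first exact: (carrierD HZD).
  apply: nil_onD; [exact: Hcomm| |exact: yn].
  by rewrite (Hcomm Hi Hni); apply: nil_onM; [exact: Hcomm|exact: xn].
Qed.

Lemma nilpotent_ideal_part n x : nilpotent_ideal x -> nilpotent_ideal (hh_part n x).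
Proof.
move=> [Hx xn]; split; first exact: Hhom.
move=> m; rewrite hh_part_part; case: ifP => _; [exact: xn|exact: nil_on0].
Qed.

Lemma nilpotent_ideal_deg s x : hh_deg s x -> H x -> nilpotent_ideal x <-> nil_on M x.
Proof.
move=> xs Hx; split=> [[_ /(_ s)]|xn]; first by rewrite xs.
split; first exact: Hx.
by move=> n; rewrite (hh_part_deg _ xs); case: ifP => _; [exact: xn|exact: nil_on0].
Qed.

Lemma ann_ideal (N : lmodType A) : ideal H (ann H M N).
Proof.
split.
- by move=> x [].
- split; first exact: (carrier0 H1 HZD).
  by move=> e; rewrite /ext_act tensor0 yoneda0r.
- move=> x y [Hx xe] [Hy ye]; split; first exact: (carrierD HZD).
  move=> e; rewrite /ext_act tensorD yonedaDr.
  by have := xe e; have := ye e; rewrite /ext_act => -> ->; rewrite addr0.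
- move=> a x Ha [Hx xe]; split; first exact: HM.
  move=> e; rewrite /ext_act tensorM yonedaA; exact: xe.
Qed.

(** Test against homogeneous e of degree j: the component of e x in degree j + n is e times the
    component of x in degree n. *)
Lemma ann_homogeneous (N : lmodType A) : homogeneous (ann H M N).
Proof.
move=> n x [Hx xe]; split; first exact: Hhom.
move=> e; have [m [_ ->]] := ext_sum_parts e.
rewrite /ext_act yoneda_suml big1// => j _; set ej := ext_part j e.
have : ext_part (j + n)%N (yoneda ej (tensor M x)) = 0.
  by have := xe ej; rewrite /ext_act => ->; exact: ext_part0.
have jn : (j < (j + n).+1)%N by rewrite ltnS leq_addr.
rewrite ext_part_yoneda (bigD1 (Ordinal jn)) //= addKn big1 => [|i].
  by rewrite addr0 ext_deg_part tensor_part.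
rewrite -val_eqE /= => /negPf ij.
by rewrite (ext_part_deg _ (ext_deg_part j e)) ij yoneda0l.
Qed.

Lemma nil_on_maximal (N : lmodType A) m x : maximal_ideal H m -> ann H M N `<=` m ->
  H x -> nil_on M x -> m x.
Proof.
move=> mm am Hx [p xp].
have : m (x ^+ p).
  apply: am; split; first exact: (carrierX H1 HM).
  by move=> e; rewrite /ext_act xp yoneda0r.
elim: p {xp} => [|p IHp]; first by rewrite expr0 => /(maximal_one mm).
rewrite exprS => /(maximal_prime H1 HZD HM Hcomm mm Hx)[|//|//].
exact: (carrierX H1 HM).
Qed.

Lemma nilpotent_ideal_maximal (N : lmodType A) m : maximal_ideal H m -> ann H M N `<=` m ->
  nilpotent_ideal `<=` m.
Proof.
move=> mm am x [Hx xn]; have [p [_ ->]] := hh_sum_parts x.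
apply: (ideal_sum _ (ideal_maximal mm)) => i _.
apply: (nil_on_maximal mm am); [exact: Hhom|exact: xn].
Qed.

End NilpotentIdeal.

Theorem proposition4p2 (k : closedFieldType) (L : falgType k) (H : set (HH L))
    (M : lmodType L) :
  indecomposable_algebra L -> selfinjective L ->
  graded_subalgebra H ->
  (forall x y, H x -> H y -> x * y = y * x) ->
  noetherian H ->
  contains_HH0 H ->
  fg_module M -> indecomposable M -> periodic M ->
  fg_ext H M M ->
  line H (variety H M).
Proof.
move=> _ _ [[H1' HZD' HM'] Hhom] Hcomm Hnoeth _ fgM indec per Hfg.
have H1 : H 1 by exact: set_mem H1'.
have HZD (c : k) x y : H x -> H y -> H (c *: x + y).
  by move=> Hx Hy; apply: set_mem; apply: HZD'; exact: mem_set.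
have HM x y : H x -> H y -> H (x * y).
  by move=> Hx Hy; apply: set_mem; apply: HM'; exact: mem_set.
have fdM := fg_fin_dim fgM.
have [n n0 /(nth_syzygy_shift fgM)[g gS]] := per.
have [e1 d1 e1n] := ext1_radical_quotient fgM indec.1 per.
have e1_pos := ext_value0_deg d1.
have dich := nil_or_injective (mod_radical L) n0 gS fdM indec.
pose P := nilpotent_ideal M H.
(* A component of an annihilating element kills [e1], so it is not injective and must be
   nilpotent. *)
have annP : ann H M (mod_radical L) `<=` P.
  move=> x xa; split; first by case: xa.
  move=> s; have [_ xs] := ann_homogeneous Hhom s xa.
  have [//|xi] := dich s (hh_part s x) (hh_deg_part s x).
  by case/eqP: e1n; apply: xi => //; exact: xs.
(* A power of a nilpotent element annihilates, and maximal ideals are prime; with [annP] this gives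
   both inclusions. *)
have VE : variety H M = zero_locus H P.
  apply/seteqP; split=> m [mm sub]; split=> //.
    exact: (nilpotent_ideal_maximal H1 HZD HM Hcomm Hhom mm sub).
  by move=> x /annP; exact: sub.
have [s [h [s0 Hh hs hn]]] : exists s h, [/\ (0 < s)%N, H h, hh_deg s h & ~ nil_on M h].
  apply: (ex_positive_nonnilpotent H1 HZD HM Hcomm Hhom Hnoeth Hfg) => e0.
  (* G has degree e0 n, at least e0, and is nonzero because composing [e1] with it is nonzero. *)
  have [G GS] := ext_shift_exp gS e0; have [Gd /(_ (mod_radical L))[_ GI]] := GS.
  exists (e0 * n)%N, G; split; [exact: leq_pmulr|exact: Gd|].
  by apply/eqP => G0; case/eqP: e1n; apply: GI => //; rewrite G0 yoneda0r.
have Pi : ideal H P := nilpotent_ideal_ideal M H1 HZD HM Hcomm Hhom.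
have nilP t x : hh_deg t x -> H x -> P x <-> nil_on M x by exact: nilpotent_ideal_deg.
have P1 : ~ P 1.
  move=> /(nilP 0%N 1 (hh_part_one L) H1); apply: (nil_injective_absurd e1_pos e1n).
  exact: injective_on1.
have P_part t x : P x -> P (hh_part t x) by exact: nilpotent_ideal_part.
have P_hom i j x y : H x -> H y -> hh_part i x = x -> hh_part j y = y ->
    P (x * y) -> P x \/ P y.
  move=> Hx Hy xi yj /(nilP _ _ (hh_deg_mul xi yj) (HM _ _ Hx Hy)) xyn.
  have [xn|yn] := nil_on_mul_homogeneous n0 gS fdM indec e1_pos e1n xi yj xyn.
    by left; exact: (proj2 (nilP i x xi Hx) xn).
  by right; exact: (proj2 (nilP j y yj Hy) yn).
have P_prop i x y : H x -> H y -> hh_part i x = x -> hh_part i y = y -> ~ P y ->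
    exists c : k, P (x - c *: y).
  move=> Hx Hy xi yi yP.
  have [|c cn] := proportional n0 gS fdM indec e1_pos e1n (Hcomm _ _ Hx Hy) xi yi.
    by move=> yn; apply: yP; exact: (proj2 (nilP i y yi Hy) yn).
  exists c; apply: (proj2 (nilP i _ _ _) cn); first exact: hh_degB xi (hh_degZ c yi).
  exact: (carrierB HZD Hx (carrierZ H1 HZD c Hy)).
have hP : ~ P h by move=> /(nilP s h hs Hh).
rewrite VE; split.
- exists (ann H M (mod_radical L)); last by rewrite -VE.
  by split; [exact: ann_ideal|exact: ann_homogeneous].
- exact: (curve_irreducible H1 HZD HM Hcomm (fun i x => Hhom i x) (@hh_partD k L) (@hh_partZ k L)
    (@hh_part_part k L) (@hh_sum_parts k L) (@hh_part_mul k L) (@hh_part_one k L)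
    Pi P1 P_part P_hom P_prop Hh hs s0 hP).
- exact: (curve_dimension H1 HZD HM Hcomm (fun i x => Hhom i x) (@hh_partD k L) (@hh_partZ k L)
    (@hh_part_part k L) (@hh_sum_parts k L) (@hh_part_mul k L) (@hh_part_one k L)
    Pi P1 P_part P_hom P_prop Hh hs s0 hP).
Qed.
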